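(* Let $p>2$, let $q\in\mathcal{C}^1(\mathbb{R}^N)$ be a bounded real potential, and let $V(\mathbb{R}^N)=H^2(\mathbb{R}^N)\cap L^p(\mathbb{R}^N)\cap\mathcal{C}(\mathbb{R}^N)$ (complex-valued functions). For every initial datum $u_0\in V_\Lambda(\mathbb{R}^N)$ the Cauchy problem, with $u(0)=u_0$, for the nonlinear Schrödinger equation $$i\,\partial_tu=-\tfrac12\Delta u+q(x)u-|u|^{p-2}u$$ has a unique generalized ultrafunction solution (GUS) $u\in\mathcal{C}^1(I^*,V_\Lambda(\mathbb{R}^N))$, $I=[0,T)$. Moreover, the energy $$E(u)=\int\left[\tfrac12|\nabla u|^2+q(x)|u|^2-\tfrac2p|u|^p\right]dx$$ and the $L^2$-norm are preserved along this solution.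
   Context: Nonstandard setting. $V_\infty(\mathbb{R})$ is the superstructure on $\mathbb{R}$ ($V_0=\mathbb{R}$, $V_{n+1}=V_n\cup\mathcal{P}(V_n)$, $V_\infty=\bigcup_nV_n$), $\mathfrak{L}$ is the set of its finite subsets ordered by inclusion, $\mathcal{U}$ is a fine ultrafilter on $\mathfrak{L}$ (i.e. $\{\mu:\lambda\subseteq\mu\}\in\mathcal{U}$ for all $\lambda\in\mathfrak{L}$). $\mathbb{R}^*=\mathbb{R}^{\mathfrak{L}}/\mathcal{U}$; for $\varphi:\mathfrak{L}\to\mathbb{R}$, $\lim_{\lambda\uparrow\Lambda}\varphi(\lambda)$ is its class; for $\varphi:\mathfrak{L}\to V_n(\mathbb{R})$, inductively $\lim_{\lambda\uparrow\Lambda}\varphi(\lambda)=\{\lim_{\lambda\uparrow\Lambda}\psi(\lambda):\psi(\lambda)\in\varphi(\lambda)\ \forall\lambda\}$. $E^*,f^*$ are natural extensions (limits of constant nets). Ultrafunctions. An approximating net for a function vector space $V$ is a family $(V_\lambda)_{\lambda\in\mathfrak{L}}$ of finite dimensional vector subspaces of $V$ (complex subspaces in the complex-valued case), increasing in $\lambda$, such that every finite dimensional subspace of $V$ is contained in some $V_\lambda$. The space of ultrafunctions it generates is $V_\Lambda=\lim_{\lambda\uparrow\Lambda}V_\lambda\subseteq V^*$. $\mathcal{C}^1(I^*,V_\Lambda)$ is the set of $u\in[\mathcal{C}^1(I,V)]^*$ with $u(t,\cdot),\partial_tu(t,\cdot)\in V_\Lambda$ for all $t\in I^*$. A GUS of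 a Cauchy problem $\partial_tu=\mathcal{A}(u)$, $u(0)=u_0$, with $\mathcal{A}:V\to V'$, is $u\in\mathcal{C}^1(I^*,V_\Lambda)$ such that, for all $t\in I^*$ and $v\in V_\Lambda$, the $L^2$-pairing of $\partial_tu$ with $v$ equals the (extended) duality pairing of $\mathcal{A}^*(u)$ with $v$, and $u(0)=u_0$. Here $\mathcal{A}(u)=-i\left(-\frac12\Delta u+q u-|u|^{p-2}u\right)$. The functionals $E$ and $\|\cdot\|_{L^2}$ are evaluated on ultrafunctions via their natural extensions. *)

(* Defs.v *)
From HB Require Import structures.
From mathcomp Require Import all_boot all_order all_algebra.
From mathcomp Require Import all_classical all_reals all_analysis.
From mathcomp Require Import complex.
Set Implicit Arguments.
Unset Strict Implicit.
Unset Printing Implicit Defensive.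
Import Order.TTheory GRing.Theory Num.Theory.
Import numFieldNormedType.Exports.
Local Open Scope classical_set_scope.
Local Open Scope ring_scope.
Local Open Scope complex_scope.

(* Since the levels increase, V_0 = R and V_{n+1} = R \cup P(V_n), where the
   union is disjoint because reals are not sets. *)
Fixpoint Vlevel (R : realType) (n : nat) : Type :=
  if n is n'.+1 then (R + set (Vlevel R n'))%type else R.

Fixpoint Vemb (R : realType) (n : nat) : Vlevel R n -> Vlevel R n.+1 :=
  match n return Vlevel R n -> Vlevel R n.+1 with
  | 0 => fun r => inl r
  | n'.+1 => fun x => match x with
                      | inl r => inl r
                      | inr A => inr ((@Vemb R n') @` A)
                      end
  end.

(* The union of the V_n: every element is represented exactly once, at the
   least level where it occurs. *)
Definition superstructure (R : realType) : Type :=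
  {x : {n & Vlevel R n} |
     ~ exists y : {n & Vlevel R n}, x = existT _ _ (Vemb (projT2 y))}.

Definition finsub (R : realType) : Type :=
  {l : set (superstructure R) | finite_set l}.

Definition le_finsub (R : realType) (l m : finsub R) : Prop :=
  sval l `<=` sval m.

Definition fine_filter (R : realType) (U : set_system (finsub R)) : Prop :=
  forall l : finsub R, U [set m | le_finsub l m].

Section Ultrapower.
Variables (R : realType) (U : set_system (finsub R)).
Local Notation L := (finsub R).

Definition ultra_class (X : Type) (phi : L -> X) : set (L -> X) :=
  [set psi | U [set l | psi l = phi l]].

(* X^L / U.  For X a set of the superstructure this is X^*, also when the
   elements of X are functions: two nets of functions have the same limit iff
   they agree on a set of U, so that limit is determined by the function
   [star_app] below. *)
Definition star (X : Type) : Type :=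
  {A : set (L -> X) | exists phi, A = ultra_class phi}.

Definition ulim (X : Type) (phi : L -> X) : star X :=
  exist _ (ultra_class phi) (ex_intro _ phi erefl).

Definition ulim_set (X : Type) (phi : L -> set X) : set (star X) :=
  [set xi | exists psi : L -> X, (forall l, phi l (psi l)) /\ xi = ulim psi].

Definition star_set (X : Type) (A : set X) : set (star X) :=
  ulim_set (fun=> A).

Definition star_cst (X : Type) (x : X) : star X := ulim (fun=> x).

(* When U is a filter, the functions defined from [net] do not depend on the
   chosen representative. *)
Definition net (X : Type) (xi : star X) : L -> X := projT1 (cid (svalP xi)).

Definition star_fun (X Y : Type) (f : X -> Y) (xi : star X) : star Y :=
  ulim (fun l => f (net xi l)).

Definition star_fun2 (X Y Z : Type) (f : X -> Y -> Z)
    (xi : star X) (eta : star Y) : star Z :=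
  ulim (fun l => f (net xi l) (net eta l)).

(* A limit of functions, seen as a function on X^* *)
Definition star_app (X Y : Type) : star (X -> Y) -> star X -> star Y :=
  star_fun2 (fun f x => f x).

End Ultrapower.

Arguments ulim {R} U {X} phi.
Arguments ulim_set {R} U {X} phi.
Arguments star_set {R} U {X} A.
Arguments star_cst {R} U {X} x.

Section Lebesgue.
Variable R : realType.
Local Notation mR := (measurableTypeR R).

Definition cons_pair (n : nat) (x : mR * n.-tuple mR) : n.+1.-tuple mR :=
  [tuple of x.1 :: x.2].

Lemma measurable_cons_pair n : measurable_fun setT (@cons_pair n).
Proof.
exact: (measurable_cons (@measurable_fst _ _ _ _) (@measurable_snd _ _ _ _)).
Qed.

Definition leb1 : {sigma_finite_measure set mR -> \bar R} := @lebesgue_measure R.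

Section Step.
Variables (n : nat) (m : {sigma_finite_measure set (n.-tuple mR) -> \bar R}).

Definition lebesgue_step : set (n.+1.-tuple mR) -> \bar R :=
  pushforward (leb1 \x m)%E (@cons_pair n).

HB.instance Definition _ := Measure.copy lebesgue_step
  (measure_function_pushforward__canonical__measure_function_Measure
     (leb1 \x m)%E (@measurable_cons_pair n)).

Lemma lebesgue_step_sigma_finite : sigma_finite setT lebesgue_step.
Proof.
have /sigma_finiteP[F [FT ndF Foo]] := sigma_finiteT leb1.
have /sigma_finiteP[G [GT ndG Goo]] := sigma_finiteT m.
pose g (t : n.+1.-tuple mR) : mR * n.-tuple mR := (thead t, [tuple of behead t]).
have mg : measurable_fun setT g.
  apply: measurable_fun_pair; last exact: measurable_behead.
  exact: (@measurable_tnth _ mR n.+1 ord0).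
have gK : g \o @cons_pair n = id.
  by apply/funext => -[x t]; rewrite /g/=; congr pair; apply/val_inj.
have mFG i : measurable (F i `*` G i).
  by apply: measurableX; [exact: (Foo i).1|exact: (Goo i).1].
exists (fun i => g @^-1` (F i `*` G i)).
  rewrite -preimage_bigcup -[LHS](preimage_setT g); congr (_ @^-1` _).
  rewrite -setXTT FT GT predeqE => -[x y]; split.
    move=> [/= [i _ Fx] [j _ Gy]]; exists (maxn i j) => //; split.
    - by move: x Fx; exact/subsetPset/ndF/leq_maxl.
    - by move: y Gy; exact/subsetPset/ndG/leq_maxr.
  by move=> [i _ []/= ? ?]; split; exists i.
move=> i; split; first by rewrite -[X in measurable X]setTI; exact: mg.
rewrite /lebesgue_step /pushforward -comp_preimage gK preimage_id.
have [? ?] := Foo i; have [? ?] := Goo i.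
by rewrite product_measure1E// lte_mul_pinfty// ge0_fin_numE.
Qed.

HB.instance Definition _ := @Measure_isSigmaFinite.Build _ _ _
  lebesgue_step lebesgue_step_sigma_finite.

Definition lebesgue_stepM : {sigma_finite_measure set (n.+1.-tuple mR) -> \bar R} :=
  lebesgue_step.
End Step.

Fixpoint lebesgueN (n : nat) : {sigma_finite_measure set (n.-tuple mR) -> \bar R} :=
  if n is n'.+1 then lebesgue_stepM (lebesgueN n') else \d_([tuple]).

End Lebesgue.

Section Spaces.
Variables (R : realType) (N : nat).
Local Notation mR := (measurableTypeR R).
Local Notation E := 'rV[R]_N.
Local Notation F := (E -> R[i]).
Local Notation cnorm := (@ComplexField.Normc.normc R).
Local Notation leb := (lebesgueN R N).

(* [lebesgueN] lives on tuples, which carry the product sigma-algebra; the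
   topology and the derivatives live on row vectors. *)
Definition pt (t : N.-tuple mR) : E := \row_i tnth t i.

Definition rintegral (f : E -> R) : R := \int[leb]_t f (pt t).

Definition cintegral (f : F) : R[i] :=
  rintegral (fun x => complex.Re (f x)) +i* rintegral (fun x => complex.Im (f x)).

(* Hermitian, conjugate-linear in the second (test) argument *)
Definition L2pair (f g : F) : R[i] := cintegral (fun x => f x * conjc (g x)).

Definition Lp_norm (p : R) (f : F) : R :=
  fine (Lnorm leb p%:E (fun t => (cnorm (f (pt t)))%:E)).

Definition Lp (p : R) : set F :=
  [set f | [/\ measurable_fun setT (fun t : N.-tuple mR => complex.Re (f (pt t)) : mR),
               measurable_fun setT (fun t : N.-tuple mR => complex.Im (f (pt t)) : mR) &
               (Lnorm leb p%:E (fun t => (cnorm (f (pt t)))%:E) < +oo)%E]].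

Fixpoint is_Ck (k : nat) (f : E -> R) : Prop :=
  if k is k'.+1 then
    continuous f /\
    forall i : 'I_N, (forall x, derivable f x (delta_mx 0 i)) /\
                     is_Ck k' (fun x => 'D_(delta_mx 0 i) f x)
  else continuous f.

Definition test_function (f : E -> R) : Prop :=
  (forall k, is_Ck k f) /\ compact (closure [set x | f x != 0]).

Definition is_weakD (i : 'I_N) (f g : F) : Prop :=
  forall phi : E -> R, test_function phi ->
    cintegral (fun x => f x * ('D_(delta_mx 0 i) phi x)%:C) =
    - cintegral (fun x => g x * (phi x)%:C).

Fixpoint Hk (k : nat) : set F :=
  if k is k'.+1 then
    [set f | Lp 2 f /\ forall i, exists g, is_weakD i f g /\ Hk k' g]
  else Lp 2.

(* Some L^2 representative of the weak derivative; it is unique up to a null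
   set. *)
Definition weakD (i : 'I_N) (f : F) : F :=
  xget 0 [set g | Lp 2 g /\ is_weakD i f g].

Definition laplacian (f : F) : F := \sum_i weakD i (weakD i f).

Definition H2_norm (f : F) : R :=
  Num.sqrt (Lp_norm 2 f ^+ 2 + \sum_i Lp_norm 2 (weakD i f) ^+ 2 +
            \sum_i \sum_j Lp_norm 2 (weakD i (weakD j f)) ^+ 2).

Definition ccontinuous (f : F) : Prop :=
  continuous (fun x => complex.Re (f x)) /\ continuous (fun x => complex.Im (f x)).

Definition Vspace (p : R) : set F :=
  [set f | [/\ Hk 2 f, Lp p f & ccontinuous f]].

(* The increasing sequence of norms defining the natural (Frechet) topology of
   the intersection, C(R^N) carrying uniform convergence on compact sets *)
Definition Vnorm (p : R) (k : nat) (f : F) : R :=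
  H2_norm f + Lp_norm p f + sup [set cnorm (f x) | x in [set x : E | `|x| <= k%:R]].

Definition findim_subspace (W : set F) : Prop :=
  exists n (b : 'I_n -> F),
    W = [set f | exists c : 'I_n -> R[i], f = \sum_i c i *: b i].

Definition approximating_net (V : set F) (Vn : finsub R -> set F) : Prop :=
  [/\ forall l, findim_subspace (Vn l) /\ Vn l `<=` V,
      forall l m, le_finsub l m -> Vn l `<=` Vn m &
      forall W, findim_subspace W -> W `<=` V -> exists l, W `<=` Vn l].

Definition itime (T : \bar R) : Type := {t : R | (0 <= t) && (t%:E < T)%E}.

Lemma itime0_subproof (T : \bar R) (hT : (0 < T)%E) :
  ((0 : R) <= 0) && ((0 : R)%:E < T)%E.
Proof. by rewrite lexx. Qed.

Definition itime0 (T : \bar R) (hT : (0 < T)%E) : itime T :=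
  exist _ 0 (itime0_subproof hT).

Section Cauchy.
Variables (V : set F) (nu : nat -> F -> R) (T : \bar R).
Local Notation I := (itime T).

(* f(s) -> w as s -> t, s <> t, for the topology defined by the norms nu k *)
Definition cvg_in (f : I -> F) (t : I) (w : F) : Prop :=
  forall k (e : R), 0 < e -> exists2 d : R, 0 < d &
    forall s : I, sval s != sval t -> `|sval s - sval t| < d ->
      nu k (f s - w) < e.

(* One-sided at t = 0 *)
Definition is_dtime (f : I -> F) (t : I) (w : F) : Prop :=
  V w /\ cvg_in (fun s => ((sval s - sval t)^-1)%:C *: (f s - f t)) t w.

Definition dtime (f : I -> F) (t : I) : F := xget 0 [set w | is_dtime f t w].

Definition C1 : set (I -> F) :=
  [set f | [/\ forall t, V (f t), forall t, exists w, is_dtime f t w &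
               forall t, cvg_in (dtime f) t (dtime f t)]].

Variables (U : set_system (finsub R)) (VL : set (star U F)).

Definition C1_ultra : set (star U (I -> F)) :=
  [set u | star_set U C1 u /\
    forall t : star U I, VL (star_app u t) /\ VL (star_app (star_fun dtime u) t)].

(* The dual of V is represented by functionals on F. *)
Definition is_GUS (A : F -> (F -> R[i])) (t0 : I) (u0 : star U F)
    (u : star U (I -> F)) : Prop :=
  [/\ C1_ultra u,
      forall (t : star U I) (v : star U F), VL v ->
        star_fun2 L2pair (star_app (star_fun dtime u) t) v =
        star_app (star_fun A (star_app u t)) v &
      star_app u (star_cst U t0) = u0].
End Cauchy.

(* For u in V, A(u) lies in L^2 + L^{p'} and its duality pairing with v in V
   is the integral extending the L^2-pairing. *)
Definition nls_op (q : E -> R) (p : R) (u : F) : F -> R[i] :=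
  L2pair (fun x => - (0 +i* 1) * (- (2^-1 * laplacian u x) + (q x)%:C * u x
                           - (cnorm (u x) `^ (p - 2))%:C * u x)).

Definition energy (q : E -> R) (p : R) (u : F) : R :=
  rintegral (fun x => 2^-1 * (\sum_i cnorm (weakD i u x) ^+ 2)
                      + q x * cnorm (u x) ^+ 2
                      - 2 / p * (cnorm (u x) `^ p)).

End Spaces.

(* Main.v *)
(* On a finite dimensional level W of the net, the equation is the Galerkin system
   Re <u_t, v> = h(u; i v) for v in W, where h(u; .) = Re <- Delta u / 2 + q u - |u|^(p-2) u, .>.
   In a basis of W orthonormal for Re <., .> it is an ordinary differential equation
   c' = G(c) with G locally Lipschitz. Since h(u; i u) = 0, the field G is tangent to
   the spheres: the L^2-norm is conserved and the solution is global. Since 2 h(u; .) is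
   the derivative of the energy, testing with v = - i u_t shows that the energy is
   conserved. On W the norms of V are equivalent to the Euclidean norm of the coordinates,
   which is the L^2-norm, so that C^1 curves in W for the topology of V are the curves
   with C^1 coordinates, and the level solution is unique. The ultrafunction
   solution is the limit of the level solutions. Conversely, a GUS satisfies the level
   problem for almost every level: otherwise choosing a counterexample (t, v) at each
   failing level would give a counterexample in the limit. *)
Require Import Defs.
From mathcomp Require Import all_boot all_order all_algebra.
From mathcomp Require Import all_classical all_reals all_analysis.
From mathcomp Require Import complex.
From mathcomp Require Import measurable_realfun ring lra.
Set Implicit Arguments.
Unset Strict Implicit.
Unset Printing Implicit Defensive.
Import Order.TTheory GRing.Theory Num.Theory.
Import numFieldNormedType.Exports.
Local Open Scope classical_set_scope.
Local Open Scope ring_scope.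

(** The obstacle lies on the space side: elements of V are functions and not classes, [weakD]
    selects one representative, and neither the symmetry of the Laplacian nor the differentiability
    of the energy comes for free. Symmetry is integration by parts between two weak derivatives; it
    is obtained from translations, since [<f(. + h e_i), g>] can be expanded in h on either factor,
    without density of smooth functions. The energy is not differentiated under the integral:
    convexity bounds the remainder of [|u|^p] from both sides, and on a fixed span every error is a
    constant times [Sfun ^ p], an integrable function that depends on the basis alone. Such a
    quadratic remainder suffices for a chain rule along the coordinates. Continuity of the elements
    of V makes the L^2 form definite, so that an orthonormal basis of functions exists. A level is a
    complex space treated as a real one: its closure under multiplication by i recovers the
    imaginary part of the equation from the real part. The differential equation is solved for a
    cutoff field that keeps the orthogonality; the conservation law of this field then confines its
    solutions to the region where nothing was cut. *)

(** * Integrable and square integrable real functions *)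

Section IntegrationToolkit.
Context d (T : measurableType d) (R : realType) (m : {measure set T -> \bar R}).
Implicit Types f g h : T -> R.

Definition itg f := m.-integrable setT (EFin \o f).

Lemma itg_measurable f : itg f -> measurable_fun setT f.
Proof. by move=> /measurable_int/measurable_EFinP. Qed.

Lemma itg_le f g : measurable_fun setT f -> (forall x, `|f x| <= g x) ->
  itg g -> itg f.
Proof.
move=> mf fg; apply: le_integrable => //; first exact/measurable_EFinP.
move=> x _ /=; rewrite lee_fin (le_trans (fg x))//.
by rewrite ler_norm.
Qed.

Lemma itgD f g : itg f -> itg g -> itg (fun x => f x + g x).
Proof. by move=> fi gi; exact: (integrableD measurableT fi gi). Qed.

Lemma itgZ (r : R) f : itg f -> itg (fun x => r * f x).
Proof. by move=> fi; exact: (integrableZl measurableT r fi). Qed.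

Lemma itgN f : itg f -> itg (fun x => - f x).
Proof. by move=> fi; exact: (integrableN fi). Qed.

Lemma itgB f g : itg f -> itg g -> itg (fun x => f x - g x).
Proof. by move=> fi /itgN gi; exact: itgD. Qed.

Lemma itg_norm f : itg f -> itg (fun x => `|f x|).
Proof. exact: integrable_norm. Qed.

Lemma itg0 : itg (fun=> 0).
Proof. exact: integrable0. Qed.

Lemma itg_sum (I : Type) (s : seq I) (F : I -> T -> R) :
  (forall i, itg (F i)) -> itg (fun x => \sum_(i <- s) F i x).
Proof.
move=> Fi; elim: s => [|a s IH].
  by rewrite (_ : (fun _ => _) = fun=> 0); [exact: itg0|apply/funext => x; rewrite big_nil].
rewrite (_ : (fun _ => _) = fun x => F a x + \sum_(i <- s) F i x); first exact: itgD.
by apply/funext => x; rewrite big_cons.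
Qed.

Lemma Rint_sum (I : Type) (s : seq I) (F : I -> T -> R) :
  (forall i, itg (F i)) ->
  \int[m]_x (\sum_(i <- s) F i x) = \sum_(i <- s) \int[m]_x F i x.
Proof.
move=> Fi; elim: s => [|a s IH].
  rewrite big_nil; under eq_Rintegral do rewrite big_nil.
  by rewrite /Rintegral integral0.
rewrite big_cons -IH -RintegralD//; [|exact: Fi|exact: itg_sum].
by apply: eq_Rintegral => x _; rewrite big_cons.
Qed.

Lemma Rint_ae f g : measurable_fun setT f -> measurable_fun setT g ->
  {ae m, forall x, f x = g x} -> \int[m]_x f x = \int[m]_x g x.
Proof.
move=> mf mg fg; rewrite /Rintegral; congr fine.
apply: ae_eq_integral => //; try exact/measurable_EFinP.
by apply: filterS fg => x /= ->.
Qed.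

Lemma itg_ae f g : measurable_fun setT g ->
  {ae m, forall x, f x = g x} -> itg f -> itg g.
Proof.
move=> mg fg fi; have mf := itg_measurable fi.
move/integrableP: (fi) => [_ fioo]; apply/integrableP; split.
  exact/measurable_EFinP.
suff <- : (\int[m]_x `|(EFin \o f) x| = \int[m]_x `|(EFin \o g) x|)%E by [].
apply: ae_eq_integral => //.
- by apply: measurableT_comp => //; exact/measurable_EFinP.
- by apply: measurableT_comp => //; exact/measurable_EFinP.
- by apply: filterS fg => x /= ->.
Qed.

Lemma Rint_EFin f : itg f -> (\int[m]_x (f x)%:E = (\int[m]_x f x)%:E)%E.
Proof. by move=> fi; rewrite /Rintegral fineK//; exact: integrable_fin_num. Qed.

Lemma Rint_le f g : itg f -> itg g -> (forall x, f x <= g x) ->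
  \int[m]_x f x <= \int[m]_x g x.
Proof. by move=> fi gi fg; exact: le_Rintegral. Qed.

Lemma Rint_bound f g : itg f -> itg g -> (forall x, `|f x| <= g x) ->
  `|\int[m]_x f x| <= \int[m]_x g x.
Proof.
move=> fi gi fg; apply: le_trans (le_normr_Rintegral _ fi) _ => //.
by apply: Rint_le => //; exact: itg_norm.
Qed.

Definition L2r f := measurable_fun setT f /\ itg (fun x => f x ^+ 2).

Lemma L2r_mul f g : L2r f -> L2r g -> itg (fun x => f x * g x).
Proof.
move=> [mf fi] [mg gi]; apply: (@itg_le _ (fun x => f x ^+ 2 + g x ^+ 2)).
- exact: measurable_funM.
- by move=> x; rewrite normrM; case: (ger0P (f x)); case: (ger0P (g x)) => ? ?; nra.
- exact: itgD.
Qed.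

Lemma L2r_le f g : measurable_fun setT f -> (forall x, `|f x| <= `|g x|) -> L2r g -> L2r f.
Proof.
move=> mf fg [mg gi]; split => //; apply: (@itg_le _ (fun x => g x ^+ 2)) => //.
- exact: measurable_funX.
- by move=> x; rewrite normrX -(real_normK (num_real (g x))) ler_sqr ?nnegrE//; exact: fg.
Qed.

Lemma L2rZ (r : R) f : L2r f -> L2r (fun x => r * f x).
Proof.
move=> [mf fi]; split; first exact: measurable_funM.
rewrite (_ : (fun _ => _) = fun x => r ^+ 2 * f x ^+ 2); first exact: itgZ.
by apply/funext => x; rewrite exprMn.
Qed.

Lemma L2rN f : L2r f -> L2r (fun x => - f x).
Proof.
by move=> /(L2rZ (-1)); congr L2r; apply/funext => x; rewrite mulN1r.
Qed.

Lemma L2rD f g : L2r f -> L2r g -> L2r (fun x => f x + g x).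
Proof.
move=> Lf Lg; split; first exact: measurable_funD Lf.1 Lg.1.
rewrite (_ : (fun _ => _) = fun x => f x ^+ 2 + f x * g x *+ 2 + g x ^+ 2); last first.
  by apply/funext => x; rewrite sqrrD.
apply: itgD Lg.2; apply: itgD Lf.2 _.
rewrite (_ : (fun _ => _) = fun x => 2 * (f x * g x)).
  exact/itgZ/L2r_mul.
by apply/funext => x; rewrite mulr_natl.
Qed.

Lemma L2rB f g : L2r f -> L2r g -> L2r (fun x => f x - g x).
Proof. by move=> Lf /L2rN Lg; exact: L2rD. Qed.

Lemma L2r0 : L2r (fun=> 0).
Proof.
split; first exact: measurable_cst.
by rewrite (_ : (fun _ => _) = fun=> 0); [exact: itg0|apply/funext => x; rewrite expr0n].
Qed.

(** The pointwise bound [|x y| <= x^2 + y^2] takes the place of the Cauchy-Schwarz inequality; the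
    estimates of translates need only some finite constant. *)
Lemma Rint_mul_bound f g : L2r f -> L2r g ->
  `|\int[m]_x (f x * g x)| <= \int[m]_x (f x ^+ 2) + \int[m]_x (g x ^+ 2).
Proof.
move=> Lf Lg; rewrite -RintegralD//; [|exact: Lf.2|exact: Lg.2].
apply: Rint_bound; [exact: L2r_mul|exact: itgD Lf.2 Lg.2|].
by move=> x; rewrite normrM; case: (ger0P (f x)); case: (ger0P (g x)) => ? ?; nra.
Qed.

Lemma Rint_dct (f_ : nat -> T -> R) f g : (forall n, measurable_fun setT (f_ n)) ->
  (forall x, f_ n x @[n --> \oo] --> f x) -> itg g ->
  (forall n x, `|f_ n x| <= g x) ->
  itg f /\ (\int[m]_x f_ n x @[n --> \oo] --> \int[m]_x f x).
Proof.
move=> mf_ ff gi fg.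
have mf : measurable_fun setT f by apply: measurable_fun_cvg mf_ _ => x _; exact: ff.
have [fi _ cvgi] : [/\ itg f,
    (\int[m]_x `|(EFin \o f_ n) x - (EFin \o f) x| @[n --> \oo] --> 0)%E &
    (\int[m]_x (EFin \o f_ n) x @[n --> \oo] --> \int[m]_x (EFin \o f) x)%E].
  apply: (@dominated_convergence _ T R m setT measurableT
    (fun n => EFin \o f_ n) (EFin \o f) (EFin \o g)) => //.
  - by move=> n; exact/measurable_EFinP.
  - exact/measurable_EFinP.
  - by apply: aeW => x _ /=; apply: cvg_EFin; [exact: nearW|exact: ff].
  - by apply: aeW => x n _ /=; rewrite lee_fin; exact: fg.
split => //; apply: fine_cvg.
by have := Rint_EFin fi => /= <-.
Qed.

Lemma Rint_dct0 (f_ : nat -> T -> R) f g : (forall n, measurable_fun setT (f_ n)) ->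
  (forall x, f_ n x @[n --> \oo] --> f x) -> itg g ->
  (forall n x, `|f_ n x| <= g x) ->
  (forall n, \int[m]_x f_ n x = 0) -> \int[m]_x f x = 0.
Proof.
move=> mf_ ff gi fg f0; have [_] := Rint_dct mf_ ff gi fg.
under eq_fun do rewrite f0.
by move=> /cvg_lim; rewrite lim_cst// => <-.
Qed.

Lemma itg_indic f (A : set T) : measurable A -> itg f -> itg (fun x => f x * \1_A x).
Proof.
move=> mA fi; apply: (@itg_le _ (fun x => `|f x|)); last exact: itg_norm.
- apply: measurable_funM; [exact: itg_measurable|exact: measurable_indic].
- by move=> x; rewrite normrM ler_piMr// indicE; case: (_ \in _); rewrite ?normr1 ?normr0.
Qed.

Lemma Rint_norm0 f : itg f -> \int[m]_x `|f x| = 0 -> {ae m, forall x, f x = 0}.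
Proof.
move=> fi f0.
have : ae_eq m setT (EFin \o f) (cst 0%E).
  apply/ae_eq_integral_abs => //; first exact: measurable_int fi.
  by have := Rint_EFin (itg_norm fi); rewrite f0.
by apply: filterS => x /= /(_ I)[].
Qed.

End IntegrationToolkit.

(** * Lebesgue measure on tuples *)

Section LebesgueN.
Variable R : realType.
Local Notation mR := (measurableTypeR R).

Definition box n (a b : 'I_n -> R) : set (n.-tuple mR) :=
  [set t | forall i, a i < tnth t i < b i].

Lemma measurable_box n (a b : 'I_n -> R) : measurable (box a b).
Proof.
have -> : box a b = \bigcap_(i in [set: 'I_n]) ((fun t : n.-tuple mR => tnth t i) @^-1` `]a i, b i[%classic).
  apply/seteqP; split => t /=.
    by move=> h i _ /=; rewrite in_itv /=; exact: h.
  by move=> h i; have /= := h i I; rewrite in_itv.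
apply: fin_bigcap_measurable => // i _.
rewrite -[X in measurable X]setTI; exact: (@measurable_tnth _ mR n i).
Qed.

(** Induction on the dimension through the product measure. The maximum with 0 accounts for empty
    boxes; in dimension 0 the empty product 1 is the Dirac mass of the only tuple. *)
Lemma lebesgueN_box n (a b : 'I_n -> R) :
  lebesgueN R n (box a b) = (\prod_i Num.max 0 (b i - a i))%:E.
Proof.
elim: n a b => [|n IH] a b.
  rewrite big_ord0 /=.
  rewrite diracE mem_set//.
  by move=> [].
rewrite big_ord_recl /= /lebesgue_step /pushforward.
have -> : @cons_pair R n @^-1` (box a b) =
    `]a ord0, b ord0[%classic `*` box (a \o lift ord0) (b \o lift ord0).
  apply/seteqP; split => -[x t] /= => [h|[h1 h2] i].
    split; first by have := h ord0; rewrite in_itv /= /cons_pair /= tnth0.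
    by move=> i; have := h (lift ord0 i); rewrite /cons_pair /= tnthS.
  case: (unliftP ord0 i) => [j ->|->].
    by rewrite /cons_pair /= tnthS; exact: h2.
  by move: h1; rewrite in_itv /= /cons_pair /= tnth0.
rewrite product_measure1E; [|exact: measurable_itv|exact: measurable_box].
rewrite IH EFinM; congr (_ * _)%E.
rewrite [LHS]lebesgue_measure_itv /= lte_fin.
case: ltP => ab; first by rewrite max_r ?subr_ge0 ?ltW// EFinB.
by rewrite max_l// subr_le0.
Qed.

Lemma boxI n (a b a' b' : 'I_n -> R) :
  box a b `&` box a' b' = box (fun i => Num.max (a i) (a' i)) (fun i => Num.min (b i) (b' i)).
Proof.
apply/seteqP; split => t /= => [[h h'] i|h].
  by rewrite gt_max lt_min; have /andP[-> ->] := h i; have /andP[-> ->] := h' i.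
by split => i; have := h i; rewrite gt_max lt_min => /andP[/andP[? ?] /andP[? ?]]; apply/andP.
Qed.

Definition boxes n : set_system (n.-tuple mR) := [set A | exists a b, A = box a b].
Definition bbox n (k : nat) : set (n.-tuple mR) := box (fun=> - k%:R) (fun=> k%:R).

Lemma bbox_cover n (t : n.-tuple mR) : \forall k \near \oo, bbox k t.
Proof.
pose M := \sum_i `|tnth t i|.
near=> k => i.
have ltM : M < k%:R.
  by near: k; exact: nbhs_infty_gtr.
rewrite -ltr_norml (le_lt_trans _ ltM)// /M (bigD1 i)//= lerDl.
exact: sumr_ge0.
Unshelve. all: by end_near. Qed.

Lemma bbox_bigcup n : \bigcup_k (@bbox n k) = setT.
Proof.
apply/seteqP; split => // t _.
have [k _ /(_ k (leqnn k)) tk] := bbox_cover t.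
by exists k.
Qed.

Lemma setI_closed_boxes n : setI_closed (@boxes n).
Proof. by move=> _ _ [a [b ->]] [a' [b' ->]]; rewrite boxI; do 2 eexists. Qed.

(** The identity is measurable from the sigma-algebra generated by boxes, because a half-space
    [x < t_i] is a countable union of boxes whose i-th side starts at [x] while the other sides
    grow. *)
Lemma measurable_boxes n : @measurable _ (n.-tuple mR) = <<s @boxes n >>.
Proof.
apply/seteqP; split; last first.
  apply: smallest_sub; first exact: sigma_algebra_measurable.
  by move=> _ [a [b ->]]; exact: measurable_box.
have : measurable_fun (setT : set (g_sigma_algebraType (@boxes n))) (id : _ -> n.-tuple mR).
  apply/measurable_fun_tnthP => i.
  suff : measurable_fun (setT : set (g_sigma_algebraType (@boxes n)))
    (fun t : n.-tuple mR => tnth t i : mR) by [].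
  apply: (measurability (@RGenOInfty.G R)) => [|/= _ [_] [x] -> <-].
    exact: RGenOInfty.measurableE.
  rewrite setTI.
  have -> : (fun t : n.-tuple mR => tnth t i : mR) @^-1` `]x, +oo[%classic =
      \bigcup_k (box (fun j => if j == i then x else - k%:R) (fun=> k%:R)).
    apply/seteqP; split => t /=; rewrite in_itv /= andbT.
      move=> xt; have [k _ /(_ k (leqnn k)) tk] := bbox_cover t.
      exists k => // j; case: eqP => [->|_]; last exact: tk.
      by rewrite xt; have /andP[] := tk i.
    by move=> [k _ /(_ i)]; rewrite eqxx => /andP[].
  apply: bigcupT_measurable => k; apply: sub_sigma_algebra.
  by do 2 eexists; reflexivity.
by move=> /(_ measurableT) + A mA => /(_ A mA); rewrite setTI.
Qed.

(** Boxes form a generating pi-system, and the boxes [bbox k] of finite measure exhaust the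
    space. *)
Lemma lebesgueN_unique n (m : {measure set (n.-tuple mR) -> \bar R}) :
  (forall a b, m (box a b) = lebesgueN R n (box a b)) ->
  forall A, measurable A -> m A = lebesgueN R n A.
Proof.
move=> mb A mA; apply: (@measure_unique _ R _ (@boxes n) (@bbox n)) => //.
- exact: measurable_boxes.
- exact: setI_closed_boxes.
- by move=> k; do 2 eexists; reflexivity.
- exact: bbox_bigcup.
- by move=> _ [a [b ->]].
- by move=> k; rewrite mb /bbox lebesgueN_box ltry.
Qed.

Definition trans n (v : 'I_n -> R) (t : n.-tuple mR) : n.-tuple mR :=
  [tuple tnth t i + v i | i < n].

Lemma measurable_trans n (v : 'I_n -> R) : measurable_fun setT (trans v).
Proof.
apply/measurable_fun_tnthP => i.
rewrite (_ : _ \o _ = fun t : n.-tuple mR => tnth t i + v i); last first.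
  by apply/funext => t /=; rewrite tnth_mktuple.
apply: measurable_funD; last exact: measurable_cst.
exact: (@measurable_tnth _ mR n i).
Qed.

(** The image measure under a translation agrees with Lebesgue measure on boxes, hence
    everywhere. *)
Lemma lebesgueN_trans n (v : 'I_n -> R) A : measurable A ->
  lebesgueN R n (trans v @^-1` A) = lebesgueN R n A.
Proof.
move=> mA; rewrite -[LHS]/(pushforward (lebesgueN R n) (trans v) A).
have mt := @measurable_trans n v.
pose m : {measure set (n.-tuple mR) -> \bar R} :=
  measure_function_pushforward__canonical__measure_function_Measure (lebesgueN R n) mt.
rewrite -[LHS]/(m A); apply: lebesgueN_unique => // a b.
rewrite /m /= /pushforward.
have -> : trans v @^-1` (box a b) = box (fun i => a i - v i) (fun i => b i - v i).
  apply/seteqP; split => t /= h i; have := h i;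
    by rewrite tnth_mktuple ltrBlDr ltrBrDr.
by rewrite !lebesgueN_box; congr (_%:E); apply: eq_bigr => i _; rewrite opprB addrA subrK.
Qed.

Lemma itg_trans n (v : 'I_n -> R) (f : n.-tuple mR -> R) :
  itg (lebesgueN R n) f -> itg (lebesgueN R n) (f \o trans v) /\
  \int[lebesgueN R n]_t f (trans v t) = \int[lebesgueN R n]_t f t.
Proof.
move=> fi; have mf := itg_measurable fi; have mt := @measurable_trans n v.
have E (g : n.-tuple mR -> \bar R) : measurable_fun setT g -> (forall t, 0 <= g t)%E ->
    (\int[lebesgueN R n]_t g (trans v t) = \int[lebesgueN R n]_t g t)%E.
  move=> mg g0; rewrite -[LHS](@ge0_integral_pushforward _ _ _ _ _ _ mt (lebesgueN R n) setT g)//.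
  by apply: eq_measure_integral => A mA _; exact: lebesgueN_trans.
have fit : itg (lebesgueN R n) (f \o trans v).
  move/integrableP : fi => [_ foo]; apply/integrableP; split.
    by apply/measurable_EFinP; exact: measurableT_comp.
  rewrite -E in foo => //.
  by apply: measurableT_comp => //; exact/measurable_EFinP.
split => //; rewrite /Rintegral; congr fine.
rewrite integralE [RHS]integralE.
rewrite -(E ((EFin \o f)^\+)%E) -?(E ((EFin \o f)^\-)%E)//.
- by congr (_ - _)%E; apply: eq_integral => t _; rewrite unlock.
- by apply: measurable_funeneg; exact/measurable_EFinP.
- by apply: measurable_funepos; exact/measurable_EFinP.
Qed.

Local Notation leb n := (lebesgueN R n).

(** Weaker than square integrability on purpose: it is checked for [avg] by pairing with indicators
    of boxes, without an L^2 bound on [avg] itself. *)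
Definition locint n (h : n.-tuple mR -> R) :=
  measurable_fun setT h /\ forall a b, itg (leb n) (fun t => h t * \1_(box a b) t).

Lemma L2r_locint n (h : n.-tuple mR -> R) : L2r (leb n) h -> locint h.
Proof.
move=> Lh; split; first exact: Lh.1.
move=> a b; apply: L2r_mul => //; split.
  by apply: measurable_indic; exact: measurable_box.
rewrite (_ : (fun _ => _) = \1_(box a b)); last first.
  by apply/funext => t; rewrite indicE; case: (_ \in _); rewrite ?expr1n ?expr0n.
have mb := measurable_box a b.
apply/integrableP; split; first by apply/measurable_EFinP; exact: measurable_indic.
under eq_integral do rewrite /= ger0_norm//.
by rewrite integral_indic// setIT -[X in (X < _)%E]/(lebesgueN R n (box a b)) lebesgueN_box ltry.
Qed.

(** On a bounded box, the sets over which [g] has integral 0 form a lambda-system containing the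
    pi-system of boxes, hence all measurable sets; the sets where [g] has constant sign then give
    the integral of [|g|]. *)
Lemma locint_box0_ae n (h : n.-tuple mR -> R) : locint h ->
  (forall a b, \int[leb n]_t (h t * \1_(box a b) t) = 0) ->
  {ae leb n, forall t, h t = 0}.
Proof.
move=> [mh hi] h0.
suff hk k : {ae leb n, forall t, h t * \1_(@bbox n k) t = 0}.
  have : {ae leb n, forall t, forall k, h t * \1_(@bbox n k) t = 0}.
    exact/ae_foralln.
  apply: filterS => t ht.
  have : (\bigcup_k @bbox n k) t by rewrite bbox_bigcup.
  by move=> [k _ tk]; have := ht k; rewrite indicE mem_set// mulr1.
pose g t := h t * \1_(@bbox n k) t.
have gi : itg (leb n) g by exact: hi.
have mg := itg_measurable gi.
pose H := [set A | measurable A /\ \int[leb n]_t (g t * \1_A t) = 0].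
have boxesH : @boxes n `<=` H.
  move=> _ [a [b ->]]; split; first exact: measurable_box.
  rewrite -[RHS](h0 (fun i => Num.max (- k%:R) (a i)) (fun i => Num.min k%:R (b i))).
  apply: eq_Rintegral => t _; rewrite /g -mulrA; congr (_ * _).
  by rewrite -boxI indicI.
(* Closure of [H] under pointwise limits of indicators, by dominated convergence with bound [|g|];
   it serves both the whole space and increasing unions. *)
have dctH (F : nat -> set (n.-tuple mR)) A : (forall i, H (F i)) ->
    (forall t, \1_(F i) t @[i --> \oo] --> (\1_A t : R)) -> \int[leb n]_t (g t * \1_A t) = 0.
  move=> HF FA; apply: (@Rint_dct0 _ _ _ _ (fun i t => g t * \1_(F i) t) _ (fun t => `|g t|)).
  - by move=> i; apply: measurable_funM => //; apply: measurable_indic; exact: (HF i).1.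
  - by move=> t; apply: cvgM; [exact: cvg_cst|exact: FA].
  - exact: itg_norm.
  - by move=> i t; rewrite normrM ler_piMr// indicE; case: (_ \in _); rewrite ?normr1 ?normr0.
  - by move=> i; exact: (HF i).2.
have lamH : lambda_system setT H.
  split => //.
  - split=> //; apply: (dctH (fun k => @bbox n k)).
      by move=> i; apply: boxesH; do 2 eexists; reflexivity.
    move=> t; rewrite indicT; apply: cvg_near_cst.
    have := bbox_cover t; apply: filterS => i ti.
    by rewrite indicE mem_set.
  - move=> A B BA [mA A0] [mB B0]; split; first exact: measurableD.
    transitivity (\int[leb n]_t (g t * \1_A t - g t * \1_B t)); last first.
      by rewrite RintegralB ?A0 ?B0 ?subrr//; exact: itg_indic.
    apply: eq_Rintegral => t _; rewrite -mulrBr; congr (_ * _).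
    rewrite !indicE in_setD; have [tB|tB] := boolP (t \in B).
      by rewrite (mem_set (BA _ (set_mem tB))) subrr.
    by rewrite andbT subr0.
  - move=> F ndF HF; split; first by apply: bigcupT_measurable => i; exact: (HF i).1.
    apply: dctH HF _ => t; have [[i _ Fit]|nFt] := pselect ((\bigcup_i F i) t).
      rewrite [X in _ --> X]indicE mem_set; last by exists i.
      apply: cvg_near_cst; exists i => // j /= ij.
      by rewrite indicE mem_set//; move: t Fit; exact/subsetPset/ndF.
    rewrite [X in _ --> X]indicE memNset//.
    apply: cvg_near_cst; apply: nearW => j.
    by rewrite indicE memNset// => Fjt; apply: nFt; exists j.
have HA A : measurable A -> H A.
  move=> mA; apply: (lambda_system_subset (@setI_closed_boxes n) lamH boxesH) => //.
  by move: mA; rewrite -(@measurable_boxes n).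
apply: Rint_norm0 => //.
pose A := [set t | 0 <= g t].
have mA : measurable A.
  rewrite (_ : A = g @^-1` `[0, +oo[%classic); first by rewrite -[X in measurable X]setTI; exact: mg.
  by apply/seteqP; split => t; rewrite /A /= in_itv /= andbT.
have mAc : measurable (~` A) by exact: measurableC.
transitivity (\int[leb n]_t (g t * \1_A t - g t * \1_(~` A) t)).
  apply: eq_Rintegral => t _; rewrite [\1_A t]indicE [\1_(~` A) t]indicE in_setC.
  have [tA|tA] := boolP (t \in A); rewrite ?mulr1 ?mulr0 ?subr0 ?sub0r.
    by rewrite ger0_norm//; move: tA; rewrite inE.
  rewrite ltr0_norm// ltNge; apply/negP => g0.
  by move/negP: tA; apply; rewrite inE.
rewrite RintegralB; [|by []|exact: itg_indic|exact: itg_indic].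
by rewrite (HA _ mA).2 (HA _ mAc).2 subrr.
Qed.

Lemma L2r_trans n (v : 'I_n -> R) (f : n.-tuple mR -> R) :
  L2r (leb n) f -> L2r (leb n) (f \o trans v).
Proof.
move=> [mf fi]; split; first by apply: measurableT_comp => //; exact: measurable_trans.
exact: (itg_trans v fi).1.
Qed.

End LebesgueN.

(** * Fubini's theorem for kernels with an integrable bound on the sections *)

Section FubiniToolkit.
Context d1 d2 (T1 : measurableType d1) (T2 : measurableType d2) (R : realType).
Variables (m1 : {sigma_finite_measure set T1 -> \bar R})
          (m2 : {sigma_finite_measure set T2 -> \bar R}).

Section Kernel.
Variables (k : T1 * T2 -> R) (c : T1 -> R).
Hypotheses (mk : measurable_fun setT k) (ci : itg m1 c)
  (ki : forall r, itg m2 (fun t => k (r, t)))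
  (kc : forall r, \int[m2]_t `|k (r, t)| <= c r).

(** By Tonelli's theorem the double integral of [|k|] is at most the integral of [c]. *)
Lemma prod_itg : itg (m1 \x m2)%E k.
Proof.
apply/(integrable12ltyP m1 m2); first exact/measurable_EFinP.
move/integrableP : (itg_norm ci) => [_]; apply: le_lt_trans.
apply: ge0_le_integral => //.
- by move=> r _; apply: integral_ge0.
- apply: (@measurable_fun_fubini_tonelli_F _ _ _ _ _ m2 (fun z => `|(k z)%:E|%E)) => //.
  by apply: measurableT_comp => //; exact/measurable_EFinP.
- by apply: measurableT_comp => //; apply: measurable_int (itg_norm ci).
- move=> r _ /=.
  have := Rint_EFin (itg_norm (ki r)) => /= ->.
  by rewrite lee_fin (le_trans (kc r))// normr_id ler_norm.
Qed.

Lemma fub_ae_itg : {ae m2, forall t, itg m1 (fun r => k (r, t))}.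
Proof. exact: (ae_integrable2 prod_itg). Qed.

Let mG : measurable_fun setT (fun t => \int[m1]_r (k (r, t))%:E)%E.
Proof. exact: (measurable_fubini_G prod_itg). Qed.

Let Goo : (\int[m2]_t `|\int[m1]_r (k (r, t))%:E| < +oo)%E.
Proof.
have /(integrable21ltyP m1 m2) := prod_itg.
move=> /(_ (measurable_int _ prod_itg)); apply: le_lt_trans.
have mk' : measurable_fun setT (EFin \o k) by exact/measurable_EFinP.
apply: ge0_le_integral => //.
- exact: measurableT_comp.
- apply: (@measurable_fun_fubini_tonelli_G _ _ _ _ _ m1 (fun z => `|(k z)%:E|%E)) => //.
  exact: measurableT_comp.
- move=> t _; apply: le_abse_integral => //.
  exact: (measurableT_comp mk' (measurable_pair2 t)).
Qed.

Lemma fub_itg : itg m2 (fun t => \int[m1]_r k (r, t)).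
Proof.
apply/integrableP; split.
  apply/measurable_EFinP; apply: (measurableT_comp (fine_measurable measurableT)) mG.
apply: le_lt_trans Goo.
apply: ge0_le_integral => //.
- by apply: measurableT_comp => //; apply/measurable_EFinP; apply: (measurableT_comp (fine_measurable measurableT)) mG.
- exact: measurableT_comp.
(* [fine] sends infinite values to 0, so passing to real-valued inner integrals does not increase
   absolute values. *)
- move=> t _; rewrite /fubini_G /Rintegral /=.
  by case: (\int[m1]_x _)%E => //= *; rewrite ?normr0 ?leey.
Qed.

(** The two sides are not symmetric: sections at fixed [r] are all integrable by [ki], those at
    fixed [t] only for almost every [t]. *)
Lemma fub_eq : \int[m2]_t (\int[m1]_r k (r, t)) = \int[m1]_r (\int[m2]_t k (r, t)).
Proof.
transitivity (fine (\int[m2]_t \int[m1]_r (k (r, t))%:E)%E).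
  rewrite /Rintegral; congr fine; apply: ae_eq_integral => //.
  - exact: measurable_int fub_itg.
  - by apply: filterS fub_ae_itg => t ti _ /=; rewrite -(Rint_EFin ti).
rewrite -(Fubini prod_itg); rewrite /Rintegral; congr fine.
by apply: eq_integral => r _; rewrite -(Rint_EFin (ki r)).
Qed.

Lemma fub_itg1 : itg m1 (fun r => \int[m2]_t k (r, t)).
Proof.
have iG := integrable_fubini_F prod_itg.
by apply: eq_integrable iG => // r _; rewrite /= /fubini_F -(Rint_EFin (ki r)).
Qed.
End Kernel.

(** Free of integrability, by splitting into positive and negative parts: it applies to [avg], whose
    inner integral may diverge on a null set. *)
Lemma measurable_Rint2 (k : T1 * T2 -> R) : measurable_fun setT k ->
  measurable_fun setT (fun t => \int[m1]_r k (r, t)).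
Proof.
move=> mk; rewrite /Rintegral.
apply: (measurableT_comp (fine_measurable measurableT)).
under eq_fun do rewrite integralE.
have mk' : measurable_fun setT (EFin \o k) by exact/measurable_EFinP.
apply: emeasurable_funB.
- have := @measurable_fun_fubini_tonelli_G _ _ _ _ _ m1 ((EFin \o k)^\+)%E
    (measurable_funepos mk') (fun=> funepos_ge0 _ _).
  by under eq_fun do rewrite /fubini_G; congr measurable_fun;
    apply/funext => t; apply: eq_integral => r _; rewrite unlock.
- have := @measurable_fun_fubini_tonelli_G _ _ _ _ _ m1 ((EFin \o k)^\-)%E
    (measurable_funeneg mk') (fun=> funeneg_ge0 _ _).
  by under eq_fun do rewrite /fubini_G; congr measurable_fun;
    apply/funext => t; apply: eq_integral => r _; rewrite unlock.
Qed.
End FubiniToolkit.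

(** * Smooth bumps *)

Section Bumps.
Variable R : realType.
Implicit Types (f g : R -> R) (x d : R).

Let quotE (h d F1 F0 : R) : h != 0 ->
  F1 - F0 - h * d = - h * (d - h^-1 *: (F1 - F0)).
Proof. by move=> h0; rewrite /GRing.scale /=; field. Qed.

(** The form without quotient includes [h = 0] and matches the one-sided notion [hasd] used for
    curves on [[0, T)]. *)
Lemma is_derive_epsP f x d :
  (forall e : R, 0 < e -> exists2 r : R, 0 < r & forall h : R, `|h| < r ->
     `|f (x + h) - f x - h * d| <= e * `|h|) <-> is_derive x 1 f d.
Proof.
split=> [fd|[df fd] e e0].
  suff cv : h^-1 *: ((f \o shift x) (h *: (1 : R)) - f x) @[h --> 0^'] --> d.
    by split; [apply/cvg_ex; exists d|exact/cvg_lim].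
  apply/cvgrPdist_le => e e0; have [r r0 fr] := fd e e0.
  near=> h.
  have h0 : h != 0 by near: h; exact: nbhs_dnbhs_neq.
  have hr : `|h| < r by near: h; exact: dnbhs0_lt.
  have /= := fr h hr.
  have -> : f (x + h) - f x - h * d = - h * (d - h^-1 *: (f (h *: 1 + x) - f x)).
    by rewrite -quotE// [_ *: _]mulr1 (addrC h).
  by rewrite normrM normrN mulrC ler_pM2r ?normr_gt0.
have : h^-1 *: ((f \o shift x) (h *: (1 : R)) - f x) @[h --> 0^'] --> d.
  by rewrite -fd; exact: df.
move=> /cvgrPdist_le /(_ e e0) /nbhs_ballP [r /= r0 fr].
exists r => // h hr; have [->|h0] := eqVneq h 0.
  by rewrite addr0 subrr mul0r subrr !normr0 mulr0.
have /= := fr h _ h0; rewrite /ball /= sub0r normrN => /(_ hr).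
have -> : f (x + h) - f x - h * d = - h * (d - h^-1 *: (f (h *: 1 + x) - f x)).
  by rewrite -quotE// [_ *: _]mulr1 (addrC h).
by move=> H; rewrite normrM normrN mulrC ler_wpM2r.
Unshelve. all: by end_near. Qed.

Fixpoint smooth (k : nat) f : Prop :=
  if k is k'.+1 then exists2 f', (forall x, is_derive x 1 f (f' x)) & smooth k' f'
  else continuous f.

Lemma smoothS k f : smooth k.+1 f -> smooth k f.
Proof.
elim: k f => [|k IH] f [f' ff' sf'] /=.
  by move=> x; apply/differentiable_continuous/derivable1_diffP; case: (ff' x).
by exists f' => //; exact: IH.
Qed.

Lemma smooth_continuous k f : smooth k f -> continuous f.
Proof. by elim: k f => // k IH f /smoothS/IH. Qed.

Lemma smoothD k f g : smooth k f -> smooth k g -> smooth k (fun x => f x + g x).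
Proof.
elim: k f g => [|k IH] f g /=.
  by move=> cf cg x; apply: cvgD; [exact: cf|exact: cg].
move=> [f' ff' sf'] [g' gg' sg']; exists (fun x => f' x + g' x); last exact: IH.
by move=> x; exact: is_deriveD.
Qed.

Lemma smoothM k f g : smooth k f -> smooth k g -> smooth k (fun x => f x * g x).
Proof.
elim: k f g => [|k IH] f g.
  by move=> cf cg x; apply: cvgM; [exact: cf|exact: cg].
move=> sf sg; have [f' ff' sf'] := sf; have [g' gg' sg'] := sg.
exists (fun x => f x * g' x + g x * f' x).
  by move=> x; exact: is_deriveM.
by apply: smoothD; apply: IH => //; exact: smoothS.
Qed.

Lemma smooth_cst k (c : R) : smooth k (fun=> c).
Proof.
elim: k c => [|k IH] c; first by move=> x; exact: cvg_cst.
by exists (fun=> 0); [move=> x; exact: is_derive_cst|exact: IH].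
Qed.

Lemma smooth_affine k f (a b : R) : smooth k f -> smooth k (fun x => f (a * x + b)).
Proof.
have da x : is_derive x 1 (fun x => a * x + b) a.
  by apply: is_derive_eq; rewrite addr0 /GRing.scale/= mulr1.
elim: k f => [|k IH] f /=.
  move=> cf x; apply: continuous_comp; last exact: cf.
  by apply/differentiable_continuous/derivable1_diffP; case: (da x).
move=> [f' ff' sf']; exists (fun x => a * f' (a * x + b)).
  move=> x; rewrite mulrC; exact: (@is_derive1_comp R f (fun x => a * x + b)).
by apply: smoothM; [exact: smooth_cst|exact: IH].
Qed.

(* The derivative of P(1/x) exp(-1/x) is again of this form, whence the polynomial. *)
Definition flat (P : {poly R}) x := if 0 < x then P.[x^-1] * expR (- x^-1) else 0.

(** With [y = 1 / x] and [n = size P], [|P(y)| <= A y^n] while [exp y >= y^(n+2) / (n+2)!]. The two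
    spare powers of [x] make [flat P] differentiable at 0 with derivative 0. *)
Lemma flat_bound (P : {poly R}) : exists2 C, 0 <= C &
  forall x, `|x| <= 1 -> `|flat P x| <= C * x ^+ 2.
Proof.
pose n := size P; pose A : R := \sum_(i < n) `|P`_i|.
have A0 : 0 <= A by exact: sumr_ge0.
exists (A * (n.+2)`!%:R); first by rewrite mulr_ge0.
move=> x x1; rewrite /flat; case: ifPn => x0; last first.
  by rewrite normr0; apply: mulr_ge0; [exact: mulr_ge0|exact: sqr_ge0].
pose y := x^-1; have y1 : 1 <= y.
  by rewrite invr_ge1 ?unitfE ?gt_eqF// -(gtr0_norm x0).
have y0 : 0 < y by exact: lt_le_trans y1.
have Py : `|P.[y]| <= A * y ^+ n.
  rewrite horner_coef (le_trans (ler_norm_sum _ _ _))// mulr_suml ler_sum// => i _.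
  rewrite normrM ler_wpM2l// normrX gtr0_norm// ler_weXn2l//.
  exact: ltnW (ltn_ord i).
have ey : y ^+ n.+2 / n.+2`!%:R <= expR y.
  by apply: le_trans (expR_ge1Dxn n.+1 (ltW y0)); rewrite lerDr.
rewrite normrM (ger0_norm (expR_ge0 _)) -/y expRN.
have f0 : 0 < n.+2`!%:R :> R by rewrite ltr0n fact_gt0.
have : (expR y)^-1 <= n.+2`!%:R / y ^+ n.+2.
  rewrite -[leRHS]invrK lef_pV2 ?posrE ?expR_gt0 ?invr_gt0 ?divr_gt0 ?exprn_gt0//.
  by rewrite invf_div.
move=> ey'; apply: le_trans (ler_pM _ _ Py ey') _ => //.
rewrite -!mulrA ler_wpM2l// mulrCA ler_wpM2l ?(ltW f0)//.
rewrite -[n.+2]addn2 exprD invfM mulrA mulfV ?expf_neq0 ?gt_eqF// mul1r.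
by rewrite /y exprVn invrK.
Qed.

(** For [x > 0] the chain rule gives [x^-2 (P - P')(1/x) exp(-1/x)], whence the factor ['X^2]. At 0
    the quadratic bound of [flat_bound] applies. *)
Lemma flat_derive (P : {poly R}) x :
  is_derive x 1 (flat P) (flat ('X^2 * (P - P^`())) x).
Proof.
case: (ltgtP 0 x) => [x0|x0|<-].
- have -> : flat ('X^2 * (P - P^`())) x =
      P.[x^-1] * (expR (- x^-1) * (- (- x^-2))) + expR (- x^-1) * (P^`().[x^-1] * (- x^-2)).
    by rewrite /flat x0 /= hornerM hornerXn hornerD hornerN exprVn; ring.
  have dV : is_derive x 1 (fun x : R => x^-1) (- x^-2).
    apply: is_derive_eq (is_deriveV _ _) _; first by rewrite gt_eqF.
    by rewrite /GRing.scale /= mulr1.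
  have d1 : is_derive x 1 (fun x => expR (- x^-1)) (expR (- x^-1) * (- (- x^-2))).
    exact: (@is_derive1_comp R expR (fun x => - x^-1)).
  have d2 : is_derive x 1 (fun x => P.[x^-1]) (P^`().[x^-1] * (- x^-2)).
    exact: (@is_derive1_comp R (horner P) (fun x => x^-1)).
  apply: (near_eq_is_derive (f := fun x => P.[x^-1] * expR (- x^-1))).
  + near=> z; rewrite /flat ifT//.
    by near: z; exact: lt_nbhsr.
  + exact: (@is_deriveM _ _ (fun x => P.[x^-1]) (fun x => expR (- x^-1))).
- rewrite {2}/flat ltNge ltW//=.
  apply: (near_eq_is_derive (f := fun=> 0)).
  near=> z; rewrite /flat ifF//.
  apply/negbTE; rewrite -leNgt ltW//.
  by near: z; exact: lt_nbhsl.
- rewrite {2}/flat ltxx; apply/is_derive_epsP => e e0.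
  have [C C0 HC] := flat_bound P.
  exists (Num.min 1 (e / (C + 1))); first by rewrite lt_min ltr01 divr_gt0// ltr_wpDl.
  move=> h; rewrite lt_min => /andP[h1 h2].
  rewrite add0r mulr0 subr0 [flat P 0]/flat ltxx subr0.
  apply: le_trans (HC h (ltW h1)) _.
  rewrite -real_normK ?num_real// expr2 mulrA ler_wpM2r//.
  move: h2; rewrite ltr_pdivlMr; last by rewrite ltr_wpDl.
  by have := normr_ge0 h; nra.
Unshelve. all: by end_near. Qed.

Lemma flat_smooth k (P : {poly R}) : smooth k (flat P).
Proof.
elim: k P => [|k IH] P /=.
  by move=> x; apply/differentiable_continuous/derivable1_diffP; case: (flat_derive P x).
by exists (flat ('X^2 * (P - P^`()))) => // x; exact: flat_derive.
Qed.

(** A smooth function with values in [[0, 1]], vanishing off []a, b[]; the factor [n] steepens the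
    edges, and the bumps converge pointwise to the indicator of the interval. *)
Definition bump (n : nat) (a b x : R) : R :=
  flat 1 (n%:R * (x - a)) * flat 1 (n%:R * (b - x)).

Lemma flat1_itv x : 0 <= flat 1 x <= 1.
Proof.
rewrite /flat; case: ifPn => x0; last by rewrite lexx ler01.
by rewrite hornerC mul1r expR_ge0 -expR0 ler_expR oppr_le0 invr_ge0 ltW.
Qed.

Lemma bump_smooth k n a b : smooth k (bump n a b).
Proof.
apply: smoothM.
- rewrite (_ : (fun _ => _) = fun x => flat 1 (n%:R * x + (- (n%:R * a)))).
    by apply: smooth_affine; exact: flat_smooth.
  by apply/funext => x; rewrite mulrBr.
- rewrite (_ : (fun _ => _) = fun x => flat 1 (- n%:R * x + n%:R * b)).
    by apply: smooth_affine; exact: flat_smooth.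
  by apply/funext => x; congr (flat 1); ring.
Qed.

Lemma bump_out n a b x : ~~ (a < x < b) -> bump n a b x = 0.
Proof.
rewrite negb_and -!leNgt /bump /flat => /orP[xa|bx].
  by rewrite ifF ?mul0r//; apply/negbTE; rewrite -leNgt mulr_ge0_le0// subr_le0.
rewrite [X in _ * X]ifF ?mulr0//; apply/negbTE; rewrite -leNgt mulr_ge0_le0//.
by rewrite subr_le0.
Qed.

Lemma bump_itv n a b x : 0 <= bump n a b x <= 1.
Proof.
rewrite /bump; have /andP[? ?] := flat1_itv (n%:R * (x - a)).
have /andP[? ?] := flat1_itv (n%:R * (b - x)).
by rewrite mulr_ge0// mulr_ile1.
Qed.

Lemma flat1_cvg y : 0 < y -> flat 1 (n%:R * y) @[n --> \oo] --> (1 : R).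
Proof.
move=> y0.
have : expR (- (n%:R * y)^-1) @[n --> \oo] --> expR (- (0 * y^-1)).
  apply: continuous_cvg; first exact: continuous_expR.
  apply: cvgN; under eq_fun do rewrite invfM.
  apply: cvgMl; rewrite gtr0_cvgV0; first exact: cvgr_idn.
  by exists 1%N => // n /= n1; rewrite ltr0n.
rewrite mul0r oppr0 expR0; apply: cvg_trans; apply: near_eq_cvg.
near=> n; rewrite /flat ifT ?hornerC ?mul1r// mulr_gt0// ltr0n.
by near: n; exact: nbhs_infty_gt.
Unshelve. all: by end_near. Qed.

Lemma bump_cvg a b x : a < x < b -> bump n a b x @[n --> \oo] --> (1 : R).
Proof.
move=> /andP[ax xb]; rewrite -[X in _ --> X]mulr1.
by apply: cvgM; apply: flat1_cvg; rewrite subr_gt0.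
Qed.

Lemma bump_shift n a b s x : bump n (a + s) (b + s) x = bump n a b (x - s).
Proof. by rewrite /bump; congr (flat 1 (_ * _) * flat 1 (_ * _)); ring. Qed.

End Bumps.

(** * Tensor products of bumps as test functions *)

Section Tensor.
Variables (R : realType) (N : nat).
Local Notation E := 'rV[R]_N.
Implicit Types (psi : 'I_N -> R -> R).

Definition tens psi (x : E) : R := \prod_j psi j (x 0 j).

Lemma continuous_bigprod (I : Type) (s : seq I) (F : I -> E -> R) :
  (forall i, continuous (F i)) -> continuous (fun x => \prod_(i <- s) F i x).
Proof.
move=> cF; elim: s => [|a s IH].
  rewrite (_ : (fun x => _) = fun=> 1); first exact: cst_continuous.
  by apply/funext => x; rewrite big_nil.
rewrite (_ : (fun x => _) = fun x => F a x * \prod_(i <- s) F i x).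
  by move=> x; exact: (cvgM (cF a x) (IH x)).
by apply/funext => x; rewrite big_cons.
Qed.

Lemma tens_continuous psi : (forall j, continuous (psi j)) -> continuous (tens psi).
Proof.
move=> cpsi; apply: continuous_bigprod => j x.
by apply: continuous_comp; [exact: coord_continuous|exact: cpsi].
Qed.

Definition upd psi i (g : R -> R) j := if j == i then g else psi j.

Lemma tens_derive psi i g (x : E) : is_derive (x 0 i) 1 (psi i) (g (x 0 i)) ->
  is_derive x (delta_mx 0 i) (tens psi) (tens (upd psi i g) x).
Proof.
move=> dg; pose c := \prod_(j | j != i) psi j (x 0 j).
have tE h : tens psi (h *: delta_mx 0 i + x) = c * psi i (x 0 i + h).
  rewrite /tens (bigD1 i)//= mulrC !mxE !eqxx mulr1 addrC; congr (_ * _).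
  by apply: eq_bigr => j ji; rewrite !mxE eqxx /= (negbTE ji) mulr0 add0r.
have t0 : tens psi x = c * psi i (x 0 i).
  by have := tE 0; rewrite scale0r add0r addr0.
have -> : tens (upd psi i g) x = c * g (x 0 i).
  rewrite /tens (bigD1 i)//= mulrC /upd eqxx; congr (_ * _).
  by apply: eq_bigr => j /negbTE ->.
have /is_derive_epsP : is_derive (x 0 i) 1 (fun y => c * psi i y) (c * g (x 0 i)).
  exact: is_deriveZ.
move=> H.
have cv : h^-1 *: ((tens psi \o shift x) (h *: delta_mx 0 i) - tens psi x)
    @[h --> 0^'] --> c * g (x 0 i).
  apply/cvgrPdist_le => e e0; have [r r0 fr] := H e e0.
  near=> h.
  have h0 : h != 0 by near: h; exact: nbhs_dnbhs_neq.
  have hr : `|h| < r by near: h; exact: dnbhs0_lt.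
  have := fr h hr; rewrite /= tE t0.
  set F1 := c * _; set F0 := c * _; set d := c * _ => H1.
  have -> : d - h^-1 *: (F1 - F0) = - h^-1 * (F1 - F0 - h * d).
    by rewrite /GRing.scale /=; field.
  by rewrite normrM normrN normfV mulrC ler_pdivrMr ?normr_gt0.
by split; [apply/cvg_ex; eexists; exact: cv|exact/cvg_lim].
Unshelve. all: by end_near. Qed.

(** A partial derivative of a tensor product is a tensor product with one factor replaced by its
    derivative, so the induction on [k] stays within tensor products. *)
Lemma tens_is_Ck k psi : (forall j, smooth k (psi j)) -> is_Ck k (tens psi).
Proof.
elim: k psi => [|k IH] psi spsi /=; first exact: tens_continuous.
split; first by apply: tens_continuous => j; exact: smooth_continuous (spsi j).
move=> i; have [g dg sg] := spsi i.
have dt x := @tens_derive psi i g x (dg _).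
split; first by move=> x; case: (dt x).
rewrite (_ : (fun x => _) = tens (upd psi i g)); last first.
  by apply/funext => x; case: (dt x).
by apply: IH => j; rewrite /upd; case: ifP => // _; exact: smoothS.
Qed.

Definition btens n (a b : 'I_N -> R) : E -> R := tens (fun j => bump n (a j) (b j)).

Lemma btens_out n a b x : btens n a b x != 0 -> forall j, a j < x 0 j < b j.
Proof.
move=> + j; apply: contraR => /(bump_out n) Hj.
by rewrite /btens /tens (bigD1 j)//= Hj mul0r.
Qed.

Lemma btens_itv n a b x : 0 <= btens n a b x <= 1.
Proof.
rewrite /btens /tens; apply/andP; split.
  by apply: prodr_ge0 => j _; case/andP: (bump_itv n (a j) (b j) (x 0 j)).
suff /andP[] : 0 <= \prod_j bump n (a j) (b j) (x 0 j) <= 1 by [].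
apply: (@big_ind _ (fun y : R => 0 <= y <= 1)); first by rewrite ler01 lexx.
  by move=> y z /andP[y0 y1] /andP[z0 z1]; rewrite mulr_ge0 ?mulr_ile1.
by move=> j _; exact: bump_itv.
Qed.

Lemma btens_test n a b : test_function (btens n a b).
Proof.
split; first by move=> k; apply: tens_is_Ck => j; exact: bump_smooth.
pose M : R := \sum_j (`|a j| + `|b j|).
have clB : closed [set x : E | `|x| <= M].
  have -> : [set x : E | `|x| <= M] = (fun x : E => `|x|) @^-1` [set r | r <= M] by [].
  apply: closed_comp; last exact: closed_le.
  by move=> x _; exact: norm_continuous.
apply: bounded_closed_compact; last exact: closed_closure.
exists M; split; first exact: num_real.
move=> M' MM' x cx; apply: le_trans (ltW MM').
suff : closure [set x | btens n a b x != 0] `<=` [set x : E | `|x| <= M] by move=> /(_ x cx).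
rewrite [X in _ `<=` X]((closure_id _).1 clB); apply: closure_subset => y /btens_out yb /=.
rewrite [`|y|]mx_normrE; apply: bigmax_le => [|[i j] _].
  by apply: sumr_ge0 => j _; rewrite addr_ge0.
rewrite (ord1 i) /= /M (bigD1 j)//=.
apply: (@le_trans _ _ (`|a j| + `|b j|)); last first.
  by rewrite lerDl; apply: sumr_ge0 => k _; rewrite addr_ge0.
have /andP[ay yb'] := yb j.
rewrite ler_norml; apply/andP; split.
  by have := ler_norm (- a j); rewrite normrN; have := normr_ge0 (b j); lra.
by have := ler_norm (b j); have := normr_ge0 (a j); lra.
Qed.

Lemma btens_cvg a b (x : E) : (forall j, a j < x 0 j < b j) ->
  btens n a b x @[n --> \oo] --> (1 : R).
Proof.
move=> abx; rewrite /btens /tens.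
have H : forall s : seq 'I_N,
    \prod_(j <- s) bump n (a j) (b j) (x 0 j) @[n --> \oo] --> \prod_(j <- s) (1 : R).
  elim=> [|i s IH].
    rewrite big_nil (_ : (fun n => _) = fun=> 1); first exact: cvg_cst.
    by apply/funext => n; rewrite big_nil.
  rewrite big_cons (_ : (fun n => _) = fun n => bump n (a i) (b i) (x 0 i) *
    \prod_(j <- s) bump n (a j) (b j) (x 0 j)).
    by apply: cvgM IH; exact: bump_cvg.
  by apply/funext => n; rewrite big_cons.
have one : \prod_(j <- index_enum 'I_N) (1 : R) = 1 by rewrite big1.
by have := H (index_enum 'I_N); rewrite one.
Qed.

Lemma btens_derivable n a b i x : derivable (btens n a b) x (delta_mx 0 i).
Proof.
have [g dg _] : smooth 1 (bump n (a i) (b i)) by exact: bump_smooth.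
by case: (@tens_derive (fun j => bump n (a j) (b j)) i g x (dg _)).
Qed.

(** A translate is the test function of the translated box, so it inherits [btens_test]. *)
Lemma btens_shift n a b i s (x : E) :
  btens n (fun j => a j + (if j == i then s else 0)) (fun j => b j + (if j == i then s else 0)) x =
  btens n a b (x - s *: delta_mx 0 i).
Proof.
rewrite /btens /tens; apply: eq_bigr => j _; rewrite bump_shift !mxE eqxx /=.
by case: eqP => _; rewrite ?mulr1 ?mulr0.
Qed.

Lemma btens_derive_continuous n a b i :
  continuous (fun x => 'D_(delta_mx 0 i) (btens n a b) x).
Proof. by have [/(_ 1%N)[_ /(_ i)[_]]] := btens_test n a b. Qed.

End Tensor.

(** * Weak derivatives and integration by parts *)

Section WeakDerivatives.
Variables (R : realType) (N : nat).
Local Notation mR := (measurableTypeR R).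
Local Notation E := 'rV[R]_N.
Local Notation leb := (lebesgueN R N).
Local Notation T := (N.-tuple mR).
Implicit Types (f g h : T -> R).

(** [F] is the pointwise limit of its values at the lower corners of grid cells of side [1 / n.+1].
    There are countably many cells, each a product of half-open intervals. *)
Lemma continuous_measurable_pt (F : E -> R) : continuous F ->
  measurable_fun setT (fun t : T => F (pt t) : mR).
Proof.
move=> cF.
pose fl (n : nat) (t : T) : 'rV[int]_N := \row_j Num.floor (n.+1%:R * tnth t j).
pose app (n : nat) (z : 'rV[int]_N) : E := \row_j ((z 0 j)%:~R / n.+1%:R).
apply: (@measurable_fun_cvg _ _ _ _ (fun n t => F (app n (fl n t)))) => [n|t _].
  move=> _ Y mY; rewrite setTI.
  have -> : (fun t => F (app n (fl n t))) @^-1` Y =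
      \bigcup_(z in [set: 'rV[int]_N]) ([set t | fl n t = z] `&` [set t | Y (F (app n z))]).
    by apply/seteqP; split => t /= => [Yt|[z _ [/= -> //]]]; exists (fl n t).
  apply: countable_bigcupT_measurable; first exact: countableP.
  move=> z; have [Yz|nYz] := pselect (Y (F (app n z))); last first.
    rewrite (_ : _ `&` _ = set0); first exact: measurable0.
    by apply/seteqP; split => // t [].
  rewrite (_ : _ `&` _ = \bigcap_(j in [set: 'I_N]) ((fun t : T => tnth t j) @^-1`
      `[(z 0 j)%:~R / n.+1%:R, (z 0 j + 1)%:~R / n.+1%:R[%classic)); last first.
    apply/seteqP; split => t /=.
      move=> [<- _] j _ /=; rewrite in_itv /= !mxE ler_pdivrMr// ltr_pdivlMr//.
      by rewrite mulrC (mulrC (tnth t j)) Num.Theory.floor_le_tmp Num.Theory.floorD1_gt.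
    move=> H; split => //; apply/rowP => j; rewrite mxE; apply: Num.Theory.floor_def.
    have /= := H j I; rewrite in_itv /= ler_pdivrMr// ltr_pdivlMr//.
    by rewrite (mulrC n.+1%:R).
  apply: fin_bigcap_measurable => // j _.
  rewrite -[X in measurable X]setTI; apply: (@measurable_tnth _ mR N j) => //.
have : app n (fl n t) @[n --> \oo] --> pt t.
  apply/cvgrPdist_le => e e0.
  near=> n.
  rewrite [X in X <= _]mx_normrE; apply: bigmax_le => [|[i j] _]; first exact: ltW.
  rewrite (ord1 i) !mxE /=.
  have n0 : 0 < n.+1%:R :> R by [].
  have en : n.+1%:R^-1 <= e.
    by apply: ltW; near: n; exact: (near_infty_natSinv_lt (PosNum e0)).
  apply: le_trans en; set x := tnth t j.
  have h1 := Num.Theory.floor_le_tmp (n.+1%:R * x).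
  have h2 := Num.Theory.floorD1_gt (n.+1%:R * x).
  have -> : x - (Num.floor (n.+1%:R * x))%:~R / n.+1%:R =
      (n.+1%:R * x - (Num.floor (n.+1%:R * x))%:~R) / n.+1%:R.
    by field; rewrite gt_eqF.
  rewrite normrM normfV (gtr0_norm n0) -[leRHS]mul1r ler_pM2r ?invr_gt0//.
  by move: h2; rewrite intrD => h2; rewrite ger0_norm ?subr_ge0//; lra.
by apply: continuous_cvg; exact: cF.
Unshelve. all: by end_near. Qed.

Definition tr (i : 'I_N) (s : R) : T -> T := trans (fun j => if j == i then s else 0).

Lemma pt_tr i s t : pt (tr i s t) = pt t + s *: delta_mx 0 i.
Proof.
apply/rowP => j; rewrite !mxE eqxx tnth_mktuple /=.
by case: eqP => _; rewrite ?mulr1 ?mulr0.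
Qed.

Lemma tr_add i s r t : tr i s (tr i r t) = tr i (s + r) t.
Proof.
apply: eq_from_tnth => j; rewrite !tnth_mktuple -addrA; congr (_ + _).
by case: eqP => _; rewrite ?addr0// addrC.
Qed.

Lemma tr0 i t : tr i 0 t = t.
Proof. by apply: eq_from_tnth => j; rewrite tnth_mktuple if_same addr0. Qed.

Lemma measurable_tr2 (i : 'I_N) (c : R) :
  measurable_fun setT (fun z : mR * T => tr i (z.1 * c) z.2).
Proof.
apply/measurable_fun_tnthP => j.
rewrite (_ : _ \o _ = fun z : mR * T => tnth z.2 j + (if j == i then z.1 * c else 0)); last first.
  by apply/funext => z /=; rewrite tnth_mktuple.
apply: measurable_funD.
  exact: (measurableT_comp (@measurable_tnth _ mR N j)).
case: (j == i); last exact: measurable_cst.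
apply: measurable_funM; [exact: measurable_fst|exact: measurable_cst].
Qed.

Definition wder (i : 'I_N) f g := forall phi : E -> R, test_function phi ->
  \int[leb]_t (f t * 'D_(delta_mx 0 i) phi (pt t)) = - \int[leb]_t (g t * phi (pt t)).

Lemma itg_box (a b : 'I_N -> R) : itg leb (\1_(box a b)).
Proof.
have mb := measurable_box a b.
apply/integrableP; split; first by apply/measurable_EFinP; exact: measurable_indic.
under eq_integral do rewrite /= ger0_norm//.
by rewrite integral_indic// setIT -[X in (X < _)%E]/(lebesgueN R N (box a b)) lebesgueN_box ltry.
Qed.

Lemma L2r_bounded_box f (a b : 'I_N -> R) (C : R) : measurable_fun setT f ->
  (forall t, `|f t| <= C * \1_(box a b) t) -> L2r leb f.
Proof.
move=> mf fC; have mb := measurable_box a b.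
have C0 t : `|f t| <= `|C * \1_(box a b) t| by exact: le_trans (fC t) (ler_norm _).
apply: L2r_le mf C0 _; apply: L2rZ; split; first exact: measurable_indic.
rewrite (_ : (fun _ => _) = \1_(box a b)); first exact: itg_box.
by apply/funext => t; rewrite indicE; case: (_ \in _); rewrite ?expr1n ?expr0n.
Qed.

Lemma btens_box n a b (t : T) : `|btens n a b (pt t)| <= \1_(box a b) t.
Proof.
have [->|nz] := eqVneq (btens n a b (pt t)) 0; first by rewrite normr0.
rewrite indicE mem_set; last by move=> j; have := btens_out nz j; rewrite mxE.
by have /andP[? ?] := btens_itv n a b (pt t); rewrite ger0_norm.
Qed.

Lemma measurable_btens n a b : measurable_fun setT (fun t : T => btens n a b (pt t)).
Proof.
apply: continuous_measurable_pt.
by have [/(_ 0%N)] := btens_test n a b.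
Qed.

Lemma L2r_compact_support (G : E -> R) (K : set E) : continuous G -> compact K ->
  (forall x, ~ K x -> G x = 0) -> L2r leb (fun t => G (pt t)).
Proof.
move=> cG cK GK.
have [M [_ HM]] := compact_bounded cK.
have [C [_ HC]] : bounded_set (G @` K).
  by apply: compact_bounded; apply: continuous_compact => //; exact: continuous_subspaceT.
have {}HM x : K x -> `|x| <= M + 1 by apply: HM; rewrite ltrDl.
have {}HC x : K x -> `|G x| <= Num.max 0 (C + 1).
  by move=> Kx; rewrite le_max; apply/orP; right; apply: HC; rewrite ?ltrDl//; exists x.
apply: (@L2r_bounded_box _ (fun=> - (M + 2)) (fun=> M + 2) (Num.max 0 (C + 1))).
  exact: (continuous_measurable_pt cG).
move=> t; have [Kt|nKt] := pselect (K (pt t)); last first.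
  by rewrite (GK _ nKt) normr0 mulr_ge0// le_max lexx.
rewrite indicE mem_set ?mulr1; first exact: HC.
move=> j; rewrite -ltr_norml.
have -> : tnth t j = pt t 0 j by rewrite mxE.
have := HM _ Kt; rewrite [X in X <= _]mx_normrE => H.
apply: (@le_lt_trans _ _ (M + 1)); last by lra.
by apply: le_trans H; exact: (le_bigmax _ (fun k => `|pt t k.1 k.2|) (0, j)).
Qed.

Lemma test_L2r phi : test_function phi -> L2r leb (fun t => phi (pt t)).
Proof.
move=> [/(_ 0%N) cphi Kphi]; apply: (L2r_compact_support cphi Kphi) => x.
by apply: contra_notP => /eqP xn0; exact: subset_closure.
Qed.

Lemma test_derive_L2r i phi : test_function phi ->
  L2r leb (fun t => 'D_(delta_mx 0 i) phi (pt t)).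
Proof.
move=> [/(_ 1%N)[_ /(_ i)[_ cdphi]] Kphi]; apply: (L2r_compact_support cdphi Kphi) => x nx.
rewrite (_ : 0 = 'D_(delta_mx 0 i) (cst 0 : E -> R) x); last by rewrite derive_cst.
apply: near_eq_derive.
have : nbhs x (~` closure [set x | phi x != 0]).
  by apply: open_nbhs_nbhs; split => //; apply: closed_openC; exact: closed_closure.
apply: filterS => y ny; apply/eqP/negPn/negP => yn0.
by apply: ny; exact: subset_closure.
Qed.

Lemma L2r_btens n a b : L2r leb (fun t => btens n a b (pt t)).
Proof. exact/test_L2r/btens_test. Qed.

Lemma L2r_btens_derive n a b i : L2r leb (fun t => 'D_(delta_mx 0 i) (btens n a b) (pt t)).
Proof. exact/test_derive_L2r/btens_test. Qed.

(** The fundamental lemma of the calculus of variations: bumps converge to the indicator of the box,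
    dominated by [|h|] on it, and [locint_box0_ae] concludes. *)
Lemma locint_test0_ae h : locint h ->
  (forall n a b, \int[leb]_t (h t * btens n a b (pt t)) = 0) ->
  {ae leb, forall t, h t = 0}.
Proof.
move=> lh h0; apply: locint_box0_ae => // a b.
apply: (@Rint_dct0 _ _ _ _ (fun n t => h t * btens n a b (pt t)) _
  (fun t => `|h t * \1_(box a b) t|)).
- by move=> n; apply: measurable_funM lh.1 _; exact: measurable_btens.
- move=> t; apply: cvgM; first exact: cvg_cst.
  rewrite indicE; have [tb|tb] := boolP (t \in box a b).
    by apply: btens_cvg => j; rewrite mxE; exact: (set_mem tb).
  apply: cvg_near_cst; apply: nearW => n; apply/eqP.
  apply: contraNT tb => nz; rewrite inE => j.
  by have := btens_out nz j; rewrite mxE.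
- exact: itg_norm (lh.2 a b).
- by move=> n t; rewrite !normrM ler_wpM2l// (le_trans (btens_box _ _ _ _))// ler_norm.
- by move=> n; exact: h0.
Qed.

Lemma wder_unique i f g g' : L2r leb g -> L2r leb g' ->
  wder i f g -> wder i f g' -> {ae leb, forall t, g t = g' t}.
Proof.
move=> Lg Lg' fg fg'.
have : {ae leb, forall t, g t - g' t = 0}.
  apply: locint_test0_ae; first exact/L2r_locint/L2rB.
  move=> n a b; transitivity (\int[leb]_t (g t * btens n a b (pt t) - g' t * btens n a b (pt t))).
    by apply: eq_Rintegral => t _; rewrite mulrBl.
  have Lb := L2r_btens n a b.
  rewrite RintegralB//; [|exact: L2r_mul|exact: L2r_mul].
  apply/eqP; rewrite subr_eq0 -eqr_opp -fg -?fg'//; exact: btens_test.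
by apply: filterS => t /eqP; rewrite subr_eq0 => /eqP.
Qed.

Lemma L2r_tr i s f : L2r leb f -> L2r leb (fun t => f (tr i s t)).
Proof. exact: L2r_trans. Qed.

Lemma Rint_tr i s f : itg leb f -> \int[leb]_t f (tr i s t) = \int[leb]_t f t.
Proof. by move=> /(itg_trans (fun j => if j == i then s else 0))[]. Qed.

(** Means over [[0, 1]] are integrals over the whole line with this weight, so that Fubini's theorem
    is used on the full product space. *)
Definition chi01 : mR -> R := \1_(`[0, 1]%classic).

Lemma measurable_chi01 : measurable_fun setT chi01.
Proof. by apply: measurable_indic; exact: measurable_itv. Qed.

Lemma chi01_itg : itg (leb1 R) chi01.
Proof.
apply/integrableP; split; first by apply/measurable_EFinP; exact: measurable_chi01.
under eq_integral do rewrite /= ger0_norm//.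
rewrite integral_indic//.
rewrite setIT -[X in (X < _)%E]/(lebesgue_measure `[(0 : R), 1]%classic).
by rewrite lebesgue_measure_itv /= lte_fin ltr01 oppr0 adde0 ltry.
Qed.

Lemma chi01_ge0 r : 0 <= chi01 r.
Proof. by rewrite /chi01 indicE. Qed.

Lemma Rint_chi01 : \int[leb1 R]_r chi01 r = 1.
Proof.
rewrite /Rintegral integral_indic//.
rewrite setIT -[X in fine X]/(lebesgue_measure `[(0 : R), 1]%classic).
by rewrite lebesgue_measure_itv /= lte_fin ltr01 oppr0 adde0.
Qed.

Section Average.
Variables (i : 'I_N) (c : R) (F : T -> R).
Hypothesis LF : L2r leb F.

(* Mean of the translates of F along [0, c e_i]; for F = D_i f in the weak sense,
   f(. + c e_i) - f = c * avg. *)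
Definition avg (t : T) : R := \int[leb1 R]_r (chi01 r * F (tr i (r * c) t)).

Let mFtr : measurable_fun setT (fun z : mR * T => chi01 z.1 * F (tr i (z.1 * c) z.2)).
Proof.
apply: measurable_funM.
  exact: measurableT_comp measurable_chi01 measurable_fst.
exact: measurableT_comp LF.1 (measurable_tr2 i c).
Qed.

Lemma measurable_avg : measurable_fun setT avg.
Proof. exact: measurable_Rint2 mFtr. Qed.

Let sqC := \int[leb]_t (F t ^+ 2).

Let c1i (C : R) : itg (leb1 R) (fun r => chi01 r * C).
Proof.
rewrite (_ : (fun _ => _) = fun r => C * chi01 r); first exact/itgZ/chi01_itg.
by apply/funext => r; rewrite mulrC.
Qed.

(** [F] is square integrable but perhaps not integrable on the whole space. Fubini's theorem is
    therefore applied to [F ^+ 2], and [|y| <= 1 + y^2] returns to [F] on the unit segment. *)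
Let avg_ae : {ae leb, forall t, itg (leb1 R) (fun r => chi01 r * F (tr i (r * c) t))}.
Proof.
have := @fub_ae_itg _ _ mR T R (leb1 R) leb
  (fun z => chi01 z.1 * F (tr i (z.1 * c) z.2) ^+ 2) (fun r => chi01 r * sqC) _ (c1i _) _ _.
move=> /(_ _)/wrap[].
  apply: measurable_funM; first exact: measurableT_comp measurable_chi01 measurable_fst.
  by apply: measurable_funX; exact: measurableT_comp LF.1 (measurable_tr2 i c).
move=> /(_ _)/wrap[].
  by move=> r /=; apply: itgZ; exact: (L2r_tr i (r * c) LF).2.
move=> /(_ _)/wrap[].
  move=> r; rewrite [leLHS](_ : _ = \int[leb]_t (chi01 r * F (tr i (r * c) t) ^+ 2)); last first.
    by apply: eq_Rintegral => t _; rewrite ger0_norm//= mulr_ge0 ?chi01_ge0 ?sqr_ge0.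
  rewrite RintegralZl//; last exact: (L2r_tr i (r * c) LF).2.
  by rewrite (Rint_tr _ _ LF.2).
apply: filterS => t ti.
apply: (@itg_le _ _ _ _ _ (fun r => chi01 r + chi01 r * F (tr i (r * c) t) ^+ 2)).
- exact: (measurableT_comp mFtr (measurable_pair2 t)).
- move=> r; rewrite normrM (ger0_norm (chi01_ge0 r)) -[X in _ <= X + _]mulr1 -mulrDr.
  apply: ler_wpM2l; first exact: chi01_ge0.
  by set y := F _; case: (ger0P y) => ?; nra.
- exact: itgD chi01_itg ti.
Qed.

Variable g : T -> R.
Hypothesis Lg : L2r leb g.

Let k (z : mR * T) := chi01 z.1 * F (tr i (z.1 * c) z.2) * g z.2.

Let mk : measurable_fun setT k.
Proof. by apply: measurable_funM => //; exact: measurableT_comp Lg.1 measurable_snd. Qed.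

Let ki r : itg leb (fun t => k (r, t)).
Proof.
rewrite /k /=; rewrite (_ : (fun _ => _) = fun t => chi01 r * (F (tr i (r * c) t) * g t)).
  by apply: itgZ; apply: L2r_mul => //; exact: L2r_tr.
by apply/funext => t; rewrite mulrA.
Qed.

Let kc r : \int[leb]_t `|k (r, t)| <= chi01 r * (sqC + \int[leb]_t (g t ^+ 2)).
Proof.
rewrite /k /=; under eq_Rintegral do rewrite -mulrA normrM (ger0_norm (chi01_ge0 r)).
have Li := L2r_tr i (r * c) LF.
have Lm : itg leb (fun t => F (tr i (r * c) t) * g t) by exact: L2r_mul.
rewrite RintegralZl//; last exact: itg_norm.
apply: ler_wpM2l; first exact: chi01_ge0.
rewrite /sqC -(Rint_tr i (r * c) LF.2) -RintegralD//; [|exact: Li.2|exact: Lg.2].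
apply: Rint_le; [exact: itg_norm|exact: itgD Li.2 Lg.2|].
move=> t; rewrite normrM; set x := F _; set y := g _.
by case: (ger0P x); case: (ger0P y) => ? ?; nra.
Qed.

Let mavg : measurable_fun setT (fun t => avg t * g t).
Proof. by apply: measurable_funM; [exact: measurable_avg|exact: Lg.1]. Qed.

Let avg_gE : {ae leb, forall t, \int[leb1 R]_r k (r, t) = avg t * g t}.
Proof. by apply: filterS avg_ae => t ti; rewrite /avg -RintegralZr. Qed.

Lemma avg_itg : itg leb (fun t => avg t * g t).
Proof. exact: itg_ae mavg avg_gE (fub_itg mk (c1i _) ki kc). Qed.

Lemma avg_eq : \int[leb]_t (avg t * g t) =
  \int[leb1 R]_r (chi01 r * \int[leb]_t (F (tr i (r * c) t) * g t)).
Proof.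
transitivity (\int[leb]_t (\int[leb1 R]_r k (r, t))).
  apply/esym/Rint_ae => //; exact: itg_measurable (fub_itg mk (c1i _) ki kc).
rewrite (fub_eq mk (c1i _) ki kc); apply: eq_Rintegral => r _.
rewrite /k /=; under eq_Rintegral do rewrite -mulrA.
by rewrite RintegralZl//; apply: L2r_mul => //; exact: L2r_tr.
Qed.

Lemma avg_itg1 : itg (leb1 R) (fun r => chi01 r * \int[leb]_t (F (tr i (r * c) t) * g t)).
Proof.
have := fub_itg1 mk (c1i _) ki kc; congr (itg _ _); apply/funext => r.
rewrite /k /=; under eq_Rintegral do rewrite -mulrA.
by rewrite RintegralZl//; apply: L2r_mul => //; exact: L2r_tr.
Qed.
End Average.

End WeakDerivatives.

(** * Translations and integration by parts *)

Section IntegrationByParts.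
Variables (R : realType) (N : nat).
Local Notation mR := (measurableTypeR R).
Local Notation E := 'rV[R]_N.
Local Notation leb := (lebesgueN R N).
Local Notation T := (N.-tuple mR).
Implicit Types (f g : T -> R) (h r s : R).

Lemma Rint_chi01_FTC (F G : R -> R) : (forall r : R, is_derive r 1 F (G r)) ->
  continuous G -> itg (leb1 R) (fun r => chi01 r * G r) /\ \int[leb1 R]_r (chi01 r * G r) = F 1 - F 0.
Proof.
move=> dF cG.
have chiE (r : R) : chi01 r * G r = (G \_ `[0, 1]%classic) r.
  by rewrite /chi01 indicE patchE; case: (r \in _); rewrite ?mul1r ?mul0r.
split.
  have : lebesgue_measure.-integrable `[(0 : R), 1]%classic (EFin \o G).
    apply: continuous_compact_integrable; first exact: segment_compact.
    exact: continuous_subspaceT.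
  move=> /integrable_mkcond-/(_ (measurable_itv _)).
  by rewrite restrict_EFin; congr (_.-integrable setT _); apply/funext => r /=; rewrite chiE.
have cF : continuous F.
  by move=> x; apply/differentiable_continuous/derivable1_diffP; case: (dF x).
have := @continuous_FTC2 R G F 0 1 ltr01 _ _ _.
move=> /(_ _)/wrap[]; first exact: continuous_subspaceT.
move=> /(_ _)/wrap[].
  split; first by move=> x _; case: (dF x).
  - exact: cvg_at_right_filter (cF 0).
  - exact: cvg_at_left_filter (cF 1).
move=> /(_ _)/wrap[]; first by move=> x _; rewrite derive1E; case: (dF x).
move=> H; rewrite /Rintegral -[RHS]/(fine ((F 1)%:E - (F 0)%:E)%E) -H.
rewrite [in RHS]integral_mkcond; congr fine; apply: eq_integral => r _.
by rewrite chiE !patchE; case: ifP.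
Qed.

Lemma line_derive (phi : E -> R) (v x : E) (s r : R) : derivable phi (x + (r * s) *: v) v ->
  is_derive r 1 (fun r => phi (x + (r * s) *: v)) (s * 'D_v phi (x + (r * s) *: v)).
Proof.
move=> dphi; pose F u := phi (x + u *: v).
have dF : is_derive (r * s) 1 F ('D_v phi (x + (r * s) *: v)).
  have E0 h : F (h *: (1 : R) + r * s) = phi (h *: v + (x + (r * s) *: v)).
    rewrite /F [h *: _]mulr1 scalerDl; congr phi.
    by rewrite addrCA addrA.
  split; rewrite /derivable /derive /=.
    by under eq_fun do rewrite E0; exact: dphi.
  by congr (lim _); rewrite /shift /=; under eq_fun do rewrite E0.
rewrite mulrC; apply: (@is_derive1_comp R F (fun r => r * s)).
have : is_derive r 1 (fun r : R => s * r) (s * 1) by exact: is_deriveZ.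
by rewrite mulr1; congr is_derive; apply/funext => z; rewrite mulrC.
Qed.

(** The fundamental theorem of calculus on the segment from [t] to [t + s e_i]; for test functions
    the mean value formula of [avg] holds at every point. *)
Lemma btens_avg n a b i s (t : T) :
  s * avg i s (fun t => 'D_(delta_mx 0 i) (btens n a b) (pt t)) t =
  btens n a b (pt (tr i s t)) - btens n a b (pt t).
Proof.
set phi := btens n a b; pose e : E := delta_mx 0 i.
have [] := @Rint_chi01_FTC (fun r => phi (pt t + (r * s) *: e))
  (fun r => s * 'D_e phi (pt t + (r * s) *: e)).
- by move=> r; apply: line_derive; exact: btens_derivable.
- move=> r; apply: cvgMr.
  have c1 : pt t + (r' * s) *: e @[r' --> r] --> pt t + (r * s) *: e.
    by apply: cvgD; [exact: cvg_cst|apply: cvgZr_tmp; apply: cvgMl; exact: cvg_id].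
  have c2 : {for pt t + (r * s) *: e, continuous (fun x => 'D_e phi x)}.
    exact: btens_derive_continuous.
  exact: (@continuous_comp _ _ _ (fun r : R => pt t + (r * s) *: e) _ _ c1 c2).
move=> iH; rewrite mul1r mul0r scale0r addr0 pt_tr -/phi -/e => <-.
have [->|s0] := eqVneq s 0.
  rewrite mul0r; under eq_Rintegral do rewrite mul0r mulr0.
  by rewrite /Rintegral integral0.
have iD : itg (leb1 R) (fun r : mR => chi01 r * 'D_e phi (pt (tr i (r * s) t))).
  have := itgZ s^-1 iH; congr itg; apply/funext => r; rewrite pt_tr.
  by rewrite mulrCA mulKf.
rewrite /avg -(RintegralZl s measurableT iD).
by apply: eq_Rintegral => r _; rewrite pt_tr mulrCA.
Qed.

Lemma derive_shift (phi : E -> R) (v c x : E) :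
  'D_v (fun x => phi (x - c)) x = 'D_v phi (x - c).
Proof.
rewrite /derive /=; congr (lim _); rewrite /shift /=.
by under eq_fun do rewrite -addrA.
Qed.

Lemma wder_shift i f f' n a b s : wder i f f' ->
  \int[leb]_t ('D_(delta_mx 0 i) (btens n a b) (pt (tr i (- s) t)) * f t) =
  - \int[leb]_t (f' t * btens n a b (pt (tr i (- s) t))).
Proof.
move=> wf.
pose a' j := a j + (if j == i then s else 0); pose b' j := b j + (if j == i then s else 0).
have E1 (t : T) : btens n a b (pt (tr i (- s) t)) = btens n a' b' (pt t).
  by rewrite btens_shift pt_tr scaleNr.
have E2 (t : T) : 'D_(delta_mx 0 i) (btens n a b) (pt (tr i (- s) t)) =
    'D_(delta_mx 0 i) (btens n a' b') (pt t).
  rewrite (_ : btens n a' b' = fun x => btens n a b (x - s *: delta_mx 0 i)).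
    by rewrite derive_shift pt_tr scaleNr.
  by apply/funext => x; rewrite btens_shift.
under eq_Rintegral do rewrite E2 mulrC.
under [in RHS]eq_Rintegral do rewrite E1.
by apply: wf; exact: btens_test.
Qed.

Lemma Rint_tr_swap i s f g : L2r leb f -> L2r leb g ->
  \int[leb]_t (f (tr i s t) * g t) = \int[leb]_t (f t * g (tr i (- s) t)).
Proof.
move=> Lf Lg; rewrite -(@Rint_tr _ _ i (- s) (fun t => f (tr i s t) * g t)).
  by apply: eq_Rintegral => t _; rewrite tr_add subrr tr0.
by apply: L2r_mul => //; exact: L2r_tr.
Qed.

Section Formula.
Variables (i : 'I_N) (f f' : T -> R).
Hypotheses (Lf : L2r leb f) (Lf' : L2r leb f') (wf : wder i f f').

(** The fundamental theorem of calculus for a weak derivative. Against a bump, the translation is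
    moved onto the bump, where [btens_avg] applies, and the derivative of the bump is moved back
    onto [f] by [wf]. *)
Lemma tr_avg_ae h : {ae leb, forall t, f (tr i h t) - f t - h * avg i h f' t = 0}.
Proof.
have Lth := L2r_tr i h Lf.
apply: locint_test0_ae => [|n a b].
  split.
    apply: measurable_funB; first by apply: measurable_funB; [exact: Lth.1|exact: Lf.1].
    by apply: measurable_funM => //; exact: measurable_avg.
  move=> a b.
  have L1 : L2r leb (\1_(box a b)).
    apply: (@L2r_bounded_box _ _ _ a b 1); first by apply: measurable_indic; exact: measurable_box.
    by move=> t; rewrite mul1r ger0_norm.
  rewrite (_ : (fun t => _) = fun t => (f (tr i h t) - f t) * \1_(box a b) t -
      h * (avg i h f' t * \1_(box a b) t)); last by apply/funext => t; ring.
  apply: itgB; first by apply: L2r_mul => //; exact: L2rB.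
  by apply: itgZ; exact: avg_itg.
pose phi (t : T) := btens n a b (pt t).
have Lphi : L2r leb phi by exact: L2r_btens.
have Ldphi := L2r_btens_derive n a b i.
transitivity (\int[leb]_t (f (tr i h t) * phi t) - \int[leb]_t (f t * phi t) -
    h * \int[leb]_t (avg i h f' t * phi t)).
  have i1 : itg leb (fun t => f (tr i h t) * phi t) by exact: L2r_mul.
  have i2 : itg leb (fun t => f t * phi t) by exact: L2r_mul.
  have i3 : itg leb (fun t => avg i h f' t * phi t) by exact: avg_itg.
  rewrite -RintegralB// -RintegralZl// -RintegralB//; last 2 first.
  - exact: itgB.
  - exact: itgZ.
  by apply: eq_Rintegral => t _; rewrite /phi; ring.
rewrite Rint_tr_swap// avg_eq//.
have i1 : itg leb (fun t => f t * phi (tr i (- h) t)) by apply: L2r_mul => //; exact: L2r_tr.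
have i2 : itg leb (fun t => f t * phi t) by exact: L2r_mul.
rewrite -RintegralB//.
have -> : \int[leb]_t (f t * phi (tr i (- h) t) - f t * phi t) =
    - h * \int[leb]_t (avg i (- h) (fun t => 'D_(delta_mx 0 i) (btens n a b) (pt t)) t * f t).
  rewrite -RintegralZl//; last exact: avg_itg.
  by apply: eq_Rintegral => t _; rewrite mulrA btens_avg /phi; ring.
rewrite avg_eq//; apply/eqP; rewrite subr_eq0 mulNr -mulrN; apply/eqP; congr (_ * _).
rewrite -[LHS]mulN1r -RintegralZl//; last exact: (avg_itg1 i (- h) Ldphi Lf).
apply: eq_Rintegral => r _; rewrite mulN1r -mulrN; congr (_ * _).
rewrite mulrN (wder_shift _ _ _ _ wf) opprK Rint_tr_swap//.
Qed.

Lemma tr_formula h g : L2r leb g ->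
  \int[leb]_t (f (tr i h t) * g t) - \int[leb]_t (f t * g t) =
  h * \int[leb1 R]_r (chi01 r * \int[leb]_t (f' (tr i (r * h) t) * g t)).
Proof.
move=> Lg; have Lth := L2r_tr i h Lf.
have i1 : itg leb (fun t => f (tr i h t) * g t) by exact: L2r_mul.
have i2 : itg leb (fun t => f t * g t) by exact: L2r_mul.
have i3 : itg leb (fun t => avg i h f' t * g t) by exact: avg_itg.
rewrite -avg_eq// -RintegralB// -RintegralZl//.
apply: Rint_ae.
- exact: itg_measurable (itgB i1 i2).
- exact: itg_measurable (itgZ h i3).
- apply: filterS (tr_avg_ae h) => t; rewrite mulrA -mulrBl => /eqP; rewrite subr_eq0 => /eqP ->.
  by [].
Qed.
End Formula.

Section Parts.
Variable i : 'I_N.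

Let sq f := \int[leb]_t (f t ^+ 2).

Let sq_ge0 f : 0 <= sq f.
Proof. by apply: Rintegral_ge0 => t _; exact: sqr_ge0. Qed.

Let mulbound f g s : L2r leb f -> L2r leb g ->
  `|\int[leb]_t (f (tr i s t) * g t)| <= sq f + sq g.
Proof.
move=> Lf Lg; have Lt := L2r_tr i s Lf.
apply: le_trans (Rint_mul_bound Lt Lg) _.
by rewrite lerD2r /sq (Rint_tr i s Lf.2).
Qed.

(** By [tr_formula] the remainder is [h] times the mean of [<f'(. + r h e_i) - f', g>]. Moving the
    translation onto [g] and using the formula for [g] gains a second factor [h] without any
    regularity of [f']. *)
Lemma tr_first_order f f' g g' h : L2r leb f -> L2r leb f' -> L2r leb g -> L2r leb g' ->
  wder i f f' -> wder i g g' ->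
  `|\int[leb]_t (f (tr i h t) * g t) - \int[leb]_t (f t * g t) - h * \int[leb]_t (f' t * g t)|
  <= h ^+ 2 * (sq f' + sq g').
Proof.
move=> Lf Lf' Lg Lg' wf wg; rewrite (tr_formula Lf Lf' wf)//.
set A := fun r => \int[leb]_t (f' (tr i (r * h) t) * g t).
set A0 := \int[leb]_t (f' t * g t).
have Ai : itg (leb1 R) (fun r => chi01 r * A r) by exact: avg_itg1.
have ci := @chi01_itg R.
have -> : h * \int[leb1 R]_r (chi01 r * A r) - h * A0 = h * \int[leb1 R]_r (chi01 r * (A r - A0)).
  rewrite -mulrBr; congr (_ * _).
  rewrite (_ : A0 = \int[leb1 R]_r (A0 * chi01 r)); last by rewrite RintegralZl// Rint_chi01 mulr1.
  rewrite -RintegralB//; last exact: itgZ.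
  by apply: eq_Rintegral => r _; rewrite RintegralZl// Rint_chi01 mulr1; ring.
rewrite normrM expr2 -mulrA -[X in X * _ <= _]/(`|h|).
have H r : `|chi01 r * (A r - A0)| <= (`|h| * (sq f' + sq g')) * chi01 r.
  rewrite normrM (ger0_norm (chi01_ge0 r)) mulrC.
  rewrite /chi01 indicE; have [r01|_] := boolP (r \in _); last by rewrite !mulr0.
  rewrite !mulr1.
  have -> : A r - A0 = \int[leb]_t (g (tr i (- (r * h)) t) * f' t) - \int[leb]_t (g t * f' t).
    rewrite /A /A0 Rint_tr_swap//; congr (_ - _); by apply: eq_Rintegral => t _; rewrite mulrC.
  rewrite (tr_formula Lg Lg' wg)// normrM normrN normrM.
  have B : `|\int[leb1 R]_r0 (chi01 r0 * \int[leb]_t (g' (tr i (r0 * - (r * h)) t) * f' t))| <= sq f' + sq g'.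
    rewrite -[leRHS]mulr1 -Rint_chi01 -RintegralZl//.
    apply: Rint_bound; [exact: avg_itg1|exact: itgZ|].
    move=> r0; rewrite normrM (ger0_norm (chi01_ge0 r0)) mulrC.
    apply: ler_wpM2r; first exact: chi01_ge0.
    by rewrite addrC; exact: mulbound.
  apply: ler_pM => //.
  move/set_mem: r01; rewrite /= in_itv /= => /andP[r0 r1].
  by rewrite (ger0_norm r0) ler_piMl.
have : `|\int[leb1 R]_r (chi01 r * (A r - A0))| <= `|h| * (sq f' + sq g').
  rewrite -[leRHS]mulr1 -Rint_chi01 -RintegralZl//.
  apply: Rint_bound; [|exact: itgZ|exact: H].
  rewrite (_ : (fun r => _) = fun r => chi01 r * A r - A0 * chi01 r); last by apply/funext => r; ring.
  by apply: itgB => //; exact: itgZ.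
move=> HI; apply: le_trans (ler_wpM2l (normr_ge0 h) HI) _.
by rewrite !mulrA -(normrM h h) -!expr2 ger0_norm ?sqr_ge0.
Qed.

(* Both <f', g> and - <f, g'> are derivatives at h = 0 of <f(. + h e_i), g> =
   <f, g(. - h e_i)>; no approximation by smooth functions is needed. *)
Theorem weak_integration_by_parts f f' g g' :
  L2r leb f -> L2r leb f' -> L2r leb g -> L2r leb g' ->
  wder i f f' -> wder i g g' ->
  \int[leb]_t (f' t * g t) = - \int[leb]_t (f t * g' t).
Proof.
move=> Lf Lf' Lg Lg' wf wg.
set a := \int[leb]_t (f' t * g t); set b := \int[leb]_t (f t * g' t).
pose M := sq f' + sq g'.
have M0 : 0 <= M by rewrite addr_ge0.
have H h : 0 < h -> `|a + b| <= h * (M + M).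
  move=> h0.
  have H1 := tr_first_order h Lf Lf' Lg Lg' wf wg.
  have H2 := tr_first_order (- h) Lg Lg' Lf Lf' wg wf.
  move: H2; rewrite Rint_tr_swap// opprK sqrrN (addrC (sq g')) -/M.
  have -> : \int[leb]_t (g t * f (tr i h t)) = \int[leb]_t (f (tr i h t) * g t).
    by apply: eq_Rintegral => t _; rewrite mulrC.
  have -> : \int[leb]_t (g t * f t) = \int[leb]_t (f t * g t).
    by apply: eq_Rintegral => t _; rewrite mulrC.
  have -> : \int[leb]_t (g' t * f t) = b by apply: eq_Rintegral => t _; rewrite mulrC.
  move: H1; rewrite -/a -/M; set m := (X in `|X - h * a|) => H1 H2.
  rewrite -(ler_pM2l h0) -{1}(gtr0_norm h0) -normrM.
  have -> : h * (a + b) = (m - - h * b) - (m - h * a) by ring.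
  apply: le_trans (ler_normB _ _) _.
  by move: H1 H2; rewrite expr2; set x := `|_|; set y := `|_|; nra.
apply/eqP; rewrite -addr_eq0 -normr_le0; apply/ler_addgt0Pr => e e0; rewrite add0r.
have MM : 0 < M + M + 1 by rewrite ltr_wpDl// addr_ge0.
apply: le_trans (H (e / (M + M + 1)) _) _; first by rewrite divr_gt0.
rewrite -mulrA ler_piMr ?(ltW e0)// mulrC ler_pdivrMr// mul1r lerDl.
exact: ler01.
Qed.
End Parts.

End IntegrationByParts.

Local Open Scope complex_scope.
Local Notation cnorm := (@ComplexField.Normc.normc _).
Local Notation Re := (@complex.Re _).
Local Notation Im := (@complex.Im _).

(** * Complex-valued functions in L^2 and H^2 *)

Section ComplexLayer.
Variables (R : realType) (N : nat).
Local Notation mR := (measurableTypeR R).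
Local Notation E := 'rV[R]_N.
Local Notation F := (E -> R[i]).
Local Notation leb := (lebesgueN R N).
Local Notation T := (N.-tuple mR).
Implicit Types (f g u v : F) (z w : R[i]).

Lemma ReM z w : Re (z * w) = Re z * Re w - Im z * Im w.
Proof. by case: z w => [a b] [c d]. Qed.
Lemma ImM z w : Im (z * w) = Re z * Im w + Im z * Re w.
Proof. by case: z w => [a b] [c d]. Qed.
Lemma ReD z w : Re (z + w) = Re z + Re w.
Proof. by case: z w => [a b] [c d]. Qed.
Lemma ImD z w : Im (z + w) = Im z + Im w.
Proof. by case: z w => [a b] [c d]. Qed.
Lemma ReN z : Re (- z) = - Re z.
Proof. by case: z. Qed.
Lemma ImN z : Im (- z) = - Im z.
Proof. by case: z. Qed.
Lemma ReC z : Re (conjc z) = Re z.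
Proof. by case: z. Qed.
Lemma ImC z : Im (conjc z) = - Im z.
Proof. by case: z. Qed.
Definition ReImE := (ReM, ImM, ReD, ImD, ReN, ImN, ReC, ImC).

Lemma Re_sum (I : Type) (s : seq I) (G : I -> R[i]) :
  Re (\sum_(i <- s) G i) = \sum_(i <- s) Re (G i).
Proof. by elim: s => [|a s IH]; rewrite ?big_nil// !big_cons ReD IH. Qed.
Lemma Im_sum (I : Type) (s : seq I) (G : I -> R[i]) :
  Im (\sum_(i <- s) G i) = \sum_(i <- s) Im (G i).
Proof. by elim: s => [|a s IH]; rewrite ?big_nil// !big_cons ImD IH. Qed.

Lemma complex_eqP z w : Re z = Re w -> Im z = Im w -> z = w.
Proof. by case: z w => [a b] [c d] /= -> ->. Qed.

Lemma cnorm_sqr z : cnorm z ^+ 2 = Re z ^+ 2 + Im z ^+ 2.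
Proof. by case: z => a b /=; rewrite sqr_sqrtr// addr_ge0 ?sqr_ge0. Qed.
Lemma cnorm_ge0 z : 0 <= cnorm z.
Proof. by case: z => a b; exact: sqrtr_ge0. Qed.

Definition reF f (t : T) := Re (f (pt t)).
Definition imF f (t : T) := Im (f (pt t)).
Definition L2c f := L2r leb (reF f) /\ L2r leb (imF f).
Definition cmeas f := measurable_fun setT (reF f) /\ measurable_fun setT (imF f).

Lemma measurable_cnorm f : cmeas f -> measurable_fun setT (fun t : T => cnorm (f (pt t))).
Proof.
move=> [mr mi].
have -> : (fun t : T => cnorm (f (pt t))) = fun t => Num.sqrt (reF f t ^+ 2 + imF f t ^+ 2).
  by apply/funext => t; rewrite /reF /imF -cnorm_sqr sqrtr_sqr ger0_norm// cnorm_ge0.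
apply: (@measurableT_comp _ _ _ _ _ _ (Num.sqrt : R -> R)).
  by apply: continuous_measurable_fun; exact: sqrt_continuous.
by apply: measurable_funD; exact: measurable_funX.
Qed.

Lemma LpP (p : R) f : 0 < p ->
  Lp p f <-> cmeas f /\ itg leb (fun t => cnorm (f (pt t)) `^ p).
Proof.
move=> p0; have powge0 : (0 <= \int[leb]_t (cnorm (f (pt t)) `^ p)%:E)%E.
  by apply: integral_ge0 => t _; rewrite lee_fin powR_ge0.
have E1 : Lnorm leb p%:E (fun t => (cnorm (f (pt t)))%:E) =
    ((\int[leb]_t (cnorm (f (pt t)) `^ p)%:E) `^ p^-1)%E.
  rewrite unlock /=; congr (_ `^ _)%E; apply: eq_integral => t _.
  by rewrite /= ger0_norm ?cnorm_ge0.
split=> [[mr mi foo]|[[mr mi] fi]]; split => //.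
- apply/integrableP; split.
    apply/measurable_EFinP; apply: (measurableT_comp (measurable_powR p)).
    exact: measurable_cnorm.
  under eq_integral do rewrite /= ger0_norm ?powR_ge0//.
  move: foo; rewrite E1; move: powge0; case: (\int[leb]_t _)%E => //=.
  - by move=> r _ _; rewrite ltry.
  - by move=> _; rewrite gt_eqF ?invr_gt0.
- rewrite E1 (Rint_EFin fi) /= ltry//.
Qed.

Lemma Lp_normE (p : R) f : 0 < p -> Lp p f ->
  Lp_norm p f = (\int[leb]_t (cnorm (f (pt t)) `^ p)) `^ p^-1.
Proof.
move=> p0 /(LpP _ p0)[_ fi]; rewrite /Lp_norm unlock /=.
rewrite (_ : (\int[leb]_x _)%E = (\int[leb]_t (cnorm (f (pt t)) `^ p))%:E); last first.
  rewrite -(Rint_EFin fi); apply: eq_integral => t _.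
  by rewrite /= ger0_norm ?cnorm_ge0.
by [].
Qed.

Lemma L2c_cmeas f : L2c f -> cmeas f.
Proof. by move=> [[? _] [? _]]. Qed.

Lemma Lp2P f : Lp 2 f <-> L2c f.
Proof.
have E1 : (fun t : T => cnorm (f (pt t)) `^ 2) = fun t => reF f t ^+ 2 + imF f t ^+ 2.
  by apply/funext => t; rewrite powR_mulrn ?cnorm_ge0// cnorm_sqr.
rewrite LpP// E1; split=> [[[mr mi] fi]|Lf].
  split; split => //; apply: itg_le fi.
  - exact: measurable_funX.
  - by move=> t; rewrite ger0_norm ?sqr_ge0// lerDl sqr_ge0.
  - exact: measurable_funX.
  - by move=> t; rewrite ger0_norm ?sqr_ge0// lerDr sqr_ge0.
by split; [exact: L2c_cmeas|exact: itgD Lf.1.2 Lf.2.2].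
Qed.

(* The real part of [L2pair], a real inner product for which f is orthogonal to i f *)
Definition rp f g := \int[leb]_t (reF f t * reF g t + imF f t * imF g t).

Lemma rp_itg f g : L2c f -> L2c g -> itg leb (fun t => reF f t * reF g t + imF f t * imF g t).
Proof. by move=> [? ?] [? ?]; apply: itgD; exact: L2r_mul. Qed.

Lemma rpC f g : rp f g = rp g f.
Proof. by apply: eq_Rintegral => t _; ring. Qed.

Lemma Lp_norm2_sqr f : L2c f -> Lp_norm 2 f ^+ 2 = rp f f.
Proof.
move=> Lf; rewrite Lp_normE//; last exact/Lp2P.
rewrite (_ : \int[leb]_t _ = rp f f); last first.
  by apply: eq_Rintegral => t _; rewrite powR_mulrn ?cnorm_ge0// cnorm_sqr !expr2.
rewrite -powR_mulrn ?powR_ge0// -powRrM mulVf// powRr1//.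
by apply: Rintegral_ge0 => t _; rewrite -!expr2 addr_ge0 ?sqr_ge0.
Qed.

Lemma rp_ge0 f : 0 <= rp f f.
Proof. by apply: Rintegral_ge0 => t _; rewrite -!expr2 addr_ge0 ?sqr_ge0. Qed.

(** Conjugate linearity gives [Im <f, g> = Re <f, i g>]: on a space closed under multiplication by
    [i] the real pairing determines the complex one. *)
Lemma L2pairE f g : L2pair f g = rp f g +i* rp f ('i *: g).
Proof.
apply: complex_eqP => /=; apply: eq_Rintegral => t _; rewrite /reF /imF /=.
  by rewrite !ReImE; ring.
have -> : ('i *: g) (pt t) = 'i * g (pt t) by [].
by rewrite !ReImE /=; ring.
Qed.

(** [weakD] selects a representative, so its linearity holds only up to this relation, which the
    pairing [rp] respects. *)
Definition aeF f g := {ae leb, forall t, f (pt t) = g (pt t)}.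

Lemma aeF_refl f : aeF f f. Proof. exact: aeW. Qed.
Lemma aeF_sym f g : aeF f g -> aeF g f. Proof. by apply: filterS => t ->. Qed.

Lemma reFD f g : reF (f + g) = fun t => reF f t + reF g t.
Proof. by apply/funext => t; exact: ReD. Qed.
Lemma imFD f g : imF (f + g) = fun t => imF f t + imF g t.
Proof. by apply/funext => t; exact: ImD. Qed.
Lemma reFZ z f : reF (z *: f) = fun t => Re z * reF f t - Im z * imF f t.
Proof. by apply/funext => t; exact: ReM. Qed.
Lemma imFZ z f : imF (z *: f) = fun t => Re z * imF f t + Im z * reF f t.
Proof. by apply/funext => t; exact: ImM. Qed.

Lemma L2cD f g : L2c f -> L2c g -> L2c (f + g).
Proof. by move=> [? ?] [? ?]; split; rewrite ?reFD ?imFD; exact: L2rD. Qed.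

Lemma L2cZ z f : L2c f -> L2c (z *: f).
Proof.
by move=> [? ?]; split; rewrite ?reFZ ?imFZ; [apply: L2rB|apply: L2rD]; exact: L2rZ.
Qed.

Lemma L2c0 : L2c 0.
Proof. by split; exact: L2r0. Qed.

Lemma L2c_sum (I : Type) (s : seq I) (G : I -> F) :
  (forall i, L2c (G i)) -> L2c (\sum_(i <- s) G i).
Proof.
move=> LG; elim: s => [|a s IH]; first by rewrite big_nil; exact: L2c0.
by rewrite big_cons; exact: L2cD.
Qed.

Lemma rpDl f f' g : L2c f -> L2c f' -> L2c g -> rp (f + f') g = rp f g + rp f' g.
Proof.
move=> Lf Lf' Lg; rewrite /rp -RintegralD//; [|exact: rp_itg|exact: rp_itg].
by apply: eq_Rintegral => t _; rewrite reFD imFD; ring.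
Qed.

Lemma rpZl (c : R) f g : L2c f -> L2c g -> rp (c%:C *: f) g = c * rp f g.
Proof.
move=> Lf Lg; rewrite /rp -RintegralZl//; last exact: rp_itg.
by apply: eq_Rintegral => t _; rewrite reFZ imFZ /=; ring.
Qed.

Lemma rpZr (c : R) f g : L2c f -> L2c g -> rp f (c%:C *: g) = c * rp f g.
Proof. by move=> *; rewrite rpC rpZl// !(rpC f). Qed.

Lemma rp0l g : rp 0 g = 0.
Proof.
rewrite /rp (_ : \int[leb]_t _ = \int[leb]_t (0 : R)).
  by rewrite /Rintegral integral0.
by apply: eq_Rintegral => t _; rewrite /reF /imF /= !mul0r addr0.
Qed.

Lemma rp_suml (I : Type) (s : seq I) (G : I -> F) g : (forall i, L2c (G i)) -> L2c g ->
  rp (\sum_(i <- s) G i) g = \sum_(i <- s) rp (G i) g.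
Proof.
move=> LG Lg; elim: s => [|a s IH]; first by rewrite !big_nil rp0l.
by rewrite !big_cons rpDl// ?IH//; exact: L2c_sum.
Qed.

Lemma rp_i f g : rp f ('i *: f) = 0.
Proof.
rewrite /rp (_ : \int[leb]_t _ = \int[leb]_t (0 : R)).
  by rewrite /Rintegral integral0.
by apply: eq_Rintegral => t _; rewrite reFZ imFZ /=; ring.
Qed.

Lemma aeF_reF f g : aeF f g -> {ae leb, forall t, reF f t = reF g t}.
Proof. by apply: filterS => t; rewrite /reF => ->. Qed.
Lemma aeF_imF f g : aeF f g -> {ae leb, forall t, imF f t = imF g t}.
Proof. by apply: filterS => t; rewrite /imF => ->. Qed.

Lemma rp_ae f f' g g' : L2c f -> L2c f' -> L2c g -> L2c g' -> aeF f f' -> aeF g g' ->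
  rp f g = rp f' g'.
Proof.
move=> Lf Lf' Lg Lg' ff gg; apply: Rint_ae.
- exact: itg_measurable (rp_itg Lf Lg).
- exact: itg_measurable (rp_itg Lf' Lg').
- by apply: filterS2 ff gg => t; rewrite /reF /imF => -> ->.
Qed.

End ComplexLayer.

(** * Linearity of weak derivatives and the Dirichlet form *)

Section WeakDerivativeAlgebra.
Variables (R : realType) (N : nat).
Local Notation mR := (measurableTypeR R).
Local Notation E := 'rV[R]_N.
Local Notation F := (E -> R[i]).
Local Notation leb := (lebesgueN R N).
Local Notation T := (N.-tuple mR).
Implicit Types (f g u v : F) (z : R[i]) (i j : 'I_N).

Lemma L2c_comb (I : Type) (s : seq I) (c : I -> R[i]) (G : I -> F) :
  (forall k, L2c (G k)) -> L2c (\sum_(k <- s) c k *: G k).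
Proof. by move=> LG; apply: L2c_sum => k; exact: (L2cZ (c k) (LG k)). Qed.

Lemma wderD i (f f' g g' : T -> R) : L2r leb f -> L2r leb f' -> L2r leb g -> L2r leb g' ->
  wder i f g -> wder i f' g' -> wder i (fun t => f t + f' t) (fun t => g t + g' t).
Proof.
move=> Lf Lf' Lg Lg' w w' phi tphi.
have Lp := test_L2r tphi; have Ld := test_derive_L2r i tphi.
transitivity (\int[leb]_t (f t * 'D_(delta_mx 0 i) phi (pt t) + f' t * 'D_(delta_mx 0 i) phi (pt t))).
  by apply: eq_Rintegral => t _; rewrite mulrDl.
rewrite RintegralD//; [|exact: L2r_mul|exact: L2r_mul].
rewrite w// w'// -opprD -RintegralD//; [|exact: L2r_mul|exact: L2r_mul].
by congr (- _); apply: eq_Rintegral => t _; rewrite mulrDl.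
Qed.

Lemma wderZ i (c : R) (f g : T -> R) : L2r leb f -> L2r leb g ->
  wder i f g -> wder i (fun t => c * f t) (fun t => c * g t).
Proof.
move=> Lf Lg w phi tphi.
have Lp := test_L2r tphi; have Ld := test_derive_L2r i tphi.
under eq_Rintegral do rewrite -mulrA.
under [in RHS]eq_Rintegral do rewrite -mulrA.
rewrite !RintegralZl//; [|exact: L2r_mul|exact: L2r_mul].
by rewrite w// mulrN.
Qed.

Lemma wder_ae i (f f' g : T -> R) : L2r leb f -> L2r leb f' ->
  {ae leb, forall t, f t = f' t} -> wder i f g -> wder i f' g.
Proof.
move=> Lf Lf' ff w phi tphi; rewrite -w//; have Ld := test_derive_L2r i tphi.
apply: Rint_ae.
- exact: itg_measurable (L2r_mul Lf' Ld).
- exact: itg_measurable (L2r_mul Lf Ld).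
- by apply: filterS ff => t ->.
Qed.

Lemma is_weakDP i f g :
  is_weakD i f g <-> wder i (reF f) (reF g) /\ wder i (imF f) (imF g).
Proof.
have key (phi : E -> R) : cintegral (fun x => f x * ('D_(delta_mx 0 i) phi x)%:C) =
      \int[leb]_t (reF f t * 'D_(delta_mx 0 i) phi (pt t)) +i*
      \int[leb]_t (imF f t * 'D_(delta_mx 0 i) phi (pt t)).
  apply: complex_eqP => /=; apply: eq_Rintegral => t _.
    by rewrite ReM /= mulr0 subr0.
  by rewrite ImM /= mulr0 add0r.
have key2 (phi : E -> R) : - cintegral (fun x => g x * (phi x)%:C) =
      (- \int[leb]_t (reF g t * phi (pt t))) +i* (- \int[leb]_t (imF g t * phi (pt t))).
  apply: complex_eqP => /=; congr (- _); apply: eq_Rintegral => t _.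
    by rewrite ReM /= mulr0 subr0.
  by rewrite ImM /= mulr0 add0r.
split=> [H|[H1 H2] phi tphi]; last by rewrite key key2 H1// H2.
by split=> phi tphi; have := H phi tphi; rewrite key key2 => -[].
Qed.

Lemma is_weakDD i f f' g g' : L2c f -> L2c f' -> L2c g -> L2c g' ->
  is_weakD i f g -> is_weakD i f' g' -> is_weakD i (f + f') (g + g').
Proof.
move=> [? ?] [? ?] [? ?] [? ?] /is_weakDP[? ?] /is_weakDP[? ?].
by apply/is_weakDP; rewrite !reFD !imFD; split; exact: wderD.
Qed.

Lemma is_weakDZ i z f g : L2c f -> L2c g -> is_weakD i f g -> is_weakD i (z *: f) (z *: g).
Proof.
move=> [? ?] [? ?] /is_weakDP[? ?]; apply/is_weakDP; rewrite !reFZ !imFZ; split.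
  have E1 (h : F) : (fun t : T => Re z * reF h t - Im z * imF h t) =
      fun t => Re z * reF h t + (- Im z) * imF h t by apply/funext => t; rewrite mulNr.
  rewrite !E1.
  by apply: wderD; try exact: L2rZ; exact: wderZ.
by apply: wderD; try exact: L2rZ; exact: wderZ.
Qed.

Lemma is_weakD0 i : is_weakD i (0 : F) (0 : F).
Proof.
have H := is_weakDZ (i := i) (0 : R[i]).
move=> phi _; rewrite /cintegral /rintegral.
have E0 (G : E -> R[i]) (psi : E -> R) : (forall x, G x = 0) ->
    rintegral (fun x => Re (G x * (psi x)%:C)) = 0 /\ rintegral (fun x => Im (G x * (psi x)%:C)) = 0.
  move=> G0; rewrite /rintegral; split.
    by under eq_Rintegral do rewrite G0 mul0r /=; rewrite /Rintegral integral0.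
  by under eq_Rintegral do rewrite G0 mul0r /=; rewrite /Rintegral integral0.
have [e1 e2] := @E0 (fun=> 0) (fun x => 'D_(delta_mx 0 i) phi x) (fun=> erefl).
have [e3 e4] := @E0 (fun=> 0) phi (fun=> erefl).
by apply: complex_eqP => /=; rewrite ?[LHS]e1 ?[LHS]e2 ?[X in - X]e3 ?[X in - X]e4 oppr0.
Qed.

Lemma is_weakD_sum i (I : Type) (s : seq I) (G G' : I -> F) (c : I -> R[i]) :
  (forall k, L2c (G k)) -> (forall k, L2c (G' k)) ->
  (forall k, is_weakD i (G k) (G' k)) ->
  is_weakD i (\sum_(k <- s) c k *: G k) (\sum_(k <- s) c k *: G' k).
Proof.
move=> LG LG' w; elim: s => [|a s IH]; first by rewrite !big_nil; exact: is_weakD0.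
rewrite !big_cons; apply: is_weakDD => //; try exact: L2cZ.
- exact: L2c_comb.
- exact: L2c_comb.
- exact: is_weakDZ.
Qed.

Lemma is_weakD_ael i f f' g : L2c f -> L2c f' -> aeF f f' ->
  is_weakD i f g -> is_weakD i f' g.
Proof.
move=> [? ?] [? ?] ff /is_weakDP[? ?]; apply/is_weakDP; split.
  by apply: wder_ae (aeF_reF ff) _.
by apply: wder_ae (aeF_imF ff) _.
Qed.

Lemma is_weakD_unique i f g g' : L2c g -> L2c g' ->
  is_weakD i f g -> is_weakD i f g' -> aeF g g'.
Proof.
move=> [? ?] [? ?] /is_weakDP[w1 w2] /is_weakDP[w1' w2'].
have h1 := wder_unique _ _ w1 w1'; have h2 := wder_unique _ _ w2 w2'.
by apply: filterS2 (h1 _ _) (h2 _ _) => // t; exact: complex_eqP.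
Qed.

Lemma weakD_spec i f g : L2c g -> is_weakD i f g ->
  [/\ L2c (weakD i f), is_weakD i f (weakD i f) & aeF g (weakD i f)].
Proof.
move=> Lg w.
have [L w'] : Lp 2 (weakD i f) /\ is_weakD i f (weakD i f).
  apply: (@xgetPex _ 0 [set g | Lp 2 g /\ is_weakD i f g]); exists g; split => //.
  exact/Lp2P.
have {}L : L2c (weakD i f) by exact/Lp2P.
by split => //; exact: is_weakD_unique w w'.
Qed.

Lemma rp_parts i f g f' g' : L2c f -> L2c f' -> L2c g -> L2c g' ->
  is_weakD i f f' -> is_weakD i g g' -> rp f' g = - rp f g'.
Proof.
move=> [? ?] [? ?] [? ?] [? ?] /is_weakDP[w1 w2] /is_weakDP[w1' w2'].
rewrite /rp RintegralD//; [|exact: L2r_mul|exact: L2r_mul].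
rewrite RintegralD//; [|exact: L2r_mul|exact: L2r_mul].
rewrite (weak_integration_by_parts _ _ _ _ w1 w1')//.
by rewrite (weak_integration_by_parts _ _ _ _ w2 w2')// opprD.
Qed.

(** The content of [Hk 2] expressed with the selected representatives, which are the functions that
    [laplacian] and [energy] contain. *)
Definition H2 f := [/\ L2c f, forall i, L2c (weakD i f) /\ is_weakD i f (weakD i f) &
  forall i j, L2c (weakD j (weakD i f)) /\ is_weakD j (weakD i f) (weakD j (weakD i f))].

Lemma Hk_H2 f : Hk 2 f -> H2 f.
Proof.
move=> [/Lp2P Lf H]; split => // i.
  have [g [wg [/Lp2P Lg _]]] := H i.
  by have [] := weakD_spec Lg wg.
move=> j; have [g [wg [/Lp2P Lg Hg]]] := H i.
have [LD wD aeD] := weakD_spec Lg wg.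
have [g' [wg' /Lp2P Lg']] := Hg j.
(* The second derivative is known for the witness [g]; it passes to [weakD i f], which equals [g]
   almost everywhere. *)
have w2 := is_weakD_ael Lg LD aeD wg'.
by have [] := weakD_spec Lg' w2.
Qed.

Section LinearCombination.
Variables (m : nat) (w : 'I_m -> F) (c : 'I_m -> R[i]).
Hypothesis Hw : forall k, H2 (w k).

Let u := \sum_k c k *: w k.

Lemma weakD_comb i : aeF (weakD i u) (\sum_k c k *: weakD i (w k)).
Proof.
have L1 k : L2c (w k) by have [] := Hw k.
have L2 k : L2c (weakD i (w k)) by have [_ /(_ i)[]] := Hw k.
have W k : is_weakD i (w k) (weakD i (w k)) by have [_ /(_ i)[]] := Hw k.
have Ls : L2c (\sum_k c k *: weakD i (w k)) by exact: (L2c_comb _ c L2).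
have [_ _] := weakD_spec Ls (is_weakD_sum _ c L1 L2 W).
exact: aeF_sym.
Qed.

Lemma H2_comb : H2 u.
Proof.
have L1 k : L2c (w k) by have [] := Hw k.
have L2 i k : L2c (weakD i (w k)) by have [_ /(_ i)[]] := Hw k.
have W i k : is_weakD i (w k) (weakD i (w k)) by have [_ /(_ i)[]] := Hw k.
have L3 i j k : L2c (weakD j (weakD i (w k))) by have [_ _ /(_ i j)[]] := Hw k.
have W3 i j k : is_weakD j (weakD i (w k)) (weakD j (weakD i (w k))).
  by have [_ _ /(_ i j)[]] := Hw k.
have Ls i : L2c (\sum_k c k *: weakD i (w k)) by exact: (L2c_comb _ c (L2 i)).
split.
- exact: (L2c_comb _ c L1).
- by move=> i; have [] := weakD_spec (Ls i) (is_weakD_sum _ c L1 (L2 i) (W i)).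
- move=> i j; have [LD _ aeD] := weakD_spec (Ls i) (is_weakD_sum _ c L1 (L2 i) (W i)).
  have w2 := is_weakD_ael (Ls i) LD aeD (is_weakD_sum _ c (L2 i) (L3 i j) (W3 i j)).
  have Ls3 : L2c (\sum_k c k *: weakD j (weakD i (w k))) by exact: (L2c_comb _ c (L3 i j)).
  by have [] := weakD_spec Ls3 w2.
Qed.

Lemma weakD2_comb i j : aeF (weakD j (weakD i u)) (\sum_k c k *: weakD j (weakD i (w k))).
Proof.
have L1 k : L2c (w k) by have [] := Hw k.
have L2 k : L2c (weakD i (w k)) by have [_ /(_ i)[]] := Hw k.
have W k : is_weakD i (w k) (weakD i (w k)) by have [_ /(_ i)[]] := Hw k.
have L3 k : L2c (weakD j (weakD i (w k))) by have [_ _ /(_ i j)[]] := Hw k.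
have W3 k : is_weakD j (weakD i (w k)) (weakD j (weakD i (w k))).
  by have [_ _ /(_ i j)[]] := Hw k.
have Ls : L2c (\sum_k c k *: weakD i (w k)) by exact: (L2c_comb _ c L2).
have [LD _ aeD] := weakD_spec Ls (is_weakD_sum _ c L1 L2 W).
have w2 := is_weakD_ael Ls LD aeD (is_weakD_sum _ c L2 L3 W3).
have Ls3 : L2c (\sum_k c k *: weakD j (weakD i (w k))) by exact: (L2c_comb _ c L3).
by have [_ _] := weakD_spec Ls3 w2; exact: aeF_sym.
Qed.
End LinearCombination.

Definition gradp u v := \sum_i rp (weakD i u) (weakD i v).

Lemma laplacian_L2c u : H2 u -> L2c (laplacian u).
Proof. by move=> [_ _ H]; apply: L2c_sum => i; exact: (H i i).1. Qed.

Lemma rp_laplacian u v : H2 u -> H2 v -> rp (laplacian u) v = - gradp u v.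
Proof.
move=> [Lu Hu Hu2] [Lv Hv Hv2]; rewrite /laplacian rp_suml//; last by move=> i; exact: (Hu2 i i).1.
rewrite /gradp -sumrN; apply: eq_bigr => i _.
have [? ?] := Hu i; have [? ?] := Hu2 i i; have [? ?] := Hv i.
by apply: (@rp_parts i (weakD i u) v).
Qed.

Lemma gradp_suml (m : nat) (w : 'I_m -> F) (c : 'I_m -> R) v : (forall k, H2 (w k)) -> H2 v ->
  gradp (\sum_k (c k)%:C *: w k) v = \sum_k c k * gradp (w k) v.
Proof.
move=> Hw [_ Hv _]; rewrite /gradp.
under [RHS]eq_bigr do rewrite mulr_sumr.
rewrite exchange_big /=; apply: eq_bigr => i _.
have [Lv _] := Hv i.
have [_ /(_ i)[Lu _] _] := H2_comb (fun k => (c k)%:C) Hw.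
have Lw k : L2c (weakD i (w k)) by have [_ /(_ i)[]] := Hw k.
have Lz k : L2c ((c k)%:C *: weakD i (w k)) by exact: (L2cZ _ (Lw k)).
have Ls : L2c (\sum_k (c k)%:C *: weakD i (w k)) by exact: (L2c_comb _ (fun k => (c k)%:C) Lw).
rewrite (rp_ae Lu Ls Lv Lv (weakD_comb _ Hw i) (aeF_refl _)).
rewrite (rp_suml _ Lz Lv).
by apply: eq_bigr => k _; rewrite (rpZl _ (Lw k) Lv).
Qed.

Lemma gradpC u v : gradp u v = gradp v u.
Proof. by apply: eq_bigr => i _; rewrite rpC. Qed.

Lemma gradp_i u : H2 u -> gradp u ('i *: u) = 0.
Proof.
move=> [Lu Hu _]; rewrite /gradp big1// => i _; have [LD wD] := Hu i.
have [LD' _ ae] := weakD_spec (L2cZ 'i LD) (is_weakDZ 'i Lu LD wD).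
by rewrite -(rp_ae LD LD (L2cZ 'i LD) LD' (aeF_refl _) ae) rp_i.
Qed.

End WeakDerivativeAlgebra.

(** * Ordinary differential equations conserving the Euclidean norm *)

Lemma max_lip (R : realType) (a x y : R) : `|Num.max a x - Num.max a y| <= `|x - y|.
Proof.
rewrite ler_norml; have := ler_norm (x - y); have := ler_norm (y - x).
rewrite (distrC y); set z := `|_|.
by case: (leP a x) => ?; case: (leP a y) => ?; move=> ? ?; apply/andP; split; lra.
Qed.

Lemma min_lip (R : realType) (a x y : R) : `|Num.min a x - Num.min a y| <= `|x - y|.
Proof.
rewrite ler_norml; have := ler_norm (x - y); have := ler_norm (y - x).
rewrite (distrC y); set z := `|_|.
by case: (leP a x) => ?; case: (leP a y) => ?; move=> ? ?; apply/andP; split; lra.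
Qed.

Section TimeDerivative.
Variables (R : realType) (T : \bar R).
Implicit Types (phi psi d : R -> R).

Definition itv0 (t : R) := (0 <= t) && (t%:E < T)%E.

Lemma itv0_le s t : 0 <= s -> s <= t -> itv0 t -> itv0 s.
Proof.
by move=> s0 st /andP[_ tT]; rewrite /itv0 s0 (le_lt_trans _ tT)// lee_fin.
Qed.

(* Derivative on [0, T), one-sided at 0; values outside of [0, T) play no role. *)
Definition hasd phi d := forall t, itv0 t -> forall e : R, 0 < e ->
  exists2 r : R, 0 < r & forall s, itv0 s -> `|s - t| < r ->
    `|phi s - phi t - (s - t) * d t| <= e * `|s - t|.

Lemma hasd_continuous phi d t : hasd phi d -> itv0 t -> forall e : R, 0 < e ->
  exists2 r : R, 0 < r & forall s, itv0 s -> `|s - t| < r -> `|phi s - phi t| <= e.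
Proof.
move=> H tT e e0; have [r r0 Hr] := H t tT 1 ltr01.
have K0 : 0 < 1 + `|d t| by rewrite ltr_pwDl.
exists (Num.min r (e / (1 + `|d t|))); first by rewrite lt_min r0 divr_gt0.
move=> s sT; rewrite lt_min => /andP[/(Hr s sT) H1 H2].
move: H2; rewrite ltr_pdivlMr// => H2.
have -> : phi s - phi t = (phi s - phi t - (s - t) * d t) + (s - t) * d t by ring.
apply: le_trans (ler_normD _ _) _; rewrite normrM.
apply: le_trans (ltW H2); rewrite mulrDr mulr1 lerD2r.
by move: H1; rewrite mul1r.
Qed.

Lemma hasdD phi psi d d' : hasd phi d -> hasd psi d' ->
  hasd (fun t => phi t + psi t) (fun t => d t + d' t).
Proof.
move=> H H' t tT e e0.
have e2 : 0 < e / 2 by rewrite divr_gt0.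
have [r r0 Hr] := H t tT _ e2; have [r' r0' Hr'] := H' t tT _ e2.
exists (Num.min r r'); first by rewrite lt_min r0.
move=> s sT; rewrite lt_min => /andP[/(Hr s sT) H1 /(Hr' s sT) H2].
have -> : phi s + psi s - (phi t + psi t) - (s - t) * (d t + d' t) =
  (phi s - phi t - (s - t) * d t) + (psi s - psi t - (s - t) * d' t) by ring.
by apply: le_trans (ler_normD _ _) _; rewrite [leRHS](splitr (e * _)) mulrAC lerD.
Qed.

Lemma hasdM phi psi d d' : hasd phi d -> hasd psi d' ->
  hasd (fun t => phi t * psi t) (fun t => d t * psi t + phi t * d' t).
Proof.
move=> H H' t tT e e0.
pose K := 1 + `|psi t| + `|phi t| + `|d t|.
have K0 : 0 < K by rewrite /K !ltr_pwDl.
(* There are three error terms, each at most [e / 3 * |s - t|]; the summand 1 in [K] absorbs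
   [|psi s - psi t| <= 1]. *)
have eK : 0 < e / (3 * K) by rewrite divr_gt0// mulr_gt0.
have [r1 r10 Hr1] := hasd_continuous H' tT eK.
have [r2 r20 Hr2] := hasd_continuous H' tT ltr01.
have [r3 r30 Hr3] := H t tT _ eK; have [r4 r40 Hr4] := H' t tT _ eK.
exists (Num.min (Num.min r1 r2) (Num.min r3 r4)); first by rewrite !lt_min r10 r20 r30 r40.
move=> s sT; rewrite !lt_min => /andP[/andP[/(Hr1 s sT) h1 /(Hr2 s sT) h2]].
move=> /andP[/(Hr3 s sT) h3 /(Hr4 s sT) h4].
have -> : phi s * psi s - phi t * psi t - (s - t) * (d t * psi t + phi t * d' t) =
  (phi s - phi t - (s - t) * d t) * psi s + phi t * (psi s - psi t - (s - t) * d' t)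
  + (s - t) * d t * (psi s - psi t) by ring.
have hs : `|psi s| <= K.
  rewrite -(subrK (psi t) (psi s)); apply: le_trans (ler_normD _ _) _.
  by rewrite /K; have := normr_ge0 (phi t); have := normr_ge0 (d t); lra.
have hp : `|phi t| <= K.
  by rewrite /K; have := normr_ge0 (psi t); have := normr_ge0 (d t); lra.
have hd : `|d t| <= K.
  by rewrite /K; have := normr_ge0 (psi t); have := normr_ge0 (phi t); lra.
set e' := e / (3 * K) in eK h1 h3 h4.
have E1 : e * `|s - t| = (e' * `|s - t|) * K + K * (e' * `|s - t|) + `|s - t| * K * e'.
  by rewrite /e'; field; rewrite gt_eqF.
rewrite E1; apply: le_trans (ler_normD _ _) _; apply: lerD.
  by apply: le_trans (ler_normD _ _) _; apply: lerD; rewrite normrM; apply: ler_pM.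
by rewrite !normrM; apply: ler_pM => //; apply: ler_pM.
Qed.

Lemma hasd_cst (c : R) : hasd (fun=> c) (fun=> 0).
Proof.
move=> t _ e e0; exists 1 => // s _ _.
by rewrite subrr mulr0 subr0 normr0 mulr_ge0// ltW.
Qed.

Lemma hasd_sum (I : Type) (s : seq I) (phi d : I -> R -> R) :
  (forall i, hasd (phi i) (d i)) ->
  hasd (fun t => \sum_(i <- s) phi i t) (fun t => \sum_(i <- s) d i t).
Proof.
move=> H; elim: s => [|a s IH].
  have E0 (G : I -> R -> R) : (fun t => \sum_(i <- [::]) G i t) = (fun=> 0).
    by apply/funext => t; rewrite big_nil.
  by rewrite !E0; exact: hasd_cst.
have E1 (G : I -> R -> R) :
    (fun t => \sum_(i <- a :: s) G i t) = (fun t => G a t + \sum_(i <- s) G i t).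
  by apply/funext => t; rewrite big_cons.
by rewrite !E1; exact: hasdD.
Qed.

Lemma hasd_eq phi d d' : (forall t, itv0 t -> d t = d' t) -> hasd phi d -> hasd phi d'.
Proof. by move=> dd H t tT; rewrite -dd//; exact: H. Qed.

Lemma is_derive_hasd phi d : (forall t : R, is_derive t 1 phi (d t)) -> hasd phi d.
Proof.
move=> H t _ e e0; have /is_derive_epsP/(_ e e0)[r r0 Hr] := H t.
by exists r => // s _ st; have := Hr _ st; rewrite (addrC t) subrK.
Qed.

Lemma hasd_nincr phi d : hasd phi d -> (forall t, itv0 t -> d t <= 0) ->
  forall t, itv0 t -> phi t <= phi 0.
Proof.
move=> H d0 t tT; have /andP[t0 _] := tT.
(* Clamping the time to [[0, t]] extends [phi] to a continuous function on the line without changing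
   its derivative in the interior, so that the mean value theorem applies. *)
pose cl s : R := Num.min t (Num.max 0 s).
have cl0 s : 0 <= cl s by rewrite /cl le_min t0 le_max lexx.
have clt s : cl s <= t by rewrite /cl ge_min lexx.
have clT s : itv0 (cl s) by exact: itv0_le tT.
have cl_lip s s' : `|cl s - cl s'| <= `|s - s'|.
  by apply: le_trans (min_lip _ _ _) (max_lip _ _ _).
have cl_id s : 0 <= s -> s <= t -> cl s = s.
  by move=> s0 st; rewrite /cl (max_r s0) (min_r st).
pose psi s := phi (cl s).
have cpsi : continuous psi.
  move=> s; apply/cvgrPdist_le => e e0.
  have [r r0 Hr] := hasd_continuous H (clT s) e0.
  near=> s'; rewrite distrC; apply: Hr; first exact: clT.
  apply: le_lt_trans (cl_lip _ _) _.
  by near: s'; exists r => //= z; rewrite /= distrC.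
have [||c c0t] := @MVT_segment R psi d 0 t t0.
- move=> x; rewrite in_itv /= => /andP[x0 xt].
  apply/is_derive_epsP => e e0.
  have xT : itv0 x by apply: itv0_le tT; exact: ltW.
  have [r r0 Hr] := H x xT e e0.
  exists (Num.min r (Num.min x (t - x))); first by rewrite !lt_min r0 x0 subr_gt0.
  move=> h; rewrite !lt_min => /and3P[hr hx htx].
  move: (hx) (htx); rewrite !ltr_norml => /andP[? ?] /andP[? ?].
  have E1 : cl (x + h) = x + h by apply: cl_id; lra.
  have E2 : cl x = x by apply: cl_id; lra.
  have xhT : itv0 (x + h) by rewrite -E1.
  rewrite /psi E1 E2; have := Hr _ xhT.
  by rewrite (addrC x) addrK => /(_ hr).
- exact: continuous_subspaceT.
rewrite /psi cl_id// cl_id// subr0 => E1.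
rewrite -subr_le0 E1 mulr_le0_ge0//; apply: d0.
by move: c0t; rewrite in_itv /= => /andP[c0 ct]; exact: itv0_le tT.
Unshelve. all: by end_near. Qed.

Lemma hasdN phi d : hasd phi d -> hasd (fun t => - phi t) (fun t => - d t).
Proof.
move=> H t tT e e0; have [r r0 Hr] := H t tT e e0.
exists r => // s sT st; have := Hr s sT st; rewrite -normrN.
by congr (`|_| <= _); ring.
Qed.

Lemma hasd_const phi d : hasd phi d -> (forall t, itv0 t -> d t = 0) ->
  forall t, itv0 t -> phi t = phi 0.
Proof.
move=> H d0 t tT; apply/eqP; rewrite eq_le; apply/andP; split.
  by apply: (hasd_nincr H) => // s sT; rewrite d0.
by rewrite -lerN2; apply: (hasd_nincr (hasdN H)) => // s sT; rewrite d0// oppr0.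
Qed.

(** [phi t * expR (- K * t)] is nonincreasing and starts at 0. *)
Lemma hasd_gronwall phi d (K : R) : hasd phi d -> (forall t, itv0 t -> 0 <= phi t) ->
  (forall t, itv0 t -> d t <= K * phi t) -> phi 0 = 0 ->
  forall t, itv0 t -> phi t = 0.
Proof.
move=> H phi0 dK p0 t tT.
have dexp : forall t : R, is_derive t 1 (fun t => expR (- K * t)) (expR (- K * t) * - K).
  move=> s; apply: (@is_derive1_comp R expR (fun t => - K * t)).
  have : is_derive s 1 (fun t : R => - K * t) (- K * 1) by exact: is_deriveZ.
  by rewrite mulr1.
have H2 := hasdM H (is_derive_hasd dexp).
have : phi t * expR (- K * t) <= phi 0 * expR (- K * 0).
  apply: (hasd_nincr H2) => // s sT.
  have := dK s sT; have := expR_gt0 (- K * s); set x := expR _; nra.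
rewrite p0 mul0r pmulr_lle0 ?expR_gt0// => tle.
by apply/eqP; rewrite eq_le tle phi0.
Qed.

End TimeDerivative.

(** * Picard iteration for globally Lipschitz fields, and uniqueness for conservative ones *)

Section Picard.
Variables (R : realType) (m : nat).
Local Notation S := ('I_m -> R).
Variable F : S -> S.

Section GlobalLipschitz.
Variable L : R.
Hypothesis L0 : 0 <= L.
Hypothesis FL : forall c d i, `|F c i - F d i| <= L * \sum_j `|c j - d j|.

Lemma primitive_ex (g : R -> R) : continuous g ->
  exists G : R -> R, G 0 = 0 /\ forall x : R, -1 < x -> is_derive x 1 G (g x).
Proof.
(* The integral starts at -1 so that 0 is an interior point, with a two-sided derivative there. *)
move=> cg; pose H x := \int[lebesgue_measure]_(t in `[(-1 : R), x]) g t.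
exists (fun x => H x - H 0); split; first by rewrite subrr.
move=> x x1; have iH : lebesgue_measure.-integrable `[(-1 : R), x + 1] (EFin \o g).
  apply: continuous_compact_integrable; first exact: segment_compact.
  exact: continuous_subspaceT.
have [dH HE] : derivable H x 1 /\ derive1 H x = g x.
  apply: (@continuous_FTC1_closed _ g (-1) x (x + 1)) => //; first by rewrite ltrDl.
  exact: cg.
have dH' : is_derive x 1 H (g x) by rewrite -HE derive1E; exact: derivableP.
rewrite -[g x]subr0; exact: (is_deriveB dH' (is_derive_cst _ _ _)).
Qed.

Definition primitive (g : R -> R) : R -> R :=
  xget (fun=> 0) [set G | G 0 = 0 /\ forall x : R, -1 < x -> is_derive x 1 G (g x)].

Lemma primitiveP g : continuous g ->
  primitive g 0 = 0 /\ forall x : R, -1 < x -> is_derive x 1 (primitive g) (g x).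
Proof.
move=> /primitive_ex[G HG].
by apply: (@xgetPex _ (fun=> 0) [set G | G 0 = 0 /\ forall x : R, -1 < x -> is_derive x 1 G (g x)]); exists G.
Qed.

Variable c0 : S.

(** Taking the maximum of the time with 0 keeps each iterate continuous on the whole line, as
    [primitive] demands of its integrand. *)
Fixpoint picard (k : nat) (t : R) (i : 'I_m) : R :=
  if k is k'.+1 then c0 i + primitive (fun s => F (picard k' s) i) (Num.max 0 t) else c0 i.

Lemma F_comp_continuous (X : R -> S) i : (forall j, continuous (fun t => X t j)) ->
  continuous (fun t => F (X t) i).
Proof.
move=> cX t; apply/cvgrPdist_le => e e0.
have c1 : L * \sum_j `|X t j - X s j| @[s --> t] --> L * \sum_j `|X t j - X t j|.
  apply: cvgMr; elim: (index_enum _) => [|a l IH].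
    by rewrite big_nil; under eq_fun do rewrite big_nil; exact: cvg_cst.
  rewrite big_cons; under eq_fun do rewrite big_cons.
  by apply: cvgD IH; apply: cvg_norm; apply: cvgB; [exact: cvg_cst|exact: cX].
move: c1; rewrite (_ : L * _ = 0); last first.
  by rewrite big1 ?mulr0// => j _; rewrite subrr normr0.
move=> /cvgrPdist_le/(_ e e0); apply: filterS => s; rewrite sub0r normrN => Hs.
by apply: le_trans (FL _ _ _) _; apply: le_trans Hs; exact: ler_norm.
Qed.

Lemma picard_continuous k i : continuous (fun t => picard k t i).
Proof.
elim: k i => [|k IH] i /=; first by move=> t; exact: cvg_cst.
have [_ dp] := primitiveP (@F_comp_continuous _ i IH).
set G := primitive _ in dp *.
have cG x : -1 < x -> {for x, continuous G}.
  by move=> x1; apply/differentiable_continuous/derivable1_diffP; case: (dp x x1).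
move=> t; apply: cvgD; first exact: cvg_cst.
have cm : {for t, continuous (fun t : R => Num.max 0 t)}.
  by apply: continuous_max; [exact: cvg_cst|exact: cvg_id].
apply: (continuous_comp cm); apply: cG.
by rewrite lt_max ltrN10.
Qed.

Lemma picard0 k i : picard k 0 i = c0 i.
Proof.
case: k => // k /=; rewrite maxxx.
by have [-> _] := primitiveP (@F_comp_continuous _ i (@picard_continuous k)); rewrite addr0.
Qed.

(** Gives increments of an iterate by a mean value, so that the regularity of the limit is obtained
    without estimating integrals. *)
Lemma picard_mvt k i s t : 0 <= s -> s <= t ->
  exists2 x, s <= x <= t & picard k.+1 t i - picard k.+1 s i = F (picard k x) i * (t - s).
Proof.
move=> s0 st; have [_ dp] := primitiveP (@F_comp_continuous _ i (@picard_continuous k)).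
have [||x xst Ex] := @MVT_segment R (primitive (fun s => F (picard k s) i)) (fun x => F (picard k x) i) s t st.
- move=> x; rewrite in_itv /= => /andP[sx xt]; apply: dp.
  by rewrite (lt_trans _ sx)// (lt_le_trans _ s0)// ltrN10.
- apply: derivable_within_continuous => x; rewrite in_itv /= => /andP[sx xt].
  have x1 : -1 < x by rewrite (lt_le_trans _ sx)// (lt_le_trans _ s0)// ltrN10.
  by case: (dp x x1).
exists x; first by move: xst; rewrite in_itv.
rewrite -Ex /= (max_r s0) max_r; last exact: le_trans st.
by ring.
Qed.

(** One iteration multiplies a distance of size [exp(K t)] by at most [m L / K <= 1/2]; the summand
    1 gives [K >= 1], hence [t <= exp(K t)], which starts the induction. *)
Let K : R := 2 * (m%:R * L) + 1.
Let B : R := \sum_i `|F c0 i|.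

Let K1 : 1 <= K. Proof. by rewrite /K lerDr mulr_ge0// mulr_ge0. Qed.
Let B0 : 0 <= B. Proof. exact: sumr_ge0. Qed.

Let dexp (x : R) : is_derive x 1 (fun t => expR (K * t)) (expR (K * x) * K).
Proof.
apply: (@is_derive1_comp R expR (fun t => K * t)).
have : is_derive x 1 (fun t : R => K * t) (K * 1) by exact: is_deriveZ.
by rewrite mulr1.
Qed.

Lemma picard_step k i t : 0 <= t ->
  `|picard k.+1 t i - picard k t i| <= B / 2 ^+ k * expR (K * t).
Proof.
elim: k i t => [|k IH] i t t0.
  have [x _] := picard_mvt 0 i (lexx 0) t0; rewrite picard0 /= subr0 => ->.
  rewrite expr0 invr1 mulr1 normrM (ger0_norm t0).
  have FB : `|F c0 i| <= B by rewrite /B (bigD1 i)//= lerDl sumr_ge0.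
  apply: ler_pM => //.
  have := expR_ge1Dx (K * t); have : t <= K * t by rewrite ler_peMl.
  lra.
pose g x := F (picard k.+1 x) i - F (picard k x) i.
pose G x := primitive (fun x => F (picard k.+1 x) i) x - primitive (fun x => F (picard k x) i) x.
have [p1 dp1] := primitiveP (@F_comp_continuous _ i (@picard_continuous k.+1)).
have [p2 dp2] := primitiveP (@F_comp_continuous _ i (@picard_continuous k)).
have dG (x : R) : -1 < x -> is_derive x 1 G (g x).
  by move=> x1; apply: is_deriveB; [exact: dp1|exact: dp2].
pose C := B / 2 ^+ k.+1.
have C0 : 0 <= C by rewrite divr_ge0// exprn_ge0.
have gb x : 0 <= x -> `|g x| <= C * (expR (K * x) * K).
  move=> x0; apply: le_trans (FL _ _ _) _.
  have : \sum_j `|picard k.+1 x j - picard k x j| <= \sum_(j < m) (B / 2 ^+ k * expR (K * x)).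
    by apply: ler_sum => j _; exact: IH.
  rewrite sumr_const card_ord -[X in _ <= X -> _]mulr_natl => H.
  apply: le_trans (ler_wpM2l L0 H) _.
  have E1 : B / 2 ^+ k = 2 * C.
    by rewrite /C exprS; field; rewrite expf_neq0.
  rewrite E1; have : 0 <= C * expR (K * x) by rewrite mulr_ge0// expR_ge0.
  by set y := expR _; rewrite /K; lra.
have E2 : picard k.+2 t i - picard k.+1 t i = G t.
  by rewrite /G /= !(max_r t0); ring.
rewrite E2 -/C; suff: `|G t| <= C * expR (K * t) - C by lra.
(* By [gb], [C * expR (K * x) - sg * G x] has a nonnegative derivative; the signs [1] and [-1]
   together bound [|G t|]. *)
have bnd (sg : R) : `|sg| = 1 -> sg * G t <= C * expR (K * t) - C.
  move=> sg1.
  have [||x xt Ex] := @MVT_segment R (fun x => C * expR (K * x) - sg * G x)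
      (fun x => C * (expR (K * x) * K) - sg * g x) 0 t t0.
  - move=> x; rewrite in_itv /= => /andP[x0 _]; apply: is_deriveB; apply: is_deriveZ; first exact: dexp.
    by apply: dG; apply: lt_trans x0; exact: ltrN10.
  - apply: derivable_within_continuous => x; rewrite in_itv /= => /andP[x0 _].
    have x1 : -1 < x by apply: lt_le_trans x0; exact: ltrN10.
    by have := dG x x1; case=> dGx _; apply: derivableB; apply: derivableZ => //; case: (dexp x).
  move: Ex; rewrite {2}/G p1 p2 subrr mulr0 subr0 mulr0 expR0 mulr1 subr0 => Ex.
  have : 0 <= (C * (expR (K * x) * K) - sg * g x) * t.
    move: xt; rewrite in_itv /= => /andP[x0 _].
    rewrite mulr_ge0// subr_ge0 (le_trans (ler_norm _))// normrM sg1 mul1r.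
    exact: gb.
  lra.
rewrite ler_norml; apply/andP; split.
  by have := bnd (-1); rewrite normrN normr1 => /(_ erefl); lra.
by have := bnd 1; rewrite normr1 => /(_ erefl); lra.
Qed.

(* In the norm weighted by exp(- K t) each iteration halves the distance. *)
Lemma picard_dist k l i t : 0 <= t ->
  `|picard (k + l) t i - picard k t i| <= 2 * B / 2 ^+ k * expR (K * t).
Proof.
(* [2 - 2 / 2 ^+ l] is the sum of the first [l] terms of the geometric series of the steps; this
   exact value lets the induction close. *)
move=> t0; suff : `|picard (k + l) t i - picard k t i| <=
    (2 - 2 / 2 ^+ l) * (B / 2 ^+ k * expR (K * t)).
  move=> H; apply: le_trans H _.
  have : 0 <= B / 2 ^+ k * expR (K * t) by rewrite mulr_ge0 ?divr_ge0 ?expR_ge0// exprn_ge0.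
  have : 0 <= 2 / 2 ^+ l :> R by rewrite divr_ge0// exprn_ge0.
  set x := _ * expR _; set y := 2 / _; have -> : 2 * B / 2 ^+ k * expR (K * t) = 2 * x.
    by rewrite /x; ring.
  nra.
elim: l => [|l IH].
  by rewrite addn0 subrr normr0 expr0 divr1 subrr mul0r.
rewrite addnS; have := picard_step (k + l) i t0 => H.
rewrite -(subrK (picard (k + l) t i) (picard (k + l).+1 t i)) -addrA.
apply: le_trans (ler_normD _ _) _; apply: le_trans (lerD H IH) _.
set x := expR _; rewrite exprD invfM exprS.
have h1 : 2 ^+ k != 0 :> R by rewrite expf_neq0.
have h2 : 2 ^+ l != 0 :> R by rewrite expf_neq0.
by rewrite le_eqVlt; apply/orP; left; apply/eqP; field; apply/andP.
Qed.

Definition picard_lim (t : R) (i : 'I_m) : R := limn (fun k => picard k t i).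

Lemma geom_small (A e : R) : 0 < e -> exists k : nat, A / 2 ^+ k <= e.
Proof.
move=> e0; have : (A * (2^-1) ^+ k) @[k --> \oo] --> A * 0.
  by apply: cvgMr; apply: cvg_expr; rewrite ger0_norm// invf_lt1// ltr1n.
rewrite mulr0 => /cvgrPdist_le/(_ e e0)[k _ /(_ k (leqnn k))] /=.
rewrite sub0r normrN exprVn => H; exists k; exact: le_trans (ler_norm _) H.
Qed.

Lemma picard_cvg t i : 0 <= t -> cvgn (fun k => picard k t i).
Proof.
move=> t0; apply: cauchy_cvg; apply: cauchy_exP => e e0.
have e2 : 0 < e / 2 by rewrite divr_gt0.
have [k Hk] := geom_small (2 * B * expR (K * t)) e2.
exists (picard k t i); exists k => // n /= kn.
rewrite /ball /= distrC -(subnKC kn); apply: le_lt_trans (picard_dist _ _ _ t0) _.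
by rewrite mulrAC; apply: le_lt_trans Hk _; lra.
Qed.

Lemma picard_lim_dist k t i : 0 <= t ->
  `|picard_lim t i - picard k t i| <= 2 * B / 2 ^+ k * expR (K * t).
Proof.
move=> t0; have c1 : `|picard n t i - picard k t i| @[n --> \oo] --> `|picard_lim t i - picard k t i|.
  by apply: cvg_norm; apply: cvgB; [exact: picard_cvg|exact: cvg_cst].
rewrite -(cvg_lim _ c1)//; apply: limr_le; first exact: cvgP c1.
exists k => // n /= kn; rewrite -(subnKC kn); exact: picard_dist.
Qed.

Lemma picard_lim0 i : picard_lim 0 i = c0 i.
Proof.
rewrite /picard_lim (_ : (fun k => _) = fun=> c0 i); first exact: lim_cst.
by apply/funext => k; exact: picard0.
Qed.

(** One index for the whole of [[0, b]]. Both [k] and [k.+1] are controlled because [picard_mvt]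
    expresses increments of iterate [k.+1] through [F] at iterate [k]. *)
Lemma picard_lim_eps (b e : R) : 0 < e -> exists k, forall t i, 0 <= t -> t <= b ->
  `|picard_lim t i - picard k t i| <= e /\ `|picard_lim t i - picard k.+1 t i| <= e.
Proof.
move=> e0; have [k Hk] := geom_small (2 * B * expR (K * b)) e0.
exists k => t i t0 tb.
have eb : expR (K * t) <= expR (K * b).
  by rewrite ler_expR ler_wpM2l// (le_trans ler01 K1).
have p0 : 0 <= 2 * B / 2 ^+ k by rewrite divr_ge0 ?mulr_ge0// exprn_ge0.
have H1 : 2 * B / 2 ^+ k * expR (K * t) <= e.
  by apply: le_trans Hk; rewrite [leRHS]mulrAC ler_wpM2l.
split; apply: le_trans (picard_lim_dist _ _ t0) _ => //.
apply: le_trans H1; rewrite ler_wpM2r ?expR_ge0// exprS invfM mulrCA ler_piMl//.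
by rewrite invf_le1// ler1n.
Qed.

Let M b : R := B + L * (m%:R * (2 * B * expR (K * b))).

Let FM k x i b : 0 <= x -> x <= b -> `|F (picard k x) i| <= M b.
Proof.
move=> x0 xb; rewrite -(subrK (F c0 i) (F _ i)) addrC.
apply: le_trans (ler_normD _ _) _; apply: lerD.
  by rewrite /B (bigD1 i)//= lerDl sumr_ge0.
apply: le_trans (FL _ _ _) _; apply: ler_wpM2l => //.
have : \sum_j `|picard k x j - c0 j| <= \sum_(j < m) (2 * B * expR (K * b)).
  apply: ler_sum => j _.
  have := picard_dist 0 k j x0; rewrite add0n expr0 divr1 => H.
  apply: le_trans H _; rewrite ler_wpM2l ?mulr_ge0// ler_expR ler_wpM2l//.
  exact: le_trans ler01 K1.
by rewrite sumr_const card_ord -[X in _ <= X -> _]mulr_natl.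
Qed.

Let M0 b : 0 <= b -> 0 <= M b.
Proof. by move=> b0; rewrite addr_ge0// !mulr_ge0// expR_ge0. Qed.

Lemma picard_lim_lip s t b i : 0 <= s -> s <= t -> t <= b ->
  `|picard_lim t i - picard_lim s i| <= M b * (t - s).
Proof.
move=> s0 st tb; apply/ler_addgt0Pr => e e0.
have t0 := le_trans s0 st; have sb := le_trans st tb.
have e2 : 0 < e / 2 by rewrite divr_gt0.
have [k Hk] := picard_lim_eps b e2.
have [_ h1] := Hk t i t0 tb; have [_ h2] := Hk s i s0 sb.
have [x /andP[sx xt] Ex] := picard_mvt k i s0 st.
have -> : picard_lim t i - picard_lim s i = (picard k.+1 t i - picard k.+1 s i) +
  ((picard_lim t i - picard k.+1 t i) - (picard_lim s i - picard k.+1 s i)) by ring.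
apply: le_trans (ler_normD _ _) _; apply: lerD.
  rewrite Ex normrM (ger0_norm (_ : 0 <= t - s)) ?subr_ge0// ler_wpM2r ?subr_ge0//.
  by apply: FM; [exact: le_trans sx|exact: le_trans tb].
by apply: le_trans (ler_normB _ _) _; lra.
Qed.

(** The point [y] is free in [[s, t]], so that either endpoint can be the base point: this covers
    the derivative from the left and from the right. *)
Lemma picard_lim_quad s t y b i : 0 <= s -> s <= t -> t <= b -> s <= y -> y <= t ->
  `|picard_lim t i - picard_lim s i - (t - s) * F (picard_lim y) i| <=
  L * (m%:R * M b) * (t - s) ^+ 2.
Proof.
move=> s0 st tb sy yt; apply/ler_addgt0Pr => e e0.
have t0 := le_trans s0 st; have sb := le_trans st tb.
have ts0 : 0 <= t - s by rewrite subr_ge0.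
(* The approximation error [e / D] occurs twice at the endpoints and once inside [F], there with
   factor [(t - s) * L * m]; the total is [e]. *)
pose D := 2 + (t - s) * (L * m%:R).
have D0 : 0 < D by rewrite ltr_wpDr// !mulr_ge0.
have e2 : 0 < e / D by rewrite divr_gt0.
have [k Hk] := picard_lim_eps b e2.
have [_ h1] := Hk t i t0 tb; have [_ h2] := Hk s i s0 sb.
have [x /andP[sx xt] Ex] := picard_mvt k i s0 st.
have x0 := le_trans s0 sx; have xb := le_trans xt tb.
have -> : picard_lim t i - picard_lim s i - (t - s) * F (picard_lim y) i =
  (picard k.+1 t i - picard k.+1 s i - (t - s) * F (picard_lim y) i) +
  ((picard_lim t i - picard k.+1 t i) - (picard_lim s i - picard k.+1 s i)) by ring.
rewrite Ex mulrC -mulrBr.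
have hF : `|F (picard k x) i - F (picard_lim y) i| <= L * (m%:R * (e / D + M b * (t - s))).
  apply: le_trans (FL _ _ _) _; apply: ler_wpM2l => //.
  have : \sum_j `|picard k x j - picard_lim y j| <= \sum_(j < m) (e / D + M b * (t - s)).
    apply: ler_sum => j _.
    have [h _] := Hk x j x0 xb.
    have -> : picard k x j - picard_lim y j =
      - (picard_lim x j - picard k x j) + (picard_lim x j - picard_lim y j) by ring.
    apply: le_trans (ler_normD _ _) _; rewrite normrN; apply: lerD => //.
    have Mb := M0 (le_trans t0 tb).
    have [xy|yx] := leP x y.
      rewrite distrC; apply: le_trans (picard_lim_lip j x0 xy (le_trans yt tb)) _.
      by apply: ler_wpM2l => //; lra.
    apply: le_trans (picard_lim_lip j (le_trans s0 sy) (ltW yx) xb) _.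
    by apply: ler_wpM2l => //; lra.
  by rewrite sumr_const card_ord -[X in _ <= X -> _]mulr_natl.
apply: le_trans (ler_normD _ _) _; rewrite normrM (ger0_norm ts0).
apply: le_trans (lerD (ler_wpM2l ts0 hF) (le_trans (ler_normB _ _) (lerD h1 h2))) _.
have eD : e = e / D * D by rewrite divfK// gt_eqF.
rewrite [X in _ <= _ + X]eD /D.
by rewrite le_eqVlt; apply/orP; left; apply/eqP; ring.
Qed.

Lemma picard_lim_hasd (T : \bar R) i : hasd T (fun t => picard_lim t i) (fun t => F (picard_lim t) i).
Proof.
move=> t /andP[t0 _] e e0; pose C := L * (m%:R * M (t + 1)).
have C0 : 0 <= C by rewrite !mulr_ge0// M0// addr_ge0.
have C1 : 0 < C + 1 by rewrite ltr_wpDl.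
exists (Num.min 1 (e / (C + 1))); first by rewrite lt_min ltr01 divr_gt0.
move=> s /andP[s0 _]; rewrite lt_min => /andP[st1 ste].
have H : `|picard_lim s i - picard_lim t i - (s - t) * F (picard_lim t) i| <= C * `|s - t| ^+ 2.
  have [st|ts] := leP s t.
    rewrite -normrN (_ : - (_ - _) = picard_lim t i - picard_lim s i - (t - s) * F (picard_lim t) i); last by ring.
    by rewrite real_normK ?num_real// -sqrrN opprB; apply: picard_lim_quad => //; lra.
  rewrite real_normK ?num_real//; apply: picard_lim_quad => //; [exact: ltW| |exact: ltW].
  by move: st1; rewrite gtr0_norm ?subr_gt0//; lra.
apply: le_trans H _; rewrite expr2 mulrA ler_wpM2r//.
move: ste; rewrite ltr_pdivlMr//; have := normr_ge0 (s - t); nra.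
Qed.

End GlobalLipschitz.

Section Conservative.
Variable T : \bar R.
Hypothesis Floc : forall rho : R, exists2 L : R, 0 <= L & forall c d,
  (forall i, `|c i| <= rho) -> (forall i, `|d i| <= rho) ->
  forall i, `|F c i - F d i| <= L * \sum_j `|c j - d j|.
Hypothesis Fskew : forall c, \sum_i c i * F c i = 0.

Definition ode_sol (c : R -> S) := forall i, hasd T (fun t => c t i) (fun t => F (c t) i).

Lemma ode_conserved c t : ode_sol c -> itv0 T t ->
  \sum_i c t i ^+ 2 = \sum_i c 0 i ^+ 2.
Proof.
move=> Hc tT.
have H := hasd_sum (index_enum 'I_m) (fun i => hasdM (Hc i) (Hc i)).
under eq_bigr do rewrite expr2; under [RHS]eq_bigr do rewrite expr2.
apply: (hasd_const H) tT => s sT.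
transitivity (\sum_i 2 * (c s i * F (c s) i)); first by apply: eq_bigr => i _; ring.
by rewrite -mulr_sumr Fskew mulr0.
Qed.

Lemma ode_bounded c t i : ode_sol c -> itv0 T t -> `|c t i| <= 1 + \sum_i c 0 i ^+ 2.
Proof.
move=> Hc tT; rewrite -(ode_conserved Hc tT) (bigD1 i)//=.
have : 0 <= \sum_(j | j != i) c t j ^+ 2 by apply: sumr_ge0 => j _; exact: sqr_ge0.
rewrite -(real_normK (num_real (c t i))); have := normr_ge0 (c t i).
by set x := `|_|; nra.
Qed.

(** Conservation keeps both solutions in one cube, where a single Lipschitz constant [L] is valid.
    Summing [|x_i| |x_j| <= (x_i^2 + x_j^2) / 2] gives the Gronwall constant [2 L m] for the squared
    distance. *)
Lemma ode_unique c d : ode_sol c -> ode_sol d -> (forall i, c 0 i = d 0 i) ->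
  forall t, itv0 T t -> forall i, c t i = d t i.
Proof.
move=> Hc Hd cd0.
have [L L0 HL] := Floc (1 + \sum_i c 0 i ^+ 2).
have bc t i : itv0 T t -> `|c t i| <= 1 + \sum_i c 0 i ^+ 2 by exact: ode_bounded.
have bd t i : itv0 T t -> `|d t i| <= 1 + \sum_i c 0 i ^+ 2.
  by under eq_bigr do rewrite cd0; exact: ode_bounded.
pose x i t := c t i + - d t i.
have Hx i : hasd T (x i) (fun t => F (c t) i + - F (d t) i) by apply: hasdD; [exact: Hc|exact: hasdN].
have H := hasd_sum (index_enum 'I_m) (fun i => hasdM (Hx i) (Hx i)).
have E t : itv0 T t -> \sum_i x i t * x i t = 0.
  apply: (hasd_gronwall (K := 2 * (L * m%:R)) H).
  - by move=> s _; apply: sumr_ge0 => i _; rewrite -expr2 sqr_ge0.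
  - move=> s sT; have -> : \sum_i ((F (c s) i + - F (d s) i) * x i s + x i s * (F (c s) i + - F (d s) i))
      = 2 * \sum_i (x i s * (F (c s) i - F (d s) i)).
      by rewrite mulr_sumr; apply: eq_bigr => i _; ring.
    rewrite -mulrA ler_pM2l//.
    have h1 : \sum_i (x i s * (F (c s) i - F (d s) i)) <= \sum_i \sum_j (L / 2 * (x i s ^+ 2 + x j s ^+ 2)).
      apply: ler_sum => i _; have := HL _ _ (fun i => bc s i sT) (fun i => bd s i sT) i => h.
      apply: le_trans (ler_norm _) _; rewrite normrM.
      apply: le_trans (ler_wpM2l (normr_ge0 _) h) _.
      rewrite mulrCA mulr_sumr mulr_sumr; apply: ler_sum => j _.
      rewrite -mulrA ler_wpM2l// -/(x j s).
      rewrite -(real_normK (num_real (x i s))) -(real_normK (num_real (x j s))).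
      set a := `|x i s|; set b := `|_|; have := sqr_ge0 (a - b); rewrite sqrrB; lra.
    apply: le_trans h1 _.
    rewrite le_eqVlt; apply/orP; left; apply/eqP.
    pose Q := \sum_i x i s ^+ 2.
    have E1 i : \sum_j (L / 2 * (x i s ^+ 2 + x j s ^+ 2)) = L / 2 * (m%:R * x i s ^+ 2 + Q).
      by rewrite -mulr_sumr big_split /= sumr_const card_ord mulr_natl.
    under eq_bigr do rewrite E1.
    rewrite -mulr_sumr big_split /= -mulr_sumr sumr_const card_ord -/Q -[Q *+ m]mulr_natl.
    by field.
  - by rewrite big1// => i _; rewrite /x cd0 subrr mul0r.
move=> t tT i; have := E t tT => /eqP; rewrite psumr_eq0; last first.
  by move=> j _; rewrite -expr2 sqr_ge0.
move=> /allP/(_ i (mem_index_enum i)); rewrite mulf_eq0 orbb subr_eq0 => /eqP //.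
Qed.

End Conservative.
End Picard.

(** * Global existence for conservative fields *)

Section OdeExistence.
Variables (R : realType) (m : nat) (T : \bar R).
Local Notation S := ('I_m -> R).
Variable F : S -> S.
Hypothesis Floc : forall rho : R, exists2 L : R, 0 <= L & forall c d,
  (forall i, `|c i| <= rho) -> (forall i, `|d i| <= rho) ->
  forall i, `|F c i - F d i| <= L * \sum_j `|c j - d j|.
Hypothesis Fskew : forall c, \sum_i c i * F c i = 0.

(* The cutoff is globally Lipschitz, agrees with F on the cube of half-side rho and
   keeps the orthogonality of F c to c, so that its solutions starting well inside
   the cube never leave it: they solve the original equation for all times. *)
Section Cutoff.
Variable rho : R.
Hypothesis rho0 : 0 <= rho.

(** The clamp makes [F] bounded and Lipschitz, but alone it would destroy the orthogonality; the
    factor [chi] is 0 wherever the clamp moves a point, and 1 on the cube of half-side [rho]. *)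
Let clamp (c : S) i : R := Num.max (- (rho + 1)) (Num.min (rho + 1) (c i)).
Let chi (c : S) : R := Num.max 0 (1 - \sum_i Num.max 0 (`|c i| - rho)).
Definition cutoff (c : S) i : R := chi c * F (clamp c) i.

Let clamp_bound c i : `|clamp c i| <= rho + 1.
Proof.
rewrite ler_norml /clamp le_max lexx /= ge_max ge_min lexx /= andbT.
by rewrite -subr_ge0 opprK addr_ge0 ?addr_ge0.
Qed.

Let clamp_lip c d i : `|clamp c i - clamp d i| <= `|c i - d i|.
Proof. by apply: le_trans (max_lip _ _ _) (min_lip _ _ _). Qed.

Let chi_bound c : 0 <= chi c <= 1.
Proof.
rewrite /chi le_max lexx /= ge_max ler01 /= gerBl.
by apply: sumr_ge0 => i _; rewrite le_max lexx.
Qed.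

Let chi_lip c d : `|chi c - chi d| <= \sum_j `|c j - d j|.
Proof.
apply: le_trans (max_lip _ _ _) _.
set A := \sum_i _; set B := \sum_i _.
have -> : 1 - A - (1 - B) = - (A - B) by ring.
rewrite normrN /A /B -sumrB.
apply: le_trans (ler_norm_sum _ _ _) _; apply: ler_sum => j _.
apply: le_trans (max_lip _ _ _) _; rewrite opprB addrA subrK.
exact: ler_dist_dist.
Qed.

Let chi_clamp c : chi c != 0 -> clamp c = c.
Proof.
rewrite /chi => chi0; apply/funext => i; have H : `|c i| <= rho + 1.
  rewrite leNgt; apply: contra chi0 => ci; rewrite max_l// subr_le0.
  rewrite (bigD1 i)//=; apply: ler_wpDr.
    by apply: sumr_ge0 => j _; rewrite le_max lexx.
  by rewrite le_max; apply/orP; right; lra.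
move: H; rewrite ler_norml => /andP[h1 h2].
by rewrite /clamp min_r// max_r.
Qed.

Lemma cutoff_skew c : \sum_i c i * cutoff c i = 0.
Proof.
rewrite /cutoff; have [->|chi0] := eqVneq (chi c) 0.
  by rewrite big1// => i _; rewrite mul0r mulr0.
under eq_bigr do rewrite chi_clamp// mulrCA.
by rewrite -mulr_sumr Fskew mulr0.
Qed.

Lemma cutoff_lip : exists2 L : R, 0 <= L &
  forall c d i, `|cutoff c i - cutoff d i| <= L * \sum_j `|c j - d j|.
Proof.
have [L L0 HL] := Floc (rho + 1).
pose B := \sum_i `|F (fun=> 0) i| + L * (m%:R * (rho + 1)).
have r1 : 0 <= rho + 1 by rewrite addr_ge0.
have B0 : 0 <= B by rewrite addr_ge0 ?sumr_ge0// !mulr_ge0.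
have FB d i : `|F (clamp d) i| <= B.
  rewrite -(subrK (F (fun=> 0) i) (F _ i)) addrC; apply: le_trans (ler_normD _ _) _.
  apply: lerD; first by rewrite (bigD1 i)//= lerDl sumr_ge0.
  apply: le_trans (HL _ _ _ _ _) _ => //; first by move=> j; rewrite normr0.
  apply: ler_wpM2l => //.
  have : \sum_j `|clamp d j - 0| <= \sum_(j < m) (rho + 1).
    by apply: ler_sum => j _; rewrite subr0.
  by rewrite sumr_const card_ord -[X in _ <= X -> _]mulr_natl.
exists (L + B); first by rewrite addr_ge0.
move=> c d i; rewrite /cutoff.
have -> : chi c * F (clamp c) i - chi d * F (clamp d) i =
  chi c * (F (clamp c) i - F (clamp d) i) + (chi c - chi d) * F (clamp d) i by ring.
have /andP[c0 c1] := chi_bound c.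
apply: le_trans (ler_normD _ _) _; rewrite [leRHS]mulrDl; apply: lerD.
  rewrite normrM (ger0_norm c0); apply: le_trans (ler_piMl (normr_ge0 _) c1) _.
  apply: le_trans (HL _ _ (clamp_bound c) (clamp_bound d) i) _.
  by apply: ler_wpM2l => //; apply: ler_sum => j _; exact: clamp_lip.
by rewrite normrM mulrC; apply: ler_pM.
Qed.

Lemma cutoff_id c : (forall i, `|c i| <= rho) -> forall i, cutoff c i = F c i.
Proof.
move=> H i; have chi1 : chi c = 1.
  rewrite /chi big1 ?subr0 ?max_r// => j _.
  by rewrite max_l// subr_le0.
by rewrite /cutoff chi_clamp chi1 ?mul1r ?oner_eq0.
Qed.
End Cutoff.

Theorem ode_exists (c0 : S) : exists c : R -> S, (forall i, c 0 i = c0 i) /\ ode_sol F T c.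
Proof.
(* The bound of [ode_bounded]: [|x| <= 1 + x^2], and the sum of squares is conserved by the cutoff
   field. *)
pose rho := 1 + \sum_i c0 i ^+ 2.
have rho0 : 0 <= rho by rewrite addr_ge0// sumr_ge0// => i _; exact: sqr_ge0.
have [L L0 HL] := cutoff_lip rho0.
pose X := picard_lim (cutoff rho) c0.
have X0 i : X 0 i = c0 i by exact: picard_lim0 HL _ _.
have HX : ode_sol (cutoff rho) T X by move=> i; exact: picard_lim_hasd L0 HL _ _ _.
exists X; split => // i; apply: hasd_eq (HX i) => t tT; apply: cutoff_id => j.
have := ode_bounded (@cutoff_skew rho) j HX tT.
by under eq_bigr do rewrite X0.
Qed.

End OdeExistence.

(** * The Schroedinger form and its energy *)

Section PowerNonlinearity.
Variables (R : realType) (p : R).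
Hypothesis hp : 2 < p.
Implicit Types (z w : R[i]) (x : R).

Definition dot z w : R := Re z * Re w + Im z * Im w.
Definition Npow z : R[i] := (cnorm z `^ (p - 2))%:C * z.

Lemma ReNpow z : Re (Npow z) = cnorm z `^ (p - 2) * Re z.
Proof. by rewrite /Npow ReM /= mul0r subr0. Qed.
Lemma ImNpow z : Im (Npow z) = cnorm z `^ (p - 2) * Im z.
Proof. by rewrite /Npow ImM /= mul0r addr0. Qed.

Lemma dotBr z w w' : dot z (w - w') = dot z w - dot z w'.
Proof. by rewrite /dot !ReImE; ring. Qed.
Lemma dotBl z z' w : dot (z - z') w = dot z w - dot z' w.
Proof. by rewrite /dot !ReImE; ring. Qed.

Lemma dotzz z : dot z z = cnorm z ^+ 2.
Proof. by rewrite cnorm_sqr /dot -!expr2. Qed.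

Lemma dot_le z w : `|dot z w| <= cnorm z * cnorm w.
Proof.
rewrite -ler_sqr ?nnegrE ?mulr_ge0 ?cnorm_ge0// real_normK ?num_real//.
rewrite exprMn !cnorm_sqr /dot -subr_ge0.
rewrite (_ : _ - _ = (Re z * Im w - Im z * Re w) ^+ 2) ?sqr_ge0//; ring.
Qed.

Lemma cnormD z w : cnorm (z + w) <= cnorm z + cnorm w.
Proof.
rewrite -ler_sqr ?nnegrE ?addr_ge0 ?cnorm_ge0// -dotzz.
have -> : dot (z + w) (z + w) = dot z z + dot z w *+ 2 + dot w w.
  by rewrite /dot !ReImE; ring.
rewrite !dotzz sqrrD lerD2r lerD2l lerMn2r /=.
exact: le_trans (ler_norm _) (dot_le _ _).
Qed.

Lemma cnormM z w : cnorm (z * w) = cnorm z * cnorm w.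
Proof.
apply/eqP; rewrite -(@eqrXn2 _ 2) ?mulr_ge0 ?cnorm_ge0// exprMn !cnorm_sqr !ReImE.
by apply/eqP; ring.
Qed.

Lemma cnormr x : cnorm x%:C = `|x|.
Proof. by rewrite /= expr0n addr0 sqrtr_sqr. Qed.

Lemma cnormN z : cnorm (- z) = cnorm z.
Proof.
apply/eqP; rewrite -(@eqrXn2 _ 2) ?cnorm_ge0// !cnorm_sqr !ReImE.
by apply/eqP; ring.
Qed.

Lemma cnormB z w : cnorm (z - w) = cnorm (w - z).
Proof. by rewrite -cnormN opprB. Qed.

Lemma cnorm_eq0 z : cnorm z = 0 -> z = 0.
Proof.
move=> /(congr1 (fun x => x ^+ 2)); rewrite cnorm_sqr expr0n /= => /eqP.
rewrite paddr_eq0 ?sqr_ge0// !sqrf_eq0 => /andP[/eqP a /eqP b].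
exact: complex_eqP.
Qed.

Lemma pow_split (a : R) : 0 <= a -> a `^ (p - 2) * a ^+ 2 = a `^ p.
Proof.
move=> a0; rewrite -powR_mulrn// -powRD ?subrK//.
by apply/implyP => /eqP h; move: hp; rewrite h; lra.
Qed.

Lemma dot_Npow z : dot (Npow z) z = cnorm z `^ p.
Proof.
rewrite /dot ReNpow ImNpow -pow_split ?cnorm_ge0// cnorm_sqr; ring.
Qed.

Let n := (Num.truncn p).+1.

(* Bernoulli's inequality with the integer exponent n >= p - 2 replaces the
   differentiation of the power function. *)
Lemma bernoulli_pow (r : R) : 0 < r -> r <= 1 -> 1 - r `^ (p - 2) <= n%:R * (1 - r).
Proof.
move=> r0 r1.
have h1 : r `^ n%:R <= r `^ (p - 2).
  apply: ger_powR; first by rewrite r0.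
  suff : p < n%:R by lra.
  by rewrite -Num.Theory.truncn_lt_nat//; move: hp; lra.
have h2 (k : nat) : 1 - r ^+ k <= k%:R * (1 - r).
  elim: k => [|k IH]; first by rewrite expr0 subrr mul0r.
  rewrite exprS -natr1 mulrDl mul1r.
  have : r ^+ k <= 1 by apply: exprn_ile1 => //; exact: ltW.
  have : 0 <= r ^+ k by apply: exprn_ge0; exact: ltW.
  nra.
have := h2 n; rewrite -powR_mulrn ?(ltW r0)//; lra.
Qed.

(** Bernoulli's inequality at [r = a / b]. The factor [a] on the left makes the bound true also for
    [p < 3], where the power [p - 2] is not Lipschitz at 0. *)
Lemma powB_le (a b : R) : 0 <= a -> a <= b ->
  (b `^ (p - 2) - a `^ (p - 2)) * a <= n%:R * b `^ (p - 2) * (b - a).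
Proof.
move=> a0 ab; have b0 := le_trans a0 ab.
have [->|an0] := eqVneq a 0; first by rewrite mulr0 !mulr_ge0 ?powR_ge0 ?subr_ge0.
have a1 : 0 < a by rewrite lt_neqAle eq_sym an0.
have b1 : 0 < b by exact: lt_le_trans ab.
pose r := a / b.
have r0 : 0 < r by rewrite divr_gt0.
have r1 : r <= 1 by rewrite ler_pdivrMr// mul1r.
have aE : a = b * r by rewrite /r mulrC divfK// gt_eqF.
have := bernoulli_pow r0 r1 => H.
have -> : a `^ (p - 2) = b `^ (p - 2) * r `^ (p - 2) by rewrite {1}aE powRM// ltW.
set B := b `^ _; have B0 : 0 <= B by exact: powR_ge0.
rewrite -[X in (X - _)]mulr1 -mulrBr.
apply: (@le_trans _ _ (B * (n%:R * (1 - r)) * a)).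
  by rewrite ler_wpM2r// ler_wpM2l.
have E1 : (1 - r) * a <= b - a by rewrite {1}aE [in leRHS]aE; nra.
have : 0 <= B * n%:R by rewrite mulr_ge0.
nra.
Qed.

Definition Nconst : R := n.+1%:R.

Lemma Nconst_ge0 : 0 <= Nconst. Proof. by []. Qed.

(** For [|z| <= |w|] the difference is [|w|^(p-2) (w - z) + (|w|^(p-2) - |z|^(p-2)) z]. The smaller
    number multiplies the difference of powers, as [powB_le] requires; the two terms give the
    constant [n + 1]. *)
Lemma Npow_lip M z w : cnorm z <= M -> cnorm w <= M ->
  cnorm (Npow w - Npow z) <= Nconst * M `^ (p - 2) * cnorm (w - z).
Proof.
wlog zw : z w / cnorm z <= cnorm w.
  move=> H zM wM; have [zw|/ltW wz] := leP (cnorm z) (cnorm w); first exact: H.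
  by rewrite cnormB (cnormB w); exact: H.
move=> zM wM; have z0 := cnorm_ge0 z; have w0 := cnorm_ge0 w.
have M0 := le_trans w0 wM.
set a := cnorm z in zM zw z0 *; set b := cnorm w in wM zw w0 *.
have -> : Npow w - Npow z = (b `^ (p - 2))%:C * (w - z) + (b `^ (p - 2) - a `^ (p - 2))%:C * z.
  by apply: complex_eqP; rewrite !ReImE /= -/a -/b; ring.
apply: le_trans (cnormD _ _) _; rewrite !cnormM !cnormr -/a.
have ab : a `^ (p - 2) <= b `^ (p - 2).
  by apply: ge0_ler_powR; rewrite ?nnegrE//; move: hp; lra.
have bM : b `^ (p - 2) <= M `^ (p - 2).
  by apply: ge0_ler_powR; rewrite ?nnegrE//; move: hp; lra.
rewrite (ger0_norm (powR_ge0 _ _)) ger0_norm ?subr_ge0//.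
have h := powB_le z0 zw.
have bz : b - a <= cnorm (w - z).
  by rewrite lerBlDr; have := cnormD (w - z) z; rewrite subrK.
set D := cnorm (w - z) in bz *.
have D0 : 0 <= D by exact: cnorm_ge0.
have B0 : 0 <= b `^ (p - 2) by exact: powR_ge0.
have : n%:R * b `^ (p - 2) * (b - a) <= n%:R * b `^ (p - 2) * D.
  by rewrite ler_wpM2l// mulr_ge0.
move=> h2.
apply: (@le_trans _ _ (Nconst * b `^ (p - 2) * D)).
  rewrite /Nconst -natr1; lra.
by rewrite ler_wpM2r// ler_wpM2l// Nconst_ge0.
Qed.

(** The tangent inequality of the convex function [|z|^p], whose gradient is [p * Npow p z]. It is
    Young's inequality with exponents [p / (p - 1)] and [p] applied to [|z|^(p-1) |w|]. *)
Lemma pow_convex z w : p * dot (Npow z) (w - z) <= cnorm w `^ p - cnorm z `^ p.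
Proof.
have p2 := hp; have p0 : 0 < p by lra.
rewrite dotBr dot_Npow.
set a := cnorm z; set b := cnorm w.
have a0 : 0 <= a by exact: cnorm_ge0. have b0 : 0 <= b by exact: cnorm_ge0.
have h1 : dot (Npow z) w <= a `^ (p - 1) * b.
  have -> : dot (Npow z) w = a `^ (p - 2) * dot z w.
    by rewrite /dot ReNpow ImNpow -/a; ring.
  have -> : a `^ (p - 1) = a `^ (p - 2) * a.
    rewrite -{3}(powRr1 a0) -powRD; first by congr (_ `^ _); ring.
    by apply/implyP => /eqP ?; exfalso; lra.
  rewrite -mulrA ler_wpM2l ?powR_ge0//.
  exact: le_trans (ler_norm _) (dot_le _ _).
have q0 : 0 < p / (p - 1) by rewrite divr_gt0//; lra.
have pq : (p / (p - 1))^-1 + p^-1 = 1 by field; apply/andP; split; apply/eqP; lra.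
have h2 := conjugate_powR (powR_ge0 a (p - 1)) b0 q0 p0 pq.
move: h2; rewrite -powRrM (_ : (p - 1) * (p / (p - 1)) = p); last by field; apply/eqP; lra.
move=> h2.
have : p * dot (Npow z) w <= p * (a `^ p / (p / (p - 1)) + b `^ p / p).
  by rewrite ler_pM2l//; exact: le_trans h2.
have -> : p * (a `^ p / (p / (p - 1)) + b `^ p / p) = (p - 1) * a `^ p + b `^ p.
  by field; apply/andP; split; apply/eqP; lra.
by lra.
Qed.

(** Convexity at [z] and at [w] encloses the remainder between 0 and [p <N w - N z, w - z>], which
    is quadratic by [Npow_lip]. *)
Lemma pow_quad M z w : cnorm z <= M -> cnorm w <= M ->
  `|cnorm w `^ p - cnorm z `^ p - p * dot (Npow z) (w - z)| <=
  p * (Nconst * M `^ (p - 2)) * cnorm (w - z) ^+ 2.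
Proof.
move=> zM wM; have h1 := pow_convex z w; have h2 := pow_convex w z.
rewrite ger0_norm; last by lra.
have h3 : dot (Npow w - Npow z) (w - z) <= Nconst * M `^ (p - 2) * cnorm (w - z) ^+ 2.
  apply: le_trans (ler_norm _) _; apply: le_trans (dot_le _ _) _.
  by rewrite expr2 mulrA ler_wpM2r ?cnorm_ge0// Npow_lip.
have -> : cnorm w `^ p - cnorm z `^ p - p * dot (Npow z) (w - z) =
   (cnorm w `^ p - cnorm z `^ p + p * dot (Npow w) (z - w))
   + p * dot (Npow w - Npow z) (w - z).
  by rewrite dotBl !dotBr; ring.
have h4 : p * dot (Npow w - Npow z) (w - z) <= p * (Nconst * M `^ (p - 2) * cnorm (w - z) ^+ 2).
  by rewrite ler_pM2l//; move: hp; lra.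
by rewrite -[leRHS]mulrA; lra.
Qed.

Lemma sum_pow_le (m : nat) (x : 'I_m -> R) : (forall k, 0 <= x k) ->
  (\sum_k x k) `^ p <= m%:R `^ p * \sum_k x k `^ p.
Proof.
move=> x0; case: m x x0 => [|m] x x0.
  by rewrite !big_ord0 mulr0 powR0//; apply/eqP; move: hp; lra.
have [k0 _ Hk] := @arg_maxP _ _ 'I_m.+1 ord0 predT x erefl.
have h1 : \sum_k x k <= m.+1%:R * x k0.
  have : \sum_k x k <= \sum_(k < m.+1) x k0 by apply: ler_sum => k _; exact: Hk.
  by rewrite sumr_const card_ord mulr_natl.
apply: (@le_trans _ _ ((m.+1%:R * x k0) `^ p)).
  apply: ge0_ler_powR; rewrite ?nnegrE ?mulr_ge0 ?sumr_ge0//; move: hp; lra.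
rewrite powRM// ler_wpM2l ?powR_ge0// (bigD1 k0)//= lerDl.
by apply: sumr_ge0 => k _; exact: powR_ge0.
Qed.

End PowerNonlinearity.

(** * The weak form of the Schroedinger operator *)

Section SchroedingerForm.
Variables (R : realType) (N : nat) (p : R) (q : 'rV[R]_N -> R).
Hypotheses (hp : 2 < p) (mq : measurable_fun setT (fun t : N.-tuple (measurableTypeR R) => q (pt t)))
  (qb : exists M : R, forall x, `|q x| <= M).
Local Notation mR := (measurableTypeR R).
Local Notation E := 'rV[R]_N.
Local Notation F := (E -> R[i]).
Local Notation leb := (lebesgueN R N).
Local Notation T := (N.-tuple mR).
Local Notation V := (Vspace p).
Implicit Types (f g u v : F) (z : R[i]).

Let p0 : 0 < p. Proof. by move: hp; lra. Qed.

Lemma V_H2 u : V u -> H2 u. Proof. by move=> [/Hk_H2]. Qed.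
Lemma V_L2c u : V u -> L2c u. Proof. by move=> /V_H2[]. Qed.
Lemma V_pow_itg u : V u -> itg leb (fun t => cnorm (u (pt t)) `^ p).
Proof. by move=> [_ /(LpP _ p0)[]]. Qed.

Definition dotF f g (t : T) := dot (f (pt t)) (g (pt t)).

Lemma measurable_dotF f g : cmeas f -> cmeas g -> measurable_fun setT (dotF f g).
Proof. by move=> [? ?] [? ?]; apply: measurable_funD; exact: measurable_funM. Qed.

Definition NF u : F := fun x => Npow p (u x).

Lemma cmeas_NF u : cmeas u -> cmeas (NF u).
Proof.
move=> mu; have mc : measurable_fun setT (fun t : T => cnorm (u (pt t)) `^ (p - 2)).
  exact: (measurableT_comp (measurable_powR (p - 2)) (measurable_cnorm mu)).
split.
  rewrite (_ : reF _ = fun t => cnorm (u (pt t)) `^ (p - 2) * reF u t).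
    exact: measurable_funM mc mu.1.
  by apply/funext => t; exact: ReNpow.
rewrite (_ : imF _ = fun t => cnorm (u (pt t)) `^ (p - 2) * imF u t).
  exact: measurable_funM mc mu.2.
by apply/funext => t; exact: ImNpow.
Qed.

(** [|z|^(p-1) |z'|] is at most the p-th power of the larger modulus; this yields integrability
    without Hoelder's inequality. *)
Lemma dotN_le z z' : `|dot (Npow p z) z'| <= cnorm z `^ p + cnorm z' `^ p.
Proof.
apply: le_trans (dot_le _ _) _.
have -> : cnorm (Npow p z) = cnorm z `^ (p - 2) * cnorm z.
  by rewrite /Npow cnormM cnormr ger0_norm// powR_ge0.
have a0 := cnorm_ge0 z; have b0 := cnorm_ge0 z'.
set a := cnorm z in a0 *; set b := cnorm z' in b0 *.
have P2 : 0 <= p - 2 by move: hp; lra.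
have [ba|/ltW ab] := leP b a.
  apply: (@le_trans _ _ (a `^ p)); last by rewrite lerDl powR_ge0.
  rewrite -(pow_split hp a0) expr2 -mulrA ler_wpM2l ?powR_ge0// ler_wpM2l//.
apply: (@le_trans _ _ (b `^ p)); last by rewrite lerDr powR_ge0.
rewrite -(pow_split hp b0) expr2 mulrA ler_wpM2r//.
apply: ler_pM => //; first exact: powR_ge0.
by apply: ge0_ler_powR; rewrite ?nnegrE.
Qed.

Lemma dotN_itg u v : V u -> V v -> itg leb (dotF (NF u) v).
Proof.
move=> Vu Vv; apply: (@itg_le _ _ _ _ _ (fun t => cnorm (u (pt t)) `^ p + cnorm (v (pt t)) `^ p)).
- by apply: measurable_dotF; [apply: cmeas_NF|]; exact/L2c_cmeas/V_L2c.
- by move=> t; exact: dotN_le.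
- by apply: itgD; exact: V_pow_itg.
Qed.

Lemma q_itg (f : T -> R) : itg leb f -> itg leb (fun t => q (pt t) * f t).
Proof.
move=> fi; have [M HM] := qb.
apply: (@itg_le _ _ _ _ _ (fun t => M * `|f t|)).
- exact: measurable_funM mq (itg_measurable fi).
- by move=> t; rewrite normrM ler_wpM2r.
- exact/itgZ/itg_norm.
Qed.

Definition qf u v := \int[leb]_t (q (pt t) * dotF u v t).
Definition Nf u v := \int[leb]_t dotF (NF u) v t.
Definition bform u v := 2^-1 * gradp u v + qf u v.
(* Half of the derivative of [energy] at u in the direction v *)
Definition hfun u v := bform u v - Nf u v.

Lemma qf_itg u v : L2c u -> L2c v -> itg leb (fun t => q (pt t) * dotF u v t).
Proof. by move=> Lu Lv; apply: q_itg; exact: rp_itg. Qed.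

Lemma qfC u v : qf u v = qf v u.
Proof. by apply: eq_Rintegral => t _; rewrite /dotF /dot; ring. Qed.

Lemma bformC u v : bform u v = bform v u.
Proof. by rewrite /bform gradpC qfC. Qed.

Definition schroedinger u : F := fun x =>
  - (2^-1 * laplacian u x) + (q x)%:C * u x - (cnorm (u x) `^ (p - 2))%:C * u x.

Let half : (2^-1 : R[i]) = (2^-1)%:C.
Proof. by rewrite fmorphV/= rmorph_nat. Qed.

Lemma rp_schroedinger u v : V u -> V v -> rp (schroedinger u) v = hfun u v.
Proof.
move=> Vu Vv; have H2u := V_H2 Vu; have H2v := V_H2 Vv.
have Lu := V_L2c Vu; have Lv := V_L2c Vv; have LD := laplacian_L2c H2u.
have i1 := rp_itg LD Lv; have i2 := qf_itg Lu Lv; have i3 := dotN_itg Vu Vv.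
rewrite /hfun /bform /Nf /qf.
rewrite -[gradp u v]opprK -(rp_laplacian H2u H2v) mulrN -mulNr /rp -RintegralZl//.
rewrite -RintegralD//; last exact: itgZ.
rewrite -RintegralB//; last by apply: itgD => //; exact: itgZ.
apply: eq_Rintegral => t _; rewrite /schroedinger /dotF /dot /reF /imF /NF /Npow half.
by rewrite !ReImE /=; ring.
Qed.

(** [Re <- i S, v> = Re <S, i v>], and the imaginary part is the same with [i v] for [v]. The
    memberships of [i v] and [i i v] will come from a complex subspace. *)
Lemma nls_opE u v : V u -> V v -> V ('i *: v) -> V ('i *: ('i *: v)) ->
  nls_op q p u v = hfun u ('i *: v) +i* hfun u ('i *: ('i *: v)).
Proof.
move=> Vu Vv Viv Viiv; rewrite /nls_op L2pairE; apply: complex_eqP => /=.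
  rewrite -(rp_schroedinger Vu Viv); apply: eq_Rintegral => t _.
  rewrite reFZ imFZ /reF /imF /schroedinger !ReImE /=.
  by ring.
rewrite -(rp_schroedinger Vu Viiv); apply: eq_Rintegral => t _.
rewrite !(reFZ, imFZ) /reF /imF /schroedinger !ReImE /=.
by ring.
Qed.

(** The infinitesimal form of the invariance under a constant phase: the gradient, potential and
    power terms vanish separately. *)
Lemma hfun_i u : V u -> hfun u ('i *: u) = 0.
Proof.
move=> Vu; rewrite /hfun /bform (gradp_i (V_H2 Vu)) mulr0 add0r.
rewrite /qf /Nf (_ : \int[leb]_t _ = \int[leb]_t (0 : R)); last first.
  apply: eq_Rintegral => t _; rewrite /dotF /dot.
  by rewrite (_ : ('i *: u) (pt t) = 'i * u (pt t))// !ReImE /=; ring.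
rewrite (_ : \int[leb]_t dotF _ _ t = \int[leb]_t (0 : R)) ?subrr//.
apply: eq_Rintegral => t _; rewrite /dotF /dot.
by rewrite (_ : ('i *: u) (pt t) = 'i * u (pt t))// /NF ReNpow ImNpow !ReImE /=; ring.
Qed.

Lemma energyE u : V u ->
  energy q p u = bform u u - 2 / p * \int[leb]_t (cnorm (u (pt t)) `^ p).
Proof.
move=> Vu; have Lu := V_L2c Vu; have [_ Hu _] := V_H2 Vu.
have i2 := qf_itg Lu Lu; have i3 := V_pow_itg Vu.
have iD i := rp_itg (Hu i).1 (Hu i).1.
rewrite /bform /gradp /rp -Rint_sum// -RintegralZl//; last exact: itg_sum.
rewrite -RintegralD//; last by apply: itgZ; exact: itg_sum.
rewrite -RintegralZl// -RintegralB//; last 2 first.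
- by apply: itgD => //; apply: itgZ; exact: itg_sum.
- exact: itgZ.
apply: eq_Rintegral => t _; rewrite /dotF dotzz; congr (_ * _ + _ - _).
by apply: eq_bigr => i _; rewrite cnorm_sqr !expr2.
Qed.

End SchroedingerForm.

(** * A chain rule for functionals with quadratic remainder *)

Section ChainRule.
Variables (R : realType) (m : nat) (T : \bar R).
Local Notation S := ('I_m -> R).
Variables (Phi : S -> R) (G : S -> S) (rho C : R) (c c' : R -> S).
Hypotheses (C0 : 0 <= C)
  (HC : forall a b, (forall k, `|a k| <= rho) -> (forall k, `|b k| <= rho) ->
     `|Phi b - Phi a - \sum_k (b k - a k) * G a k| <= C * (\sum_k `|b k - a k|) ^+ 2)
  (cb : forall t, itv0 T t -> forall k, `|c t k| <= rho)
  (dc : forall k, hasd T (fun t => c t k) (fun t => c' t k)).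

Lemma hasd_finite_family (I : finType) (phi d : I -> R -> R) (t : R) :
  (forall k, hasd T (phi k) (d k)) -> itv0 T t -> forall e : R, 0 < e ->
  exists2 r : R, 0 < r & forall s, itv0 T s -> `|s - t| < r ->
    forall k, `|phi k s - phi k t - (s - t) * d k t| <= e * `|s - t|.
Proof.
move=> H tT e e0.
suff [r r0 Hr] : exists2 r : R, 0 < r & forall k, k \in enum I -> forall s, itv0 T s -> `|s - t| < r ->
    `|phi k s - phi k t - (s - t) * d k t| <= e * `|s - t|.
  by exists r => // s sT st k; apply: Hr => //; rewrite mem_enum.
elim: (enum I) => [|k l [r r0 Hr]]; first by exists 1.
have [r' r0' Hr'] := H k t tT e e0.
exists (Num.min r r'); first by rewrite lt_min r0.
move=> k'; rewrite inE => /orP[/eqP -> | kl] s sT; rewrite lt_min => /andP[h1 h2].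
  exact: Hr'.
exact: Hr.
Qed.

(** The uniform quadratic remainder [HC] on a cube replaces the differentiability of [Phi]; [G]
    plays the part of its gradient. *)
Lemma hasd_chain : hasd T (fun t => Phi (c t)) (fun t => \sum_k c' t k * G (c t) k).
Proof.
move=> t tT e e0.
pose g := \sum_k `|G (c t) k|; pose A := \sum_k (1 + `|c' t k|).
have g0 : 0 <= g by exact: sumr_ge0.
have A0 : 0 <= A by apply: sumr_ge0 => k _; rewrite addr_ge0.
(* The bound 1 gives [|c s - c t| <= A * D] in total, for the quadratic term; [e / (2 * (g + 1))]
   makes the linear error at most half of [e * D]. *)
have e1 : 0 < Num.min 1 (e / (2 * (g + 1))).
  by rewrite lt_min ltr01 divr_gt0// mulr_gt0// ltr_wpDl.
have [r r0 Hr] := hasd_finite_family dc tT e1.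
have CA0 : 0 <= C * A ^+ 2 by rewrite mulr_ge0// exprn_ge0.
exists (Num.min r (e / (2 * (C * A ^+ 2 + 1)))).
  by rewrite lt_min r0 divr_gt0// mulr_gt0// ltr_wpDl.
move=> s sT; rewrite lt_min => /andP[/(Hr s sT) h1 h2].
set D := `|s - t| in h1 h2 *; have D0 : 0 <= D by exact: normr_ge0.
have h3 k : `|c s k - c t k - (s - t) * c' t k| <= 1 * D.
  by apply: le_trans (h1 k) _; rewrite ler_wpM2r// ge_min lexx.
have h4 k : `|c s k - c t k - (s - t) * c' t k| <= e / (2 * (g + 1)) * D.
  by apply: le_trans (h1 k) _; rewrite ler_wpM2r// ge_min lexx orbT.
have hA : \sum_k `|c s k - c t k| <= A * D.
  rewrite /A mulr_suml; apply: ler_sum => k _.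
  rewrite -(subrK ((s - t) * c' t k) (c s k - c t k)).
  apply: le_trans (ler_normD _ _) _; rewrite [leRHS]mulrDl; apply: lerD; first exact: h3.
  by rewrite normrM mulrC.
have hg : `|\sum_k (c s k - c t k - (s - t) * c' t k) * G (c t) k| <= e / 2 * D.
  apply: le_trans (ler_norm_sum _ _ _) _.
  have : \sum_k `|(c s k - c t k - (s - t) * c' t k) * G (c t) k| <=
      \sum_k e / (2 * (g + 1)) * D * `|G (c t) k|.
    by apply: ler_sum => k _; rewrite normrM ler_wpM2r.
  rewrite -mulr_sumr -/g => H; apply: le_trans H _.
  have g1 : e / (2 * (g + 1)) = e / 2 / (g + 1) by rewrite invfM mulrA.
  rewrite mulrAC ler_wpM2r// g1 mulrAC ler_pdivrMr ?ltr_wpDl//.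
  by rewrite ler_wpM2l ?lerDl// divr_ge0// ltW.
have hC : C * (\sum_k `|c s k - c t k|) ^+ 2 <= e / 2 * D.
  have : (\sum_k `|c s k - c t k|) ^+ 2 <= (A * D) ^+ 2.
    by rewrite ler_sqr ?nnegrE ?mulr_ge0 ?sumr_ge0.
  move=> H; apply: le_trans (ler_wpM2l C0 H) _.
  rewrite exprMn mulrA [D ^+ 2]expr2 mulrA ler_wpM2r//.
  move: h2; rewrite ltr_pdivlMr ?mulr_gt0 ?ltr_wpDl//; nra.
have -> : Phi (c s) - Phi (c t) - (s - t) * (\sum_k c' t k * G (c t) k) =
   (Phi (c s) - Phi (c t) - \sum_k (c s k - c t k) * G (c t) k) +
   \sum_k (c s k - c t k - (s - t) * c' t k) * G (c t) k.
  have -> : \sum_k (c s k - c t k - (s - t) * c' t k) * G (c t) k =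
     \sum_k (c s k - c t k) * G (c t) k - (s - t) * \sum_k c' t k * G (c t) k.
    by rewrite mulr_sumr -sumrB; apply: eq_bigr => k _; ring.
  by ring.
apply: le_trans (ler_normD _ _) _; rewrite (splitr (e * D)) [e * D / 2]mulrAC.
apply: lerD => //; apply: le_trans hC; apply: HC; exact: cb.
Qed.
End ChainRule.

(** * Form and energy on the real span of finitely many functions *)

Section Galerkin.
Variables (R : realType) (N : nat) (p : R) (q : 'rV[R]_N -> R).
Hypotheses (hp : 2 < p) (mq : measurable_fun setT (fun t : N.-tuple (measurableTypeR R) => q (pt t)))
  (qb : exists M : R, forall x, `|q x| <= M).
Local Notation E := 'rV[R]_N.
Local Notation F := (E -> R[i]).
Local Notation leb := (lebesgueN R N).
Local Notation V := (Vspace p).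
Variables (m : nat) (w : 'I_m -> F).
Local Notation S := ('I_m -> R).
Implicit Types (f g u v : F) (z : R[i]) (c d : S).

(** Real coefficients only: a complex subspace is handled as a real vector space, with a basis
    orthonormal for [rp]. *)
Definition uc c : F := \sum_k (c k)%:C *: w k.

Lemma ucE c x : uc c x = \sum_k (c k)%:C * w k x.
Proof.
rewrite /uc; elim: (index_enum _) => [|a l IH]; first by rewrite !big_nil.
by rewrite !big_cons -IH.
Qed.

Lemma Re_uc c x : Re (uc c x) = \sum_k c k * Re (w k x).
Proof. by rewrite ucE Re_sum; apply: eq_bigr => k _; rewrite ReM /= mul0r subr0. Qed.
Lemma Im_uc c x : Im (uc c x) = \sum_k c k * Im (w k x).
Proof. by rewrite ucE Im_sum; apply: eq_bigr => k _; rewrite ImM /= mul0r addr0. Qed.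

Lemma ucB c d : uc d - uc c = uc (fun k => d k - c k).
Proof.
apply/funext => x; apply: complex_eqP.
  rewrite ReD ReN !Re_uc -sumrB; apply: eq_bigr => k _; ring.
rewrite ImD ImN !Im_uc -sumrB; apply: eq_bigr => k _; ring.
Qed.

Lemma ucZ (a : R) c : uc (fun k => a * c k) = a%:C *: uc c.
Proof.
apply/funext => x; apply: complex_eqP.
  rewrite (_ : (a%:C *: uc c) x = a%:C * uc c x)// ReM /= mul0r subr0 !Re_uc mulr_sumr.
  by apply: eq_bigr => k _; ring.
rewrite (_ : (a%:C *: uc c) x = a%:C * uc c x)// ImM /= mul0r addr0 !Im_uc mulr_sumr.
by apply: eq_bigr => k _; ring.
Qed.

Lemma dot_ucl c x z : dot (uc c x) z = \sum_k c k * dot (w k x) z.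
Proof.
rewrite /dot Re_uc Im_uc !mulr_suml -big_split /=; apply: eq_bigr => k _; ring.
Qed.

Lemma dotC z z' : dot z z' = dot z' z.
Proof. by rewrite /dot; ring. Qed.

Lemma dot_ucr c x z : dot z (uc c x) = \sum_k c k * dot z (w k x).
Proof. by rewrite dotC dot_ucl; apply: eq_bigr => k _; rewrite dotC. Qed.

(** A common majorant: it bounds every element of the span up to the sum of its coordinates, and
    [Sfun ^ p] is integrable. *)
Definition Sfun (x : E) : R := \sum_k cnorm (w k x).

Lemma Sfun_ge0 x : 0 <= Sfun x.
Proof. by apply: sumr_ge0 => k _; exact: cnorm_ge0. Qed.

Lemma uc_le c x : cnorm (uc c x) <= (\sum_k `|c k|) * Sfun x.
Proof.
rewrite ucE mulr_suml.
apply: (@le_trans _ _ (\sum_k cnorm ((c k)%:C * w k x))).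
  elim: (index_enum _) => [|a l IH]; first by rewrite !big_nil /= expr0n addr0 sqrtr0.
  by rewrite !big_cons; apply: le_trans (cnormD _ _) _; exact: lerD.
apply: ler_sum => k _; rewrite cnormM cnormr ler_wpM2l//.
rewrite /Sfun (bigD1 k)//= lerDl; apply: sumr_ge0 => j _; exact: cnorm_ge0.
Qed.

Lemma uc_le_bound c (rho : R) x : 0 <= rho -> (forall k, `|c k| <= rho) ->
  cnorm (uc c x) <= m%:R * rho * Sfun x.
Proof.
move=> r0 cr; apply: le_trans (uc_le _ _) _; rewrite ler_wpM2r ?Sfun_ge0//.
have : \sum_k `|c k| <= \sum_(k < m) rho by apply: ler_sum => k _.
by rewrite sumr_const card_ord mulr_natl.
Qed.

Hypothesis wV : forall k, V (w k).
Hypothesis ucV : forall c, V (uc c).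

Let p0 : 0 < p. Proof. by move: hp; lra. Qed.

Lemma Sp_itg : itg leb (fun t => Sfun (pt t) `^ p).
Proof.
apply: (@itg_le _ _ _ _ _ (fun t => m%:R `^ p * \sum_k cnorm (w k (pt t)) `^ p)).
- apply: (measurableT_comp (measurable_powR p)).
  rewrite /Sfun; apply: measurable_sum => k.
  by apply: measurable_cnorm; exact: L2c_cmeas (V_L2c (wV k)).
- move=> t; rewrite ger0_norm ?powR_ge0//.
  by apply: sum_pow_le => // k; exact: cnorm_ge0.
- by apply: itgZ; apply: itg_sum => k; apply: V_pow_itg.
Qed.

Definition Sp := \int[leb]_t (Sfun (pt t) `^ p).

Lemma Sp_ge0 : 0 <= Sp.
Proof. by apply: Rintegral_ge0 => t _; exact: powR_ge0. Qed.

Lemma rp_ucl c v : L2c v -> rp (uc c) v = \sum_k c k * rp (w k) v.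
Proof.
move=> Lv; have Lw k := V_L2c (wV k); have Lz k : L2c ((c k)%:C *: w k) by exact: (L2cZ _ (Lw k)).
rewrite /uc (rp_suml _ Lz Lv).
by apply: eq_bigr => k _; rewrite (rpZl _ (Lw k) Lv).
Qed.

Lemma bform_ucl c v : V v -> bform q (uc c) v = \sum_k c k * bform q (w k) v.
Proof.
move=> Vv; rewrite /bform /uc gradp_suml; [|by move=> k; exact: V_H2 (wV k)|exact: V_H2 Vv].
rewrite -/(uc c) (_ : qf q (uc c) v = \sum_k c k * qf q (w k) v).
  rewrite mulr_sumr -big_split /=; apply: eq_bigr => k _; ring.
have iq k : itg leb (fun t => q (pt t) * dotF (w k) v t).
  exact (qf_itg mq qb (V_L2c (wV k)) (V_L2c Vv)).
transitivity (\sum_k \int[leb]_t (c k * (q (pt t) * dotF (w k) v t))); last first.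
  by apply: eq_bigr => k _; exact: (RintegralZl _ measurableT (iq k)).
rewrite -Rint_sum; last by move=> k; exact: itgZ.
apply: eq_Rintegral => t _; rewrite /dotF dot_ucl mulr_sumr.
by apply: eq_bigr => k _; ring.
Qed.

Lemma bform_ucr c v : V v -> bform q v (uc c) = \sum_k c k * bform q v (w k).
Proof.
by move=> Vv; rewrite bformC bform_ucl//; apply: eq_bigr => k _; rewrite bformC.
Qed.

Lemma Nf_ucr u d : V u -> Nf p u (uc d) = \sum_k d k * Nf p u (w k).
Proof.
move=> Vu; have iN k : itg leb (dotF (NF p u) (w k)) by exact: dotN_itg.
transitivity (\sum_k \int[leb]_t (d k * dotF (NF p u) (w k) t)); last first.
  by apply: eq_bigr => k _; exact: (RintegralZl _ measurableT (iN k)).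
rewrite -Rint_sum; last by move=> k; exact: itgZ.
by apply: eq_Rintegral => t _; rewrite /dotF dot_ucr.
Qed.

Lemma hfun_ucr u d : V u -> hfun p q u (uc d) = \sum_k d k * hfun p q u (w k).
Proof.
move=> Vu; rewrite /hfun bform_ucr// Nf_ucr// -sumrB; apply: eq_bigr => k _; ring.
Qed.

Lemma bform_uc_norm c : `|bform q (uc c) (uc c)| <=
  (\sum_k \sum_l `|bform q (w k) (w l)|) * (\sum_k `|c k|) ^+ 2.
Proof.
rewrite bform_ucl//; under eq_bigr do rewrite bform_ucr// mulr_sumr.
rewrite mulr_suml; apply: le_trans (ler_norm_sum _ _ _) _; apply: ler_sum => k _.
rewrite mulr_suml; apply: le_trans (ler_norm_sum _ _ _) _; apply: ler_sum => l _.
rewrite !normrM mulrA mulrC ler_wpM2l//.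
have ck j : `|c j| <= \sum_k `|c k| by rewrite (bigD1 j)//= lerDl sumr_ge0.
by rewrite expr2; apply: ler_pM.
Qed.

(** With [S = Sfun] and [D] the distance of the coordinates, the integrand is at most a constant
    times [(K S)^(p-2) * (D S) * S]. The last factor is the bound on [v], and the powers of [S] add
    up to [p]. *)
Lemma Nf_lip (rho : R) c d v : 0 <= rho -> (forall k, `|c k| <= rho) -> (forall k, `|d k| <= rho) ->
  V v -> (forall x, cnorm (v x) <= Sfun x) ->
  `|Nf p (uc c) v - Nf p (uc d) v| <=
  Nconst p * (m%:R * rho) `^ (p - 2) * Sp * \sum_k `|c k - d k|.
Proof.
move=> r0 cr dr Vv vS.
have ic := dotN_itg hp (ucV c) Vv; have id := dotN_itg hp (ucV d) Vv.
rewrite /Nf -(RintegralB measurableT ic id).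
set D := \sum_k _; set K := m%:R * rho.
have K0 : 0 <= K by rewrite mulr_ge0.
have -> : Nconst p * K `^ (p - 2) * Sp * D =
    \int[leb]_t ((Nconst p * K `^ (p - 2) * D) * Sfun (pt t) `^ p).
  by rewrite RintegralZl//; [rewrite -/Sp; ring|exact: Sp_itg].
apply: Rint_bound; [exact: itgB|exact/itgZ/Sp_itg|].
move=> t; rewrite /dotF -dotBl; apply: le_trans (dot_le _ _) _.
set x := pt t.
have h1 : cnorm (uc c x - uc d x) <= D * Sfun x.
  rewrite (_ : uc c x - uc d x = uc (fun k => c k - d k) x); last by rewrite -ucB.
  exact: uc_le.
have h2 := Npow_lip hp (uc_le_bound x r0 dr) (uc_le_bound x r0 cr).
have s0 := Sfun_ge0 x.
have -> : Nconst p * K `^ (p - 2) * D * Sfun x `^ p =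
    Nconst p * (K * Sfun x) `^ (p - 2) * (D * Sfun x) * Sfun x.
  by rewrite powRM// -(pow_split hp s0); ring.
apply: ler_pM; [exact: cnorm_ge0|exact: cnorm_ge0| |exact: vS].
apply: le_trans h2 _; apply: ler_wpM2l => //.
by rewrite mulr_ge0// powR_ge0.
Qed.

Lemma pow_uc_quad (rho : R) c d : 0 <= rho -> (forall k, `|c k| <= rho) -> (forall k, `|d k| <= rho) ->
  `|\int[leb]_t (cnorm (uc d (pt t)) `^ p) - \int[leb]_t (cnorm (uc c (pt t)) `^ p) -
    p * Nf p (uc c) (uc (fun k => d k - c k))| <=
  p * (Nconst p * (m%:R * rho) `^ (p - 2)) * Sp * (\sum_k `|d k - c k|) ^+ 2.
Proof.
move=> r0 cr dr; have id := V_pow_itg hp (ucV d); have ic := V_pow_itg hp (ucV c).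
have iN := dotN_itg hp (ucV c) (ucV (fun k => d k - c k)).
rewrite /Nf -RintegralZl// -RintegralB// -RintegralB//; [|exact: itgB|exact: itgZ].
set D := \sum_k _; set K := m%:R * rho.
have K0 : 0 <= K by rewrite mulr_ge0.
have -> : p * (Nconst p * K `^ (p - 2)) * Sp * D ^+ 2 =
    \int[leb]_t ((p * (Nconst p * K `^ (p - 2)) * D ^+ 2) * Sfun (pt t) `^ p).
  by rewrite RintegralZl//; [rewrite -/Sp; ring|exact: Sp_itg].
apply: Rint_bound; [by apply: itgB; [exact: itgB|exact: itgZ]|exact/itgZ/Sp_itg|].
move=> t; rewrite /dotF; set x := pt t; have s0 := Sfun_ge0 x.
rewrite -(ucB c d) (_ : (uc d - uc c) x = uc d x - uc c x)//.
apply: le_trans (pow_quad hp (uc_le_bound x r0 cr) (uc_le_bound x r0 dr)) _.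
have h1 : cnorm (uc d x - uc c x) <= D * Sfun x.
  rewrite (_ : uc d x - uc c x = uc (fun k => d k - c k) x); last by rewrite -ucB.
  exact: uc_le.
have -> : p * (Nconst p * K `^ (p - 2)) * D ^+ 2 * Sfun x `^ p =
    p * (Nconst p * (K * Sfun x) `^ (p - 2)) * (D * Sfun x) ^+ 2.
  by rewrite powRM// -(pow_split hp s0); ring.
apply: ler_wpM2l; first by rewrite mulr_ge0 ?mulr_ge0 ?powR_ge0//; exact: ltW.
have D0 : 0 <= D by exact: sumr_ge0.
by rewrite ler_sqr ?nnegrE ?cnorm_ge0 ?mulr_ge0.
Qed.

(** The bilinear part expands exactly, with remainder the form at the difference, bounded through
    [C1]; the power term contributes [C2] by [pow_uc_quad]. *)
Lemma energy_quad (rho : R) : 0 <= rho -> exists2 C : R, 0 <= C & forall c d,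
  (forall k, `|c k| <= rho) -> (forall k, `|d k| <= rho) ->
  `|energy q p (uc d) - energy q p (uc c) - \sum_k (d k - c k) * (2 * hfun p q (uc c) (w k))|
  <= C * (\sum_k `|d k - c k|) ^+ 2.
Proof.
move=> r0; pose C1 := \sum_k \sum_l `|bform q (w k) (w l)|.
pose C2 := p * (Nconst p * (m%:R * rho) `^ (p - 2)) * Sp.
have C10 : 0 <= C1 by apply: sumr_ge0 => k _; exact: sumr_ge0.
have C20 : 0 <= C2 by rewrite !mulr_ge0 ?powR_ge0 ?Sp_ge0//; exact: ltW.
exists (C1 + 2 / p * C2); first by rewrite addr_ge0// mulr_ge0// divr_ge0// ltW.
move=> c d cr dr; pose e k := d k - c k.
rewrite !(energyE hp)//.
have -> : \sum_k (d k - c k) * (2 * hfun p q (uc c) (w k)) = 2 * hfun p q (uc c) (uc e).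
  by rewrite hfun_ucr// mulr_sumr; apply: eq_bigr => k _; rewrite /e; ring.
have bd : bform q (uc d) (uc d) = bform q (uc c) (uc c) + 2 * bform q (uc c) (uc e) + bform q (uc e) (uc e).
  have dE k : d k = c k + e k by rewrite /e addrC subrK.
  have split1 v : V v -> bform q (uc d) v = bform q (uc c) v + bform q (uc e) v.
    move=> Vv; rewrite !bform_ucl// -big_split /=; apply: eq_bigr => k _.
    by rewrite dE mulrDl.
  by rewrite split1// (bformC _ (uc c)) (bformC _ (uc e)) !split1// (bformC _ (uc e) (uc c)); ring.
have H := pow_uc_quad r0 cr dr; have Hb := bform_uc_norm e.
rewrite -/C1 in Hb; rewrite -/e -/C2 in H.
set P1 := \int[leb]_t _ in H *; set P2 := \int[leb]_t _ in H *.
set D := \sum_k `|_| in H Hb *.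
have -> : bform q (uc d) (uc d) - 2 / p * P1 - (bform q (uc c) (uc c) - 2 / p * P2) -
    2 * hfun p q (uc c) (uc e) =
    bform q (uc e) (uc e) - 2 / p * (P1 - P2 - p * Nf p (uc c) (uc e)).
  by rewrite bd /hfun; field; rewrite gt_eqF.
apply: le_trans (ler_normB _ _) _; rewrite [leRHS]mulrDl; apply: lerD => //.
rewrite normrM ger0_norm; last by rewrite divr_ge0// ltW.
by rewrite -[leRHS]mulrA; apply: ler_wpM2l => //; rewrite divr_ge0// ltW.
Qed.

End Galerkin.

(** * Galerkin solutions in a finite dimensional subspace *)

Section RealBasis.
Variables (R : realType) (N : nat).
Local Notation E := 'rV[R]_N.
Local Notation F := (E -> R[i]).
Local Notation leb := (lebesgueN R N).
Implicit Types (f g u v : F).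

(** If [g x] were nonzero, a box around [x] of positive measure would lie in the exceptional null
    set. *)
Lemma continuous_ae0 (g : E -> R) : continuous g ->
  {ae leb, forall t, g (pt t) = 0} -> forall x, g x = 0.
Proof.
move=> cg [A [mA A0 gA]] x; apply/eqP/negPn/negP => gx.
have : \forall y \near x, g y != 0.
  have := cg x => /cvgr_dist_lt/(_ `|g x|); rewrite normr_gt0 => /(_ gx).
  apply: filterS => y; apply: contraTneq => ->.
  by rewrite subr0 ltxx.
move=> /nbhs_ballP[d /= d0 Hd].
pose a i : R := x ord0 i - d; pose b i : R := x ord0 i + d.
have sub : box a b `<=` A.
  move=> t tb; apply: gA => /= gt0.
  have := Hd (pt t); rewrite gt0 eqxx => H.
  suff : false by []. apply: H; split => // i j; rewrite (ord1 i) /pt mxE.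
  by have := tb j; rewrite /a /b /ball /= ltr_distlC.
have : (lebesgueN R N (box a b) <= lebesgueN R N A)%E.
  by apply: le_measure => //; rewrite inE//; exact: measurable_box.
have -> : lebesgueN R N A = 0%E := A0.
rewrite lebesgueN_box lee_fin leNgt => /negP; apply.
apply: prodr_gt0 => i _; rewrite lt_max /a /b; apply/orP; right; move: d0; lra.
Qed.

(** Continuity turns equality almost everywhere into equality, so that [rp] is an inner product on
    functions. *)
Lemma rp_definite f : L2c f -> ccontinuous f -> rp f f = 0 -> f = 0.
Proof.
move=> Lf [cr ci] f0.
have i0 := rp_itg Lf Lf.
have ge t : 0 <= reF f t * reF f t + imF f t * imF f t by rewrite -!expr2 addr_ge0 ?sqr_ge0.
have ae : {ae leb, forall t, reF f t * reF f t + imF f t * imF f t = 0}.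
  apply: Rint_norm0 => //; rewrite -[RHS]f0 /rp; apply: eq_Rintegral => t _.
  by rewrite ger0_norm.
have sq2 (x y : R) : x * x + y * y = 0 -> x = 0 /\ y = 0.
  move=> /eqP; rewrite -!expr2 paddr_eq0 ?sqr_ge0// !sqrf_eq0 => /andP[/eqP-> /eqP->].
  by [].
apply/funext => x; apply: complex_eqP.
  apply: (continuous_ae0 cr); move: ae; apply: filterS => t H.
  exact: (sq2 _ _ H).1.
apply: (continuous_ae0 ci); move: ae; apply: filterS => t H.
exact: (sq2 _ _ H).2.
Qed.

Definition orthonormal m (w : 'I_m -> F) := forall j k, rp (w j) (w k) = (j == k)%:R.

Lemma uc_eval m (w : 'I_m -> F) c k : (forall j, L2c (w j)) -> orthonormal w ->
  rp (uc w c) (w k) = c k.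
Proof.
move=> Lw ow.
have Lz j : L2c ((c j)%:C *: w j) by exact: (L2cZ _ (Lw j)).
rewrite /uc (rp_suml _ Lz (Lw k)) (bigD1 k)//= (rpZl _ (Lw k) (Lw k)) ow eqxx mulr1.
rewrite big1 ?addr0// => j jk; rewrite (rpZl _ (Lw j) (Lw k)) ow (negbTE jk) mulr0//.
Qed.

Lemma ucD m (w : 'I_m -> F) c d : uc w c + uc w d = uc w (fun k => c k + d k).
Proof.
by rewrite /uc -big_split /=; apply: eq_bigr => k _; rewrite rmorphD scalerDl.
Qed.

(** The family [b] may be dependent: if the component [g] of [b ord0] orthogonal to the span built
    so far has norm 0, it is 0 by [rp_definite] and no vector is added; otherwise it is
    normalized. *)
Lemma gram_schmidt (P : set F) : (forall f, P f -> L2c f /\ ccontinuous f) -> P 0 ->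
  (forall f g (a : R), P f -> P g -> P (f + a%:C *: g)) ->
  forall n (b : 'I_n -> F), (forall k, P (b k)) ->
  exists m (w : 'I_m -> F), [/\ forall k, P (w k), orthonormal w &
    forall a, exists c, uc b a = uc w c].
Proof.
move=> PL P0 Plin.
have Puc n (b : 'I_n -> F) a : (forall k, P (b k)) -> P (uc b a).
  move=> Pb; rewrite /uc; elim: (index_enum _) => [|k l IH]; first by rewrite big_nil.
  by rewrite big_cons addrC; exact: Plin.
elim=> [|n IH] b Pb.
  exists 0%N, b; split => //; first by move=> [].
  by move=> a; exists a.
have [m [w [Pw ow bw]]] := IH (fun k => b (lift ord0 k)) (fun k => Pb _).
have Lw k : L2c (w k) by have [] := PL _ (Pw k).
pose f := b ord0; pose g := f + (-1)%:C *: uc w (fun k => rp f (w k)).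
have Pf : P f by exact: Pb.
have Pg : P g by apply: Plin => //; exact: Puc.
have [Lf _] := PL _ Pf; have [Lg cg] := PL _ Pg.
have Luc c : L2c (uc w c) by have [] := PL _ (Puc _ _ c Pw).
have fE : f = g + uc w (fun k => rp f (w k)).
  by rewrite /g rmorphN1 scaleN1r subrK.
have ucbE a : uc b a = (a ord0)%:C *: f + uc (fun k => b (lift ord0 k)) (fun k => a (lift ord0 k)).
  by rewrite /uc big_ord_recl.
have gw k : rp g (w k) = 0.
  rewrite /g (rpDl Lf (L2cZ _ (Luc _)) (Lw k)) (rpZl _ (Luc _) (Lw k)) uc_eval//.
  by rewrite mulN1r subrr.
have [g0|gn0] := eqVneq (rp g g) 0.
  exists m, w; split => // a; have [c cE] := bw (fun k => a (lift ord0 k)).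
  exists (fun k => a ord0 * rp f (w k) + c k).
  have fE0 : f = uc w (fun k => rp f (w k)) by rewrite {1}fE (rp_definite Lg cg g0) add0r.
  by rewrite ucbE cE {1}fE0 -ucZ ucD.
have g1 : 0 < rp g g by rewrite lt_def gn0 rp_ge0.
pose r : R := Num.sqrt (rp g g); have r0 : 0 < r by rewrite sqrtr_gt0.
pose h := (r^-1)%:C *: g.
have Lh : L2c h by exact: (L2cZ _ Lg).
pose w' (k : 'I_m.+1) := oapp w h (unlift ord0 k).
have w'0 : w' ord0 = h by rewrite /w' unlift_none.
have w'S k : w' (lift ord0 k) = w k by rewrite /w' liftK.
have ucw' c : uc w' c = (c ord0)%:C *: h + uc w (fun k => c (lift ord0 k)).
  by rewrite /uc big_ord_recl w'0; congr (_ + _); apply: eq_bigr => k _; rewrite w'S.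
exists m.+1, w'; split.
- move=> k; rewrite /w'; case: unliftP => [j _|_] /=; first exact: Pw.
  by rewrite /h -[_ *: _]add0r; exact: Plin.
- move=> j k.
  case: (unliftP ord0 j) => [j' ->|->]; case: (unliftP ord0 k) => [k' ->|->].
  + by rewrite !w'S ow (inj_eq lift_inj).
  + by rewrite w'S w'0 rpC (rpZl _ Lg (Lw _)) gw mulr0 -(inj_eq val_inj).
  + by rewrite w'S w'0 (rpZl _ Lg (Lw _)) gw mulr0 -(inj_eq val_inj).
  + rewrite w'0 eqxx (rpZl _ Lg Lh) (rpZr _ Lg Lg) mulrA -[rp g g]sqr_sqrtr ?rp_ge0// -/r.
    by rewrite expr2 -invfM mulVf// mulf_neq0 ?gt_eqF.
- move=> a; have [c cE] := bw (fun k => a (lift ord0 k)).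
  pose d k := oapp (fun k' => a ord0 * rp f (w k') + c k') (a ord0 * r) (unlift ord0 k).
  exists d; rewrite ucbE cE ucw' {1}/d unlift_none /=.
  rewrite (_ : (fun k => d (lift ord0 k)) = fun k' => a ord0 * rp f (w k') + c k'); last first.
    by apply/funext => k; rewrite /d liftK.
  rewrite -ucD ucZ addrA; congr (_ + _).
  rewrite {1}fE scalerDr; congr (_ + _).
  by rewrite /h scalerA -rmorphM /= mulfK// gt_eqF.
Qed.

Lemma findim_comb (W : set F) : findim_subspace W ->
  forall f g (z : R[i]), W f -> W g -> W (f + z *: g).
Proof.
move=> [n [b ->]] f g z /= [c ->] [d ->].
exists (fun i => c i + z * d i); rewrite scaler_sumr -big_split /=.
by apply: eq_bigr => i _; rewrite scalerDl scalerA.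
Qed.

Lemma findim0 (W : set F) : findim_subspace W -> W 0.
Proof. by move=> [n [b ->]] /=; exists (fun=> 0); rewrite big1// => i _; rewrite scale0r. Qed.

Lemma findim_scale (W : set F) f (z : R[i]) : findim_subspace W -> W f -> W (z *: f).
Proof. by move=> fW Wf; rewrite -[_ *: _]add0r; apply: findim_comb => //; exact: findim0. Qed.

Lemma complexRI (z : R[i]) : z = (Re z)%:C + (Im z)%:C * 'i.
Proof. by apply: complex_eqP; rewrite !ReImE /=; ring. Qed.

(** Over the reals the complex span of the [b k] is spanned by the [b k] together with the
    ['i *: b k]; this doubled family is orthonormalized for [rp]. *)
Lemma findim_basis (W : set F) : findim_subspace W ->
  (forall f, W f -> L2c f /\ ccontinuous f) ->
  exists m (w : 'I_m -> F), [/\ orthonormal w, forall c, W (uc w c) &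
    forall v, W v -> v = uc w (fun k => rp v (w k))].
Proof.
move=> fW WL; have [n [b WE]] := fW.
have W0 := findim0 fW; have Wlin := findim_comb fW.
pose b' (k : 'I_(n + n)) : F := match fintype.split k with inl j => b j | inr j => 'i *: b j end.
have Wb k : W (b k).
  rewrite WE; exists (fun i => (i == k)%:R).
  rewrite (bigD1 k)//= eqxx scale1r big1 ?addr0// => i /negbTE ->; exact: scale0r.
have Wb' k : W (b' k).
  by rewrite /b'; case: fintype.split => j //; exact: findim_scale.
have [m [w [Ww ow bw]]] := gram_schmidt WL W0 (fun f g a => Wlin f g a%:C) Wb'.
exists m, w; split => //.
  move=> c; rewrite /uc; elim: (index_enum _) => [|k l IH]; first by rewrite big_nil.
  by rewrite big_cons addrC; exact: Wlin.
move=> v Wv; have : exists c, v = uc w c.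
  move: Wv; rewrite {1}WE => -[c ->].
  have [d dE] := bw (fun k => match fintype.split k with inl j => Re (c j) | inr j => Im (c j) end).
  exists d; rewrite -dE /uc big_split_ord /= -big_split /=; apply: eq_bigr => k _.
  rewrite /b' -/(lshift n k) -/(rshift n k).
  rewrite (unsplitK (inl k : 'I_n + 'I_n)) (unsplitK (inr k : 'I_n + 'I_n)).
  by rewrite scalerA -scalerDl -complexRI.
move=> [c ->]; congr (uc w _); apply/funext => k; rewrite uc_eval// => j.
by have [] := WL _ (Ww j).
Qed.

End RealBasis.

(** * The norms of V in coordinates *)

Section VnormBounds.
Variables (R : realType) (N : nat).
Local Notation E := 'rV[R]_N.
Local Notation F := (E -> R[i]).
Implicit Types (f g u v : F).

Lemma Lp_norm_ge0 (p : R) f : 0 <= Lp_norm p f.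
Proof. by rewrite /Lp_norm fine_ge0// Lnorm_ge0. Qed.

Lemma rp_uc_le m (g : 'I_m -> F) c : (forall k, L2c (g k)) ->
  rp (uc g c) (uc g c) <= (\sum_k \sum_l `|rp (g k) (g l)|) * (\sum_k `|c k|) ^+ 2.
Proof.
move=> Lg; have Lz k : L2c ((c k)%:C *: g k) by exact: (L2cZ _ (Lg k)).
have Lu : L2c (uc g c) by exact: L2c_sum.
rewrite {1}/uc (rp_suml _ Lz Lu) mulr_suml; apply: ler_sum => k _.
rewrite rpC /uc (rp_suml _ Lz (Lz k)) mulr_suml; apply: ler_sum => l _.
rewrite (rpZl _ (Lg l) (Lz k)) (rpZr _ (Lg l) (Lg k)).
apply: le_trans (ler_norm _) _; rewrite !normrM rpC mulrA mulrC ler_wpM2l//.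
have ck j : `|c j| <= \sum_k `|c k| by rewrite (bigD1 j)//= lerDl sumr_ge0.
by rewrite expr2; apply: ler_pM.
Qed.

Lemma Lp_norm_uc_le m (g : 'I_m -> F) f c : (forall k, L2c (g k)) -> L2c f ->
  aeF f (uc g c) ->
  Lp_norm 2 f ^+ 2 <= (\sum_k \sum_l `|rp (g k) (g l)|) * (\sum_k `|c k|) ^+ 2.
Proof.
move=> Lg Lf fg; rewrite (Lp_norm2_sqr Lf).
have Lu : L2c (uc g c) by apply: L2c_sum => k; exact: (L2cZ _ (Lg k)).
by rewrite (rp_ae Lf Lu Lf Lu fg fg); exact: rp_uc_le.
Qed.

(** [K] sums the absolute values of the Gram matrix entries of the basis and of its weak derivatives
    up to order two, these being linear up to null sets. *)
Lemma H2_norm_uc_le m (w : 'I_m -> F) : (forall k, H2 (w k)) ->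
  exists2 C : R, 0 <= C & forall c, H2_norm (uc w c) <= C * \sum_k `|c k|.
Proof.
move=> Hw.
pose gram (g : 'I_m -> F) : R := \sum_k \sum_l `|rp (g k) (g l)|.
have gram0 (g : 'I_m -> F) : 0 <= gram g by apply: sumr_ge0 => k _; exact: sumr_ge0.
pose K : R := gram w + \sum_i gram (fun k => weakD i (w k)) +
  \sum_i \sum_j gram (fun k => weakD i (weakD j (w k))).
have K0 : 0 <= K.
  apply: addr_ge0; first by rewrite addr_ge0// sumr_ge0.
  by apply: sumr_ge0 => i _; exact: sumr_ge0.
exists (Num.sqrt K); first exact: sqrtr_ge0.
move=> c; set D := \sum_k `|c k|; have D0 : 0 <= D by exact: sumr_ge0.
rewrite -[D in leRHS](ger0_norm D0) -sqrtr_sqr -sqrtrM// ler_wsqrtr//.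
have Hu : H2 (uc w c) by exact: H2_comb.
have [Lu Lu1 Lu2] := Hu.
have L1 k : L2c (w k) by have [] := Hw k.
have L2 i k : L2c (weakD i (w k)) by have [_ /(_ i)[]] := Hw k.
have L3 i j k : L2c (weakD i (weakD j (w k))) by have [_ _ /(_ j i)[]] := Hw k.
rewrite /K !mulrDl; apply: lerD; first apply: lerD.
- exact: (Lp_norm_uc_le L1 Lu (filterE _ (fun=> erefl))).
- rewrite mulr_suml; apply: ler_sum => i _; apply: Lp_norm_uc_le (L2 i) (Lu1 i).1 _.
  exact: (weakD_comb (fun k => (c k)%:C) Hw i).
- rewrite mulr_suml; apply: ler_sum => i _; rewrite mulr_suml; apply: ler_sum => j _.
  apply: Lp_norm_uc_le (L3 i j) (Lu2 j i).1 _.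
  exact: (weakD2_comb (fun k => (c k)%:C) Hw j i).
Qed.

Lemma closed_cube_compact (k : nat) : compact [set x : E | `|x| <= k%:R].
Proof.
apply: bounded_closed_compact.
  exists k%:R; split => // M kM x /= xk; apply: le_trans xk _; exact: ltW.
apply: (@preimage_closed _ _ (fun x : E => `|x|) [set y : R | y <= k%:R]); last exact: closed_le.
by move=> x _; exact: norm_continuous.
Qed.

Lemma continuous_cnorm f : ccontinuous f -> continuous (fun x => cnorm (f x)).
Proof.
move=> [cr ci] x.
rewrite (_ : (fun x => _) = fun x => Num.sqrt (Re (f x) ^+ 2 + Im (f x) ^+ 2)); last first.
  by apply/funext => y; case: (f y).
pose G (y : E) : R := Re (f y) ^+ 2 + Im (f y) ^+ 2.
apply: (@continuous_comp _ _ _ G (@Num.sqrt R)); last exact: sqrt_continuous.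
apply: (@continuousD _ _ _ (fun x => Re (f x) ^+ 2) (fun x => Im (f x) ^+ 2)).
  exact: (@continuous_comp _ _ _ (fun x => Re (f x)) (fun y : R => y ^+ 2) x (cr x) (@exprn_continuous _ 2 _)).
exact: (@continuous_comp _ _ _ (fun x => Im (f x)) (fun y : R => y ^+ 2) x (ci x) (@exprn_continuous _ 2 _)).
Qed.

Lemma cnorm_bounded f (k : nat) : ccontinuous f ->
  exists2 M : R, 0 <= M & forall x : E, `|x| <= k%:R -> cnorm (f x) <= M.
Proof.
move=> cf; have ne : [set x : E | `|x| <= k%:R] !=set0 by exists 0; rewrite /= normr0.
have [x0 _ H] := EVT_max_rV ne (@closed_cube_compact k)
  (continuous_subspaceT (continuous_cnorm cf)).
exists (cnorm (f x0)); first exact: cnorm_ge0.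
by move=> x xk; apply: H; rewrite inE.
Qed.

Lemma H2_norm_ge f : Lp_norm 2 f <= H2_norm f.
Proof.
rewrite -[leLHS](ger0_norm (Lp_norm_ge0 2 f)) -sqrtr_sqr ler_wsqrtr//.
rewrite -addrA lerDl addr_ge0//; first by apply: sumr_ge0 => i _; exact: sqr_ge0.
by apply: sumr_ge0 => i _; apply: sumr_ge0 => j _; exact: sqr_ge0.
Qed.

Lemma sup_cnorm_ge0 f (k : nat) : 0 <= sup [set cnorm (f x) | x in [set x : E | `|x| <= k%:R]].
Proof.
set A := (X in sup X).
(* [sup] takes the default value 0 on a set that has no supremum. *)
have [hA|/sup_out-> //] := pselect (has_sup A).
apply: (@le_trans _ _ (cnorm (f 0))); first exact: cnorm_ge0.
by apply: sup_upper_bound => //; exists 0; rewrite //= normr0.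
Qed.

Lemma Vnorm_ge2 (p : R) k f : Lp_norm 2 f <= Vnorm p k f.
Proof.
rewrite /Vnorm; apply: le_trans (H2_norm_ge f) _.
by rewrite -addrA lerDl addr_ge0 ?Lp_norm_ge0 ?sup_cnorm_ge0.
Qed.

Lemma Vnorm_ge_sup (p : R) k f x : ccontinuous f -> `|x| <= k%:R ->
  cnorm (f x) <= Vnorm p k f.
Proof.
move=> cf xk; have [M _ HM] := cnorm_bounded k cf.
apply: (@le_trans _ _ (sup [set cnorm (f x) | x in [set x : E | `|x| <= k%:R]])).
  apply: sup_upper_bound; last by exists x.
  split; first by exists (cnorm (f x)); exists x.
  by exists M => _ [y yk <-]; exact: HM.
rewrite /Vnorm lerDr addr_ge0 ?Lp_norm_ge0//; exact: sqrtr_ge0.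
Qed.

Section Span.
Variables (p : R) (m : nat) (w : 'I_m -> F).
Hypotheses (hp : 2 < p) (ucV : forall c, Vspace p (uc w c)).

Lemma span_V k : Vspace p (w k).
Proof.
have -> : w k = uc w (fun j => (j == k)%:R); last exact: ucV.
rewrite /uc (bigD1 k)//= eqxx scale1r big1 ?addr0// => i /negbTE ->; exact: scale0r.
Qed.

Lemma Lp_norm_p_uc_le c : Lp_norm p (uc w c) <= Sp p w `^ p^-1 * \sum_k `|c k|.
Proof.
have p0 : 0 < p by move: hp; lra.
have [_ Lc _] := ucV c; rewrite (Lp_normE p0 Lc).
set D := \sum_k `|c k|; have D0 : 0 <= D by exact: sumr_ge0.
have DE : D = (D `^ p) `^ p^-1 by rewrite -powRrM mulfV ?gt_eqF// powRr1.
rewrite {1}DE -powRM ?powR_ge0 ?Sp_ge0//.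
apply: ge0_ler_powR.
- by rewrite invr_ge0 ltW.
- by rewrite nnegrE; apply: Rintegral_ge0 => t _; exact: powR_ge0.
- by rewrite nnegrE mulr_ge0 ?powR_ge0 ?Sp_ge0.
have iS := Sp_itg hp span_V.
rewrite mulrC /Sp -(RintegralZl _ measurableT iS).
apply: Rint_le; [exact: V_pow_itg hp _ (ucV c)|exact: itgZ|].
move=> t; rewrite -powRM// ?Sfun_ge0//.
apply: ge0_ler_powR; rewrite ?nnegrE ?cnorm_ge0 ?mulr_ge0 ?Sfun_ge0 ?(ltW p0)//.
exact: uc_le.
Qed.

Lemma Sfun_bounded (k : nat) :
  exists2 M : R, 0 <= M & forall x : E, `|x| <= k%:R -> Sfun w x <= M.
Proof.
have H j : exists M : R, 0 <= M /\ forall x : E, `|x| <= k%:R -> cnorm (w j x) <= M.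
  have [_ _ /(cnorm_bounded k)[M M0 HM]] := span_V j; by exists M.
have [M HM] := choice H.
exists (\sum_j M j); first by apply: sumr_ge0 => j _; exact: (HM j).1.
by move=> x xk; apply: ler_sum => j _; exact: (HM j).2.
Qed.

Lemma Vnorm_uc_le k : exists2 C : R, 0 <= C & forall c, Vnorm p k (uc w c) <= C * \sum_j `|c j|.
Proof.
have [C1 C10 H1] := @H2_norm_uc_le m w (fun j => V_H2 (span_V j)).
have [M M0 HM] := Sfun_bounded k.
exists (C1 + Sp p w `^ p^-1 + M); first by rewrite !addr_ge0// powR_ge0.
move=> c; rewrite /Vnorm !mulrDl; apply: lerD; first apply: lerD.
- exact: H1.
- exact: Lp_norm_p_uc_le.
apply: ge_sup; first by exists (cnorm (uc w c 0)); exists 0; rewrite //= normr0.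
move=> _ [x xk <-]; apply: le_trans (uc_le _ _ _) _.
by rewrite mulrC ler_wpM2r ?sumr_ge0//; exact: HM.
Qed.

Lemma Lp_norm2_uc c : orthonormal w -> Lp_norm 2 (uc w c) ^+ 2 = \sum_k c k ^+ 2.
Proof.
move=> ow; have Lw k := V_L2c (span_V k); have Lu := V_L2c (ucV c).
have Lz k : L2c ((c k)%:C *: w k) by exact: (L2cZ _ (Lw k)).
rewrite (Lp_norm2_sqr Lu) {1}/uc (rp_suml _ Lz Lu); apply: eq_bigr => k _.
by rewrite (rpZl _ (Lw k) Lu) rpC uc_eval// expr2.
Qed.

(** Every [Vnorm p k] contains the L^2-norm, which is Euclidean in orthonormal coordinates: the
    converse of [Vnorm_uc_le]. *)
Lemma coord_le_Vnorm k c j : orthonormal w -> `|c j| <= Vnorm p k (uc w c).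
Proof.
move=> ow; apply: le_trans (Vnorm_ge2 p k _).
rewrite -ler_sqr ?nnegrE ?Lp_norm_ge0// Lp_norm2_uc// real_normK ?num_real//.
by rewrite (bigD1 j)//= lerDl sumr_ge0// => i _; exact: sqr_ge0.
Qed.

End Span.
End VnormBounds.

(** * Time derivatives of curves in V *)

Section TimeDerivativeInV.
Variables (R : realType) (N : nat) (T : \bar R) (p : R).
Local Notation E := 'rV[R]_N.
Local Notation F := (E -> R[i]).
Local Notation I := (itime T).
Implicit Types (f : I -> F) (t : I) (v : F).
Local Notation V := (Vspace p).
Local Notation nu := (Vnorm p).

(** No point of the interval is isolated: it is open on the right, so slightly later times exist,
    also at [t = 0]. Uniqueness of limits rests on this. *)
Lemma itime_near t (d : R) : 0 < d ->
  exists2 s : I, sval s != sval t & `|sval s - sval t| < d.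
Proof.
case: t => t /= /andP[t0 tT] d0.
suff [h /andP[h0 hd] hT] : exists2 h : R, 0 < h < d & ((t + h)%:E < T)%E.
  have sT : (0 <= t + h) && ((t + h)%:E < T)%E by rewrite hT addr_ge0// ltW.
  exists (exist _ (t + h) sT) => /=; first by rewrite -subr_eq0 addrAC subrr add0r gt_eqF.
  by rewrite addrAC subrr add0r ger0_norm// ltW.
case: T tT => [r| |] //; last first.
  by move=> _; exists (d / 2); [apply/andP; split; move: d0; lra|rewrite ltry].
rewrite lte_fin => tr; exists (Num.min (d / 2) ((r - t) / 2)).
  by rewrite lt_min gt_min; apply/andP; split; [apply/andP; split|apply/orP; left]; move: d0 tr; lra.
rewrite lte_fin -ltrBrDl gt_min; apply/orP; right; move: tr; lra.
Qed.

Lemma ccontinuous_comb (f g : F) (z : R[i]) : ccontinuous f -> ccontinuous g ->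
  ccontinuous (f + z *: g).
Proof.
move=> [fr fi] [gr gi]; split.
- rewrite (_ : (fun x => _) = fun x => Re (f x) + (Re z * Re (g x) - Im z * Im (g x))).
    move=> x; apply: (continuousD (fr x)); apply: continuousB.
      by apply: continuousM; [exact: cst_continuous|exact: gr].
    by apply: continuousM; [exact: cst_continuous|exact: gi].
  by apply/funext => x; rewrite (_ : (f + z *: g) x = f x + z * g x)// !ReImE.
- rewrite (_ : (fun x => _) = fun x => Im (f x) + (Re z * Im (g x) + Im z * Re (g x))).
    move=> x; apply: (continuousD (fi x)); apply: continuousD.
      by apply: continuousM; [exact: cst_continuous|exact: gi].
    by apply: continuousM; [exact: cst_continuous|exact: gr].
  by apply/funext => x; rewrite (_ : (f + z *: g) x = f x + z * g x)// !ReImE.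
Qed.

Lemma ccontinuousB (f g : F) : ccontinuous f -> ccontinuous g -> ccontinuous (f - g).
Proof. by move=> cf cg; rewrite -scaleN1r; exact: ccontinuous_comb. Qed.

(** The norm whose index exceeds [|x|] controls the values at [x], so the limits agree at every
    point and not only almost everywhere. *)
Lemma cvg_in_unique f t v v' : (forall s, ccontinuous (f s)) ->
  ccontinuous v -> ccontinuous v' -> cvg_in nu f t v -> cvg_in nu f t v' -> v = v'.
Proof.
move=> cf cv cv' fv fv'; apply/funext => x.
apply/eqP; rewrite -subr_eq0; apply/eqP/cnorm_eq0/eqP.
rewrite eq_le cnorm_ge0 andbT; apply/ler_addgt0Pl => e e0; rewrite addr0.
have xk : `|x| <= (Num.bound `|x|)%:R by apply/ltW/archi_boundP.
have e2 : 0 < e / 2 by rewrite divr_gt0.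
have [d d0 Hd] := fv (Num.bound `|x|) _ e2.
have [d' d0' Hd'] := fv' (Num.bound `|x|) _ e2.
have [s st] : exists2 s : I, sval s != sval t & `|sval s - sval t| < Num.min d d'.
  by apply: itime_near; rewrite lt_min d0.
rewrite lt_min => /andP[/(Hd s st) h /(Hd' s st) h'].
have := Vnorm_ge_sup p (ccontinuousB (cf s) cv) xk.
have := Vnorm_ge_sup p (ccontinuousB (cf s) cv') xk.
rewrite (_ : (f s - v') x = f s x - v' x)// (_ : (f s - v) x = f s x - v x)// => h1' h1.
have -> : v x - v' x = (f s x - v' x) + (v x - f s x) by rewrite [RHS]addrC addrA subrK.
apply: le_trans (cnormD _ _) _; rewrite [e]splitr; apply: lerD.
  by apply: le_trans h1' _; exact: ltW.
by rewrite cnormB; apply: le_trans h1 _; exact: ltW.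
Qed.

Lemma dtime_eq f t v : (forall s, V (f s)) -> is_dtime V nu f t v -> dtime V nu f t = v.
Proof.
move=> fV fv; rewrite /dtime; case: xgetP => [v' _ fv'|/(_ v)]; last by move=> /(_ fv).
have cf s : ccontinuous (f s) by have [] := fV s.
apply: (@cvg_in_unique _ t _ _ _ _ _ fv'.2 fv.2).
- by move=> s; rewrite -[_ *: _]add0r; apply: ccontinuous_comb;
    [split => x; exact: cst_continuous|exact: ccontinuousB].
- by have [[]] := fv'.
- by have [[]] := fv.
Qed.

Lemma dtimeP f t : C1 V nu f -> is_dtime V nu f t (dtime V nu f t).
Proof. by move=> [_ /(_ t) ex _]; exact: xgetPex. Qed.

Lemma hasd_lipschitz_at m (c c' : R -> 'I_m -> R) (t : R) : itv0 T t ->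
  (forall j, hasd T (fun s : R => c s j) (fun s : R => c' s j)) ->
  forall e : R, 0 < e -> exists2 r : R, 0 < r & forall s : R, itv0 T s -> `|s - t| < r ->
    forall j, `|c s j - c t j| <= e.
Proof.
move=> tT H e e0; have [r r0 Hr] := hasd_finite_family H tT (@ltr01 R).
pose A : R := 1 + \sum_k `|c' t k|.
have A0 : 0 < A by rewrite ltr_wpDr// sumr_ge0.
exists (Num.min r (e / A)); first by rewrite lt_min r0 divr_gt0.
move=> s sT; rewrite lt_min ltr_pdivlMr// => /andP[/(Hr s sT) h sA] j.
apply: le_trans (ltW sA); rewrite -[c s j - c t j](subrK ((s - t) * c' t j)).
apply: le_trans (ler_normD _ _) _; rewrite [leRHS]mulrDr mulr1; apply: lerD.
  by rewrite -[leRHS]mul1r.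
by rewrite normrM ler_wpM2l// (bigD1 j)//= lerDl sumr_ge0.
Qed.

Section Coordinates.
Variables (m : nat) (w : 'I_m -> F).
Local Notation S := ('I_m -> R).
Hypotheses (hp : 2 < p) (ucV : forall c, V (uc w c)).

Lemma cvg_in_uc (g : I -> S) (l : S) t :
  (forall e : R, 0 < e -> exists2 r : R, 0 < r & forall s : I, sval s != sval t ->
     `|sval s - sval t| < r -> forall j, `|g s j - l j| <= e) ->
  cvg_in nu (fun s => uc w (g s)) t (uc w l).
Proof.
move=> H k e e0; have [C C0 HC] := Vnorm_uc_le hp ucV k.
have K0 : 0 < C * m%:R + 1 by rewrite ltr_wpDl// mulr_ge0.
have [r r0 Hr] := H (e / (C * m%:R + 1)) (divr_gt0 e0 K0).
exists r => // s st sr; rewrite ucB; apply: le_lt_trans (HC _) _.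
apply: (@le_lt_trans _ _ (C * (m%:R * (e / (C * m%:R + 1))))).
  rewrite ler_wpM2l//; apply: (@le_trans _ _ (\sum_(j < m) e / (C * m%:R + 1))).
    by apply: ler_sum => j _; exact: Hr.
  by rewrite sumr_const card_ord mulr_natl.
by rewrite mulrA mulrCA gtr_pMr// ltr_pdivrMr// mul1r ltrDl.
Qed.

Lemma hasd_is_dtime (c c' : R -> S) t :
  (forall j, hasd T (fun s : R => c s j) (fun s : R => c' s j)) ->
  is_dtime V nu (fun s => uc w (c (sval s))) t (uc w (c' (sval t))).
Proof.
move=> cc'; split; first exact: ucV.
rewrite (_ : (fun s : I => _) = fun s : I => uc w (fun j => (sval s - sval t)^-1 * (c (sval s) j - c (sval t) j))).
  apply: cvg_in_uc => e e0.
  have [r r0 Hr] := hasd_finite_family cc' (svalP t) e0.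
  exists r => // s st sr j.
  have st0 : 0 < `|sval s - sval t| by rewrite normr_gt0 subr_eq0.
  rewrite -(ler_pM2r st0) -normrM; apply: le_trans (Hr _ (svalP s) sr j).
  rewrite le_eqVlt; apply/orP; left; apply/eqP; congr `|_|.
  by field; rewrite subr_eq0.
by apply/funext => s; rewrite ucB -ucZ.
Qed.

(** Turns a function on the subtype of times into one on the line, the domain of [hasd], with
    default value 0 outside [[0, T)]. *)
Definition extend_itime (g : I -> R) (t : R) : R := oapp g 0 (insub t : option I).

Lemma extend_itimeE (g : I -> R) (t : R) (tT : itv0 T t) : extend_itime g t = g (exist _ t tT).
Proof.
by rewrite /extend_itime; case: insubP => [s _ st|]; [congr g; exact: val_inj|rewrite /= -/(itv0 T t) tT].
Qed.

Hypothesis ow : orthonormal w.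

Lemma is_dtime_hasd (c c' : I -> S) :
  (forall t, is_dtime V nu (fun s => uc w (c s)) t (uc w (c' t))) ->
  forall j, hasd T (extend_itime (fun t => c t j)) (extend_itime (fun t => c' t j)).
Proof.
(* A single norm, of index 0, suffices, since each of them bounds the coordinates. *)
move=> H j t tT e e0; have [_ /(_ 0%N e e0)[r r0 Hr]] := H (exist _ t tT).
exists r => // s sT sr; have [->|st] := eqVneq s t.
  by rewrite !subrr mul0r subrr normr0 mulr0.
rewrite !extend_itimeE.
have := Hr (exist _ s sT) st sr => /=.
rewrite ucB -ucZ ucB => /ltW; set g := (fun k => _) => h.
have := le_trans (coord_le_Vnorm ucV 0 g j ow) h.
have st0 : 0 < `|s - t| by rewrite normr_gt0 subr_eq0.
rewrite -(ler_pM2r st0) -normrM; apply: le_trans.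
rewrite le_eqVlt; apply/orP; left; apply/eqP; congr `|_|.
by rewrite /g; field; rewrite subr_eq0.
Qed.

End Coordinates.
End TimeDerivativeInV.

(** * The Galerkin problem on one level *)

Section Level.
Variables (R : realType) (N : nat) (p : R) (q : 'rV[R]_N -> R).
Hypotheses (hp : 2 < p) (mq : measurable_fun setT (fun t : N.-tuple (measurableTypeR R) => q (pt t)))
  (qb : exists M : R, forall x, `|q x| <= M).
Local Notation E := 'rV[R]_N.
Local Notation F := (E -> R[i]).
Local Notation V := (Vspace p).
Local Notation nu := (Vnorm p).
Variable W : set F.
Hypotheses (fW : findim_subspace W) (WV : W `<=` V).

Section GalerkinField.
Variables (m : nat) (w : 'I_m -> F).
Local Notation S := ('I_m -> R).
Hypotheses (ow : orthonormal w) (Wuc : forall c, W (uc w c))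
  (Wspan : forall v, W v -> v = uc w (fun k => rp v (w k))).

(* Re <- i S, w> = Re <S, i w>: these are the coordinates of A(u) in the basis w. *)
Definition galerkin_field (c : S) (j : 'I_m) : R := hfun p q (uc w c) ('i *: w j).
Local Notation G := galerkin_field.

Let ucV c : V (uc w c). Proof. exact: WV. Qed.
Let wV k : V (w k). Proof. exact: span_V. Qed.
Let WL v : W v -> L2c v. Proof. by move=> /WV/V_L2c. Qed.
Let Ww k : W (w k).
Proof.
have -> : w k = uc w (fun j => (j == k)%:R); last exact: Wuc.
rewrite /uc (bigD1 k)//= eqxx scale1r big1 ?addr0// => i /negbTE ->; exact: scale0r.
Qed.
Let iwV k : V ('i *: w k). Proof. exact: WV (findim_scale 'i fW (Ww k)). Qed.

Lemma scale_i_uc c : 'i *: uc w c = uc (fun k => 'i *: w k) c.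
Proof.
by rewrite /uc scaler_sumr; apply: eq_bigr => k _; rewrite !scalerA mulrC.
Qed.

Lemma hfun_galerkin c d : hfun p q (uc w c) ('i *: uc w d) = \sum_j d j * G c j.
Proof.
have iucV e : V (uc (fun k => 'i *: w k) e) by rewrite -scale_i_uc; exact: WV (findim_scale 'i fW (Wuc e)).
by rewrite scale_i_uc (hfun_ucr hp mq qb iwV).
Qed.

(** The constant [B] serves the bilinear part, [K] the power part by [Nf_lip], since
    [|i w_i| <= Sfun w]. For [rho < 0] the bounds on [c] are contradictory. *)
Lemma galerkin_locally_lipschitz (rho : R) : exists2 L : R, 0 <= L & forall c d,
  (forall i, `|c i| <= rho) -> (forall i, `|d i| <= rho) ->
  forall i, `|G c i - G d i| <= L * \sum_j `|c j - d j|.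
Proof.
have [r0|r0] := leP 0 rho; last first.
  exists 0 => // c d cr _ i; have := le_lt_trans (cr i) r0.
  by rewrite normr_lt0.
pose B : R := \sum_i \sum_k `|bform q (w k) ('i *: w i)|.
have B0 : 0 <= B by apply: sumr_ge0 => i _; exact: sumr_ge0.
pose K := Nconst p * (m%:R * rho) `^ (p - 2) * Sp p w.
have K0 : 0 <= K by rewrite !mulr_ge0 ?powR_ge0 ?Sp_ge0.
exists (B + K); first exact: addr_ge0.
move=> c d cr dr i; rewrite /galerkin_field /hfun.
have swap (x y z t : R) : x - y - (z - t) = (x - z) - (y - t) by ring.
rewrite swap.
apply: le_trans (ler_normB _ _) _; rewrite [leRHS]mulrDl; apply: lerD.
  rewrite !(bform_ucl mq qb wV _ (iwV i)) -sumrB.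
  apply: le_trans (ler_norm_sum _ _ _) _; rewrite mulr_sumr; apply: ler_sum => k _.
  rewrite -mulrBl normrM mulrC ler_wpM2r// /B (bigD1 i)//= (bigD1 k)//= -addrA lerDl.
  by rewrite addr_ge0// ?sumr_ge0// => j _; rewrite sumr_ge0.
apply: Nf_lip => // x.
rewrite (_ : ('i *: w i) x = 'i * w i x)// cnormM.
have -> : ComplexField.Normc.normc ('i : R[i]) = 1 by rewrite /= expr0n expr1n add0r sqrtr1.
by rewrite mul1r /Sfun (bigD1 i)//= lerDl; apply: sumr_ge0 => k _; exact: cnorm_ge0.
Qed.

Lemma galerkin_skew c : \sum_i c i * G c i = 0.
Proof. by rewrite -hfun_galerkin (hfun_i _ (ucV c)). Qed.

(** Real parts tested with the basis identify the coordinates. Conversely the imaginary part at [v]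
    is the real part at [i v], which lies in [W] because [W] is a complex subspace. *)
Lemma galerkin_equation c d :
  (forall v, W v -> L2pair (uc w d) v = nls_op q p (uc w c) v) <-> forall j, d j = G c j.
Proof.
have nlsE v : W v -> nls_op q p (uc w c) v =
    hfun p q (uc w c) ('i *: v) +i* hfun p q (uc w c) ('i *: ('i *: v)).
  move=> Wv; have Wiv := findim_scale 'i fW Wv; have Wiiv := findim_scale 'i fW Wiv.
  exact: (nls_opE hp mq qb (WV (Wuc c)) (WV Wv) (WV Wiv) (WV Wiiv)).
have Lw k := WL (Ww k).
split=> [H j|dE].
  have := H _ (Ww j); rewrite (nlsE _ (Ww j)) L2pairE => -[].
  by rewrite uc_eval.
have key v : W v -> rp (uc w d) v = hfun p q (uc w c) ('i *: v).
  move=> Wv; rewrite (Wspan Wv) hfun_galerkin (rp_ucl wV)//; last exact/WL/Wuc.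
  by apply: eq_bigr => k _; rewrite rpC uc_eval// dE mulrC.
by move=> v Wv; rewrite (nlsE _ Wv) L2pairE -!key//; exact: findim_scale.
Qed.

(* Tested with v = - i u_t, the equation says that the derivative of half the energy
   along u_t is Re <u_t, - i u_t> = 0. *)
Lemma energy_orthogonal c : \sum_k G c k * (2 * hfun p q (uc w c) (w k)) = 0.
Proof.
have -> : \sum_k G c k * (2 * hfun p q (uc w c) (w k)) = 2 * hfun p q (uc w c) (uc w (G c)).
  by rewrite hfun_ucr// mulr_sumr; apply: eq_bigr => k _; ring.
set d := G c; pose v := (- 'i) *: uc w d.
have Wv : W v by exact: findim_scale.
have ivE : 'i *: v = uc w d.
  by rewrite /v scalerA mulrN -expr2 sqr_i opprK scale1r.
have Lw k := WL (Ww k).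
have : rp (uc w d) v = hfun p q (uc w c) ('i *: v).
  rewrite (Wspan Wv) hfun_galerkin (rp_ucl wV)//; last exact/WL/Wuc.
  by apply: eq_bigr => k _; rewrite rpC uc_eval// mulrC.
rewrite ivE => <-; have -> : v = (-1)%:C *: ('i *: uc w d).
  by rewrite /v scalerA rmorphN1 mulN1r.
have Lu := WL (Wuc d).
have -> : rp (uc w d) ((-1)%:C *: ('i *: uc w d)) = 0; last by rewrite mulr0.
by rewrite (rpZr _ Lu (L2cZ 'i Lu)) (rp_i (uc w d) 0); exact: mulr0.
Qed.

End GalerkinField.

Variables (T : \bar R) (hT : (0 < T)%E).
Local Notation I := (itime T).

Definition galerkin_sol (v0 : F) (u : I -> F) :=
  [/\ C1 V nu u, forall t, W (u t) /\ W (dtime V nu u t),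
      forall t v, W v -> L2pair (dtime V nu u t) v = nls_op q p (u t) v &
      u (itime0 hT) = v0].

Let WP f : W f -> L2c f /\ ccontinuous f.
Proof. by move=> /WV Vf; split; [exact: V_L2c Vf|have [] := Vf]. Qed.

Theorem galerkin_exists v0 : W v0 -> exists u : I -> F,
  [/\ galerkin_sol v0 u, forall s t, energy q p (u s) = energy q p (u t) &
      forall s t, Lp_norm 2 (u s) = Lp_norm 2 (u t)].
Proof.
move=> Wv0; have [m [w [ow Wuc Wspan]]] := findim_basis fW WP.
have ucV c : V (uc w c) by exact: WV.
have wV := span_V ucV.
have Floc := galerkin_locally_lipschitz Wuc.
have Fskew := galerkin_skew Wuc.
have [c [c0 cs]] := ode_exists T Floc Fskew (fun k => rp v0 (w k)).
pose G := galerkin_field w.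
pose rho : R := 1 + \sum_i c 0 i ^+ 2.
have cb t : itv0 T t -> forall i, `|c t i| <= rho.
  by move=> tT i; exact: (ode_bounded Fskew _ cs tT).
pose u (t : I) := uc w (c (sval t)).
have uV t : V (u t) by exact: ucV.
have du t : is_dtime V nu u t (uc w (G (c (sval t)))) by exact: (@hasd_is_dtime _ _ T p m w hp ucV c (fun s => G (c s)) t cs).
have dE t : dtime V nu u t = uc w (G (c (sval t))) by exact: dtime_eq.
exists u; split.
- split.
  + split => //; first by move=> t; exists (uc w (G (c (sval t)))).
    move=> t; rewrite dE (_ : dtime V nu u = fun s : I => uc w (G (c (sval s)))); last first.
      by apply/funext => s; exact: dE.
    (* The time derivative is continuous because the field is Lipschitz on the cube that contains
       the whole curve. *)
    apply: cvg_in_uc => // e e0.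
    have [L L0 HL] := Floc rho.
    have K0 : 0 < L * m%:R + 1 by rewrite ltr_wpDl// mulr_ge0.
    have [r r0 Hr] : exists2 r : R, 0 < r & forall s, itv0 T s -> `|s - sval t| < r ->
        forall k, `|c s k - c (sval t) k| <= e / (L * m%:R + 1).
      exact: (hasd_lipschitz_at (svalP t) cs (divr_gt0 e0 K0)).
    exists r => // s _ sr j.
    apply: le_trans (HL _ _ (cb _ (svalP s)) (cb _ (svalP t)) j) _.
    apply: (@le_trans _ _ (L * (m%:R * (e / (L * m%:R + 1))))).
      rewrite ler_wpM2l//; apply: (@le_trans _ _ (\sum_(j < m) e / (L * m%:R + 1))).
        by apply: ler_sum => k _; exact: (Hr _ (svalP s)).
      by rewrite sumr_const card_ord mulr_natl.
    by rewrite mulrA mulrCA ger_pMr// ler_pdivrMr// mul1r lerDl.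
  + by move=> t; rewrite dE; split; exact: Wuc.
  + move=> t; rewrite dE; apply/galerkin_equation => //.
  + rewrite /u /= [RHS](Wspan _ Wv0); congr (uc w _); apply/funext => k; exact: c0.
- suff H t : energy q p (u t) = energy q p (uc w (c 0)) by move=> s t; rewrite !H.
  have r0 : 0 <= rho by rewrite addr_ge0// sumr_ge0// => i _; exact: sqr_ge0.
  have [C C0 HC] := energy_quad hp mq qb wV ucV r0.
  apply: (hasd_const (hasd_chain C0 HC cb cs) _ (svalP t)).
  by move=> s sT; exact: energy_orthogonal.
- suff H t : Lp_norm 2 (u t) = Num.sqrt (\sum_k c 0 k ^+ 2) by move=> s t; rewrite !H.
  rewrite -(ode_conserved Fskew cs (svalP t)) -(Lp_norm2_uc ucV _ ow).
  by rewrite sqrtr_sqr ger0_norm// Lp_norm_ge0.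
Qed.

(** The coordinates of any solution satisfy the same differential equation: membership of [u t] and
    of its time derivative in [W] lets both be read off in the basis. *)
Theorem galerkin_unique v0 u u' : galerkin_sol v0 u -> galerkin_sol v0 u' -> u = u'.
Proof.
have [m [w [ow Wuc Wspan]]] := findim_basis fW WP.
have ucV c : V (uc w c) by exact: WV.
have Floc := galerkin_locally_lipschitz Wuc.
have Fskew := galerkin_skew Wuc.
pose co (u : I -> F) (t : R) j : R := extend_itime (fun t => rp (u t) (w j)) t.
have key v : galerkin_sol v0 v -> ode_sol (galerkin_field w) T (co v).
  move=> [C1v Wv eqv _].
  have vE : v = fun t => uc w (fun k => rp (v t) (w k)).
    by apply/funext => t; exact: Wspan (Wv t).1.
  have dE t : dtime V nu v t = uc w (fun k => rp (dtime V nu v t) (w k)).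
    exact: Wspan (Wv t).2.
  have H t : is_dtime V nu (fun t => uc w (fun k => rp (v t) (w k))) t
      (uc w (fun k => rp (dtime V nu v t) (w k))).
    by rewrite -vE -dE; exact: dtimeP.
  move=> j; have := is_dtime_hasd ucV ow H j; apply: hasd_eq => t tT.
  rewrite extend_itimeE; set t' := exist _ _ _.
  have -> : co v t = fun k => rp (v t') (w k).
    by apply/funext => k; rewrite /co extend_itimeE.
  apply: (galerkin_equation ow Wuc Wspan _ (fun k => rp (dtime V nu v t') (w k))).1 => x Wx.
  rewrite -dE -(_ : v t' = uc w _); first exact: eqv.
  by rewrite {1}vE.
move=> gu gu'; have su := key _ gu; have su' := key _ gu'.
have [_ Wu _ u0] := gu; have [_ Wu' _ u0'] := gu'.
have T0 : itv0 T 0 by rewrite /itv0 lexx.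
have E0 v : v (itime0 hT) = v0 -> forall j, co v 0 j = rp v0 (w j).
  move=> v00 j; rewrite /co (extend_itimeE _ T0) -v00; congr (rp (v _) _); exact: val_inj.
have eqc := ode_unique Floc Fskew su su' (fun j => etrans (E0 _ u0 j) (esym (E0 _ u0' j))).
apply/funext => t; rewrite (Wspan _ (Wu t).1) (Wspan _ (Wu' t).1); congr (uc w _).
apply/funext => j; case: t => t tT.
by have := eqc t tT j; rewrite /co !(extend_itimeE _ tT).
Qed.

End Level.

(** * Passage to the ultrapower *)

Section Ultrapower.
Variables (R : realType) (U : set_system (finsub R)).
Context {FU : Filter U}.
Local Notation L := (finsub R).

(** A net belongs to its own class since [U] contains the whole index set; equal classes give equal
    elements of the subtype by proof irrelevance. *)
Lemma ulim_eqP (X : Type) (phi psi : L -> X) :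
  ulim U phi = ulim U psi <-> U [set l | phi l = psi l].
Proof.
split=> [/(congr1 (@sval _ _)) /= E|H].
  have : ultra_class U psi phi; last by [].
  by rewrite -E /ultra_class /=; apply: filterE.
have E : ultra_class U phi = ultra_class U psi.
  apply/seteqP; split=> xi /= Hxi.
    by apply: filterS2 H Hxi => l /= <-.
  by apply: filterS2 H Hxi => l /= ->.
rewrite /ulim; move: (ex_intro _ phi _) (ex_intro _ psi _) => /=.
rewrite E => e1 e2; congr exist; exact: Prop_irrelevance.
Qed.

Lemma net_ulim (X : Type) (phi : L -> X) : U [set l | net (ulim U phi) l = phi l].
Proof.
rewrite /net; case: cid => psi /= E.
have : ultra_class U phi psi by rewrite E /ultra_class /=; apply: filterE.
by [].
Qed.

Lemma ulim_net (X : Type) (xi : star U X) : ulim U (net xi) = xi.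
Proof.
case: xi => A [phi EA]; subst A; apply/(ulim_eqP _ _).
exact: net_ulim.
Qed.

Lemma star_funE (X Y : Type) (f : X -> Y) (phi : L -> X) :
  star_fun f (ulim U phi) = ulim U (fun l => f (phi l)).
Proof. by apply/ulim_eqP; apply: filterS (net_ulim phi) => l /= ->. Qed.

Lemma star_fun2E (X Y Z : Type) (f : X -> Y -> Z) (phi : L -> X) (psi : L -> Y) :
  star_fun2 f (ulim U phi) (ulim U psi) = ulim U (fun l => f (phi l) (psi l)).
Proof.
by apply/ulim_eqP; apply: filterS2 (net_ulim phi) (net_ulim psi) => l /= -> ->.
Qed.

Lemma star_appE (X Y : Type) (f : L -> X -> Y) (x : L -> X) :
  star_app (ulim U f) (ulim U x) = ulim U (fun l => f l (x l)).
Proof. exact: star_fun2E. Qed.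

Lemma ulim_setP (X : Type) (A : L -> set X) (phi : L -> X) :
  ulim_set U A (ulim U phi) -> U [set l | A l (phi l)].
Proof.
move=> [psi [Apsi /ulim_eqP H]]; apply: filterS H => l /= ->; exact: Apsi.
Qed.

(* The counterexamples, chosen level by level, form a net of their own. *)
Lemma near_forall (X : Type) (x0 : X) (P : L -> X -> Prop) :
  (forall x : L -> X, U [set l | P l (x l)]) -> U [set l | forall x, P l x].
Proof.
move=> H.
have /choice[x Hx] : forall l, exists x, P l x -> forall y, P l y.
  move=> l; have [HP|/existsNP[x nPx]] := pselect (forall y, P l y).
    by exists x0.
  by exists x => /nPx.
by apply: filterS (H x) => l; exact: Hx.
Qed.

End Ultrapower.

Local Close Scope complex_scope.

Theorem theorem42 (R : realType) (N : nat) (hN : (0 < N)%N)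
    (U : set_system (finsub R)) (hU : UltraFilter U) (fineU : fine_filter U)
    (p : R) (hp : 2 < p)
    (q : 'rV[R]_N -> R) (qC1 : is_Ck 1 q)
    (q_bounded : exists M : R, forall x, `|q x| <= M)
    (Vnet : finsub R -> set ('rV[R]_N -> R[i]))
    (hVnet : approximating_net (Vspace p) Vnet)
    (T : \bar R) (hT : (0 < T)%E)
    (u0 : star U ('rV[R]_N -> R[i])) (hu0 : ulim_set U Vnet u0) :
  exists u : star U (itime T -> ('rV[R]_N -> R[i])),
    [/\ is_GUS (Vspace p) (Vnorm p) (ulim_set U Vnet) (nls_op q p)
          (itime0 hT) u0 u,
        (forall w : star U (itime T -> ('rV[R]_N -> R[i])),
          is_GUS (Vspace p) (Vnorm p) (ulim_set U Vnet) (nls_op q p)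
            (itime0 hT) u0 w -> w = u),
        (forall s t : star U (itime T),
          star_fun (energy q p) (star_app u s) =
          star_fun (energy q p) (star_app u t)) &
        (forall s t : star U (itime T),
          star_fun (Lp_norm 2) (star_app u s) =
          star_fun (Lp_norm 2) (star_app u t))].

Proof.
have FU : Filter U by apply: filter_filter.
have mq := continuous_measurable_pt qC1.1.
have [Vsub _ _] := hVnet.
have fW l := (Vsub l).1; have WV l := (Vsub l).2.
have [v0 [Wv0 ->]] := hu0.
have /choice[us Hus] := fun l => galerkin_exists hp mq q_bounded (fW l) (@WV l) hT (Wv0 l).
(* Every point of the extended time interval is the limit of a net of real times, so each assertion
   reduces to a levelwise one. *)
have tau (t : star U (itime T)) : exists tau, t = ulim U tau.
  by exists (net t); rewrite ulim_net.
exists (ulim U us); split.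
- split.
  + split; first by exists us; split => // l; have [[]] := Hus l.
    move=> t; have [s ->] := tau t; rewrite star_funE !star_appE; split.
      exists (fun l => us l (s l)); split => // l.
      by have [[_ /(_ (s l))[]]] := Hus l.
    exists (fun l => dtime (Vspace p) (Vnorm p) (us l) (s l)); split => // l.
    by have [[_ /(_ (s l))[]]] := Hus l.
  + move=> t _ [v [Wv ->]]; have [s ->] := tau t.
    rewrite (star_funE _ us) (star_appE us s) (star_funE (nls_op q p)) !star_appE star_fun2E.
    by apply/ulim_eqP; apply: filterE => l /=; have [[_ _ -> //]] := Hus l.
  + rewrite star_appE; apply/ulim_eqP; apply: filterE => l /=.
    by have [[_ _ _ ->]] := Hus l.
- move=> w; have [om ->] : exists om, w = ulim U om by exists (net w); rewrite ulim_net.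
  move=> [[C1w Ww] eqw w0].
  have H1 : U [set l | C1 (Vspace p) (Vnorm p) (om l)] by exact: ulim_setP C1w.
  have H2 : U [set l | forall t, Vnet l (om l t) /\
      Vnet l (dtime (Vspace p) (Vnorm p) (om l) t)].
    apply: (near_forall (itime0 hT)) => s.
    have := Ww (ulim U s); rewrite star_funE !star_appE => -[/ulim_setP h1 /ulim_setP h2].
    exact: filterI h1 h2.
  (* Time and test function are joined in a pair so that one use of [near_forall] covers both
     quantifiers. *)
  have H3 : U [set l | forall tv : itime T * ('rV[R]_N -> R[i]), Vnet l tv.2 ->
      L2pair (dtime (Vspace p) (Vnorm p) (om l) tv.1) tv.2 = nls_op q p (om l tv.1) tv.2].
    apply: (near_forall (itime0 hT, 0)) => tv.
    (* A test net must lie in [Vnet l] at every level; where the given function does not, 0 replaces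
       it and the implication to be proved is vacuous. *)
    pose v l := if pselect (Vnet l (tv l).2) then (tv l).2 else 0.
    have Wv : ulim_set U Vnet (ulim U v).
      exists v; split => // l; rewrite /v; case: pselect => [//|nW] /=; exact: findim0.
    have := eqw (ulim U (fun l => (tv l).1)) _ Wv.
    rewrite (star_funE _ om) (star_appE om) (star_funE (nls_op q p)) !star_appE star_fun2E => /ulim_eqP.
    by apply: filterS => l /=; rewrite /v; case: pselect.
  have H4 : U [set l | om l (itime0 hT) = v0 l].
    by move: w0; rewrite star_appE => /ulim_eqP.
  (* On a common set of levels in [U] all four conditions hold; there [om l] solves the level
     problem with datum [v0 l] and equals [us l]. *)
  apply/ulim_eqP; apply: filterS (filterI (filterI H1 H2) (filterI H3 H4)) => l /= [[h1 h2] [h3 h4]].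
  apply: (galerkin_unique hp mq q_bounded (fW l) (@WV l) (v0 := v0 l) (hT := hT)).
    by split => // t v Wv; exact: (h3 (t, v)).
  by have [] := Hus l.
- move=> s t; have [s' ->] := tau s; have [t' ->] := tau t.
  rewrite (star_appE us s') (star_appE us t').
  rewrite (star_funE (energy q p) (fun l => us l (s' l))) (star_funE (energy q p) (fun l => us l (t' l))).
  by apply/ulim_eqP; apply: filterE => l; have [_ H1 H2] := Hus l; exact: H1.
- move=> s t; have [s' ->] := tau s; have [t' ->] := tau t.
  rewrite (star_appE us s') (star_appE us t').
  rewrite (star_funE (Lp_norm 2) (fun l => us l (s' l))) (star_funE (Lp_norm 2) (fun l => us l (t' l))).
  by apply/ulim_eqP; apply: filterE => l; have [_ H1 H2] := Hus l; exact: H2.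
Qed.
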